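(* Let $0<\rho\le1$ and let $a\in S^0_{\rho,0}(n,2)$ be such that for every multi-index $\alpha\in\mathbb{Z}_+^n$ \[ \sup_{x_0,\zeta\in\mathbb{R}^n}\Big(\int_{B_1(x_0)}\int_{\mathbb{R}^n}|\partial_x^\alpha a(x,\zeta-\eta,\eta)|^2\,d\eta\,dx\Big)^{1/2}<\infty, \] where $B_1(x_0)$ is the unit ball centred at $x_0$. Then $T_a$ is bounded from $L^p(\mathbb{R}^n)\times L^q(\mathbb{R}^n)$ to $L^r(\mathbb{R}^n)$ for all $p,q\in[2,\infty]$ and $r\in[1,2]$ with $1/p+1/q=1/r$.
   Context: A symbol $a:\mathbb{R}^n\times\mathbb{R}^n\times\mathbb{R}^n\to\mathbb{C}$ belongs to $S^m_{\rho,\delta}(n,2)$ if for all multi-indices $\alpha,\beta,\gamma\in\mathbb{Z}_+^n$ there is $C_{\alpha,\beta,\gamma}$ with $|\partial_\xi^\alpha\partial_\eta^\beta\partial_x^\gamma a(x,\xi,\eta)|\le C_{\alpha,\beta,\gamma}(1+|\xi|^2+|\eta|^2)^{(m-\rho(|\alpha|+|\beta|)+\delta|\gamma|)/2}$. The bilinear operator is $T_a(f,g)(x)=\int\int a(x,\xi,\eta)\widehat f(\xi)\widehat g(\eta)e^{ix\cdot(\xi+\eta)}d\xi\,d\eta$ for Schwartz $f,g$, with $\widehat f(\xi)=\int f(y)e^{-iy\cdot\xi}dy$; boundedness means $\|T_a(f,g)\|_{L^r}\le C\|f\|_{L^p}\|g\|_{L^q}$ for Schwartz $f,g$. *)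

(* Defs.v *)
From HB Require Import structures.
From mathcomp Require Import all_boot all_order all_algebra.
From mathcomp Require Import all_classical all_reals all_analysis.
From mathcomp Require Import complex.

Set Implicit Arguments.
Unset Strict Implicit.
Unset Printing Implicit Defensive.

Import Order.TTheory GRing.Theory Num.Theory.
Local Open Scope ring_scope.

Section Defs.
Context {R : realType}.
Local Notation C := (R[i]).

Definition cRe (z : C) : R := complex.Re z.
Definition cIm (z : C) : R := complex.Im z.
Definition cabs (z : C) : R := Num.sqrt (cRe z ^+ 2 + cIm z ^+ 2).
Definition cexpi (t : R) : C := Complex (cos t) (sin t).
Definition cofR (t : R) : C := Complex t 0.

Definition dotv n (x y : 'rV[R]_n) : R := \sum_(i < n) x 0 i * y 0 i.
Definition enorm n (x : 'rV[R]_n) : R := Num.sqrt (dotv x x).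
Definition mabs n (alpha : 'I_n -> nat) : nat := \sum_(i < n) alpha i.
Definition vmon n (x : 'rV[R]_n) (alpha : 'I_n -> nat) : R :=
  \prod_(i < n) x 0 i ^+ alpha i.
Definition coordv n (i : 'I_n) : 'rV[R]_n := delta_mx 0 i.

Definition cderive (X : normedModType R) (v : X) (F : X -> C) : X -> C :=
  fun x => Complex ('D_v (cRe \o F) x) ('D_v (cIm \o F) x).

Definition smoothC (X : normedModType R) (F : X -> C) : Prop :=
  forall s : seq X,
    let G := foldr (fun v H => cderive v H) F s in
    (forall (v x : X), derivable (cRe \o G) x v /\ derivable (cIm \o G) x v)
    /\ continuous (fun x : X => (cRe (G x) : R^o)) /\ continuous (fun x : X => (cIm (G x) : R^o)).

Definition Dmulti (X : normedModType R) n (e : 'I_n -> X)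
    (alpha : 'I_n -> nat) (F : X -> C) : X -> C :=
  foldr (fun i H => iter (alpha i) (cderive (e i)) H) F (enum 'I_n).

Definition uncurry3 n (a : 'rV[R]_n -> 'rV[R]_n -> 'rV[R]_n -> C)
    (t : 'rV[R]_n * 'rV[R]_n * 'rV[R]_n) : C := a t.1.1 t.1.2 t.2.
Definition e_x n (i : 'I_n) : 'rV[R]_n * 'rV[R]_n * 'rV[R]_n :=
  (coordv i, 0, 0).
Definition e_xi n (i : 'I_n) : 'rV[R]_n * 'rV[R]_n * 'rV[R]_n :=
  (0, coordv i, 0).
Definition e_eta n (i : 'I_n) : 'rV[R]_n * 'rV[R]_n * 'rV[R]_n :=
  (0, 0, coordv i).

Definition symbol_class n (m rho delta : R)
    (a : 'rV[R]_n -> 'rV[R]_n -> 'rV[R]_n -> C) : Prop :=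
  smoothC (uncurry3 a) /\
  forall alpha beta gamma : 'I_n -> nat, exists K : R,
    forall x xi eta : 'rV[R]_n,
      cabs (Dmulti (@e_xi n) alpha (Dmulti (@e_eta n) beta
              (Dmulti (@e_x n) gamma (uncurry3 a))) (x, xi, eta))
      <= K * powR (1 + enorm xi ^+ 2 + enorm eta ^+ 2)
               ((m - rho * (mabs alpha + mabs beta)%:R
                   + delta * (mabs gamma)%:R) / 2).

Definition schwartz n (f : 'rV[R]_n -> C) : Prop :=
  smoothC f /\
  forall alpha beta : 'I_n -> nat, exists K : R, forall x : 'rV[R]_n,
    cabs (cofR (vmon x alpha) * Dmulti (@coordv n) beta f x) <= K.

(* ---------- Lebesgue integration on R^n (iterated, coordinate by
   coordinate, w.r.t. one-dimensional Lebesgue measure) ---------- *)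
Definition vcons n (t : R) (y : 'rV[R]_n) : 'rV[R]_n.+1 :=
  \row_(j < n.+1) (if unlift ord0 j is Some k then y 0 k else t).

Fixpoint Nint (n : nat) : ('rV[R]_n -> \bar R) -> \bar R :=
  match n with
  | 0 => fun h => h 0
  | n'.+1 => fun h =>
      (\int[@lebesgue_measure R]_(t in setT) Nint (fun y => h (vcons t y)))%E
  end.

Fixpoint Rint (n : nat) : ('rV[R]_n -> R) -> R :=
  match n with
  | 0 => fun h => h 0
  | n'.+1 => fun h =>
      Rintegral (@lebesgue_measure R) setT (fun t => Rint (fun y => h (vcons t y)))
  end.

Definition cint n (h : 'rV[R]_n -> C) : C :=
  Complex (Rint (cRe \o h)) (Rint (cIm \o h)).

Definition lebn n (A : set 'rV[R]_n) : \bar R := Nint (fun x => (\1_A x)%:E).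

Definition esssup n (f : 'rV[R]_n -> C) : \bar R :=
  ereal_inf [set M : \bar R | lebn [set x | (M < (cabs (f x))%:E)%E] = 0%E].

Definition Lpnorm n (p : \bar R) (f : 'rV[R]_n -> C) : \bar R :=
  match p with
  | EFin r => poweR (Nint (fun x => (powR (cabs (f x)) r)%:E)) r^-1
  | +oo%E => esssup f
  | -oo%E => 0%E
  end.

Definition einv (p : \bar R) : R :=
  match p with EFin r => r^-1 | _ => 0 end.

Definition fourier n (f : 'rV[R]_n -> C) (xi : 'rV[R]_n) : C :=
  cint (fun y => f y * cexpi (- dotv y xi)).

Definition Tbil n (a : 'rV[R]_n -> 'rV[R]_n -> 'rV[R]_n -> C)
    (f g : 'rV[R]_n -> C) (x : 'rV[R]_n) : C :=
  cint (fun xi => cint (fun eta =>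
    a x xi eta * fourier f xi * fourier g eta * cexpi (dotv x (xi + eta)))).

End Defs.

(* Main.v *)
(* The operator is studied through windows of unit size: with the weight
   [wt x = prod_i 1 / (1 + x_i^2)] the claim reduces to the local L^2 estimate

     int |wt^N T_a(f, g)|^2 (x + k) dx <= C (wt^2 * |f|^2)(k) (wt^2 * |g|^2)(k),

   uniformly in [k]: integrating in [k], Hoelder's inequality in [x] (r <= 2), Hoelder's
   inequality in [k] with exponents p/r and q/r, and Jensen's inequality (p, q >= 2) give
   the L^p x L^q -> L^r bound.

   For the local estimate, write f(. + k) = wt^-2 (wt^2 f(. + k)). The polynomial wt^-2
   becomes a differential operator on the Fourier side, and integrating by parts in xi and
   eta moves it to the symbol, at the price of powers of x which wt^N absorbs. It remains
   to bound an operator with amplitude Phi(x, xi, eta) decaying in x, acting on U = u v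
   with u, v the transforms of the windowed functions. In its T T^* kernel, integrating by
   parts in x produces the factor wt((xi + eta) - (xi' + eta')), so Schur's test in the
   variable zeta = xi + eta followed by Cauchy-Schwarz on the slices (zeta - eta, eta)
   leaves exactly the hypothesis on the L^2 norms of a over slices, applied to derivatives
   of a. For mixed derivatives this hypothesis is recovered by interpolation: derivatives
   of high order in (xi, eta) are square integrable on slices since rho > 0, and a
   derivative of lower order is controlled by a finite difference of the function and by
   the next derivative. The L^2 norms of u and v are bounded without Plancherel, by
   duality and the same T T^* argument. *)
Require Import Defs.
From HB Require Import structures.
From mathcomp Require Import all_boot all_order all_algebra.
From mathcomp Require Import all_classical all_reals all_analysis measurable_realfun.
From mathcomp Require Import complex ring lra.
Import Order.TTheory GRing.Theory Num.Theory.
Import numFieldNormedType.Exports.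
Set Implicit Arguments.
Unset Strict Implicit.
Unset Printing Implicit Defensive.
Local Open Scope classical_set_scope.
Local Open Scope ring_scope.

(** * Lebesgue measure on row vectors *)

(** Bounds [K * wt] on Schwartz functions and on their transforms have constants depending on [f],
    [g] and [k]. They serve only absolute convergence, Fubini and the finiteness needed to absorb a
    term. The constants of the theorem come from the amplitudes alone, so the amplitudes produced by
    each integration by parts are chosen before [f], [g], [k] and the frequencies. Uniformity in [k]
    holds because the hypothesis takes a supremum over all centres [x0] and hence does not see
    translations in [x]. The obstacle is that the integrations by parts in the frequencies and in
    [x] together produce mixed derivatives of [a], whereas the hypothesis concerns derivatives in
    [x] only. Two facts make the interpolation possible: with [delta = 0], derivatives in [x] do not
    spoil the decay gained from frequency derivatives; and a translation of the frequencies changes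
    a slice only through its [zeta]. *)

Definition rv_display : measure_display.
Proof. exact: default_measure_display. Qed.

Section rv_measurable.
Context {R : realType} (n : nat).

(** Generated by the coordinates and not by the open sets: maps into row vectors are then tested
    coordinatewise, and continuous functions are shown to be measurable separately, through
    [approximable]. *)
Definition rv_gen : set (set 'rV[R]_n) :=
  [set A | exists (i : 'I_n) (B : set R), measurable B /\ A = [set x : 'rV[R]_n | B (x 0 i)]].

HB.instance Definition _ := @isMeasurable.Build rv_display 'rV[R]_n
  <<s rv_gen >> (@sigma_algebra0 _ _ _) (@sigma_algebraC _ _)
  (@sigma_algebra_bigcup _ _ _).

Lemma measurable_coord (i : 'I_n) :
  measurable_fun setT (fun x : 'rV[R]_n => x 0 i).
Proof.
move=> _ B mB; rewrite setTI; apply: sub_sigma_algebra.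
by exists i, B.
Qed.

Lemma measurable_rvP d (T : measurableType d) (f : T -> 'rV[R]_n) :
  measurable_fun setT f <->
  forall i, measurable_fun setT (fun t => f t 0 i).
Proof.
split=> [mf i|mf].
  exact: (measurableT_comp (measurable_coord i) mf).
suff : (@measurable _ 'rV[R]_n) `<=` [set A | measurable (f @^-1` A)].
  by move=> H _ A mA; rewrite setTI; exact: H.
apply: smallest_sub => /=.
  split; first by rewrite /= preimage_set0.
    move=> A /= mA; rewrite setTD preimage_setC; exact: measurableC.
  move=> F mF /=; rewrite preimage_bigcup; exact: bigcupT_measurable.
move=> _ [i [B [mB ->]]] /=.
by have := mf i measurableT B mB; rewrite setTI.
Qed.

End rv_measurable.

Section cons_measurable.
Context {R : realType}.

Lemma vcons0 n (t : R) (y : 'rV[R]_n) : vcons t y 0 0 = t.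
Proof. by rewrite mxE unlift_none. Qed.

Lemma vconsS n (t : R) (y : 'rV[R]_n) i : vcons t y 0 (lift ord0 i) = y 0 i.
Proof. by rewrite mxE liftK. Qed.

Definition vtail n (x : 'rV[R]_n.+1) : 'rV[R]_n := \row_i x 0 (lift ord0 i).

Lemma vtail_cons n (t : R) (y : 'rV[R]_n) : vtail (vcons t y) = y.
Proof. by apply/rowP => i; rewrite mxE vconsS. Qed.

Lemma measurable_vcons n :
  measurable_fun setT (fun p : measurableTypeR R * 'rV[R]_n => vcons p.1 p.2).
Proof.
apply/measurable_rvP => i; case: (unliftP ord0 i) => [j ->|->].
  under eq_fun do rewrite vconsS.
  exact: (measurableT_comp (measurable_coord j) measurable_snd).
under eq_fun do rewrite vcons0.
exact: measurable_fst.
Qed.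

Lemma measurable_split n :
  measurable_fun setT (fun x : 'rV[R]_n.+1 => (x 0 0, vtail x)).
Proof.
apply: measurable_fun_pair; first exact: measurable_coord.
apply/measurable_rvP => i.
under eq_fun do rewrite mxE.
exact: measurable_coord.
Qed.

End cons_measurable.

Section prodm.
Context d1 d2 (T1 : measurableType d1) (T2 : measurableType d2) (R : realType).
Variable m1 : {sigma_finite_measure set T1 -> \bar R}.
Variable m2 : {sigma_finite_measure set T2 -> \bar R}.

(* The library product [m1 \x m2] has no sigma-finite instance; this copy receives one. *)
Definition prodm : set (T1 * T2) -> \bar R := (m1 \x m2)%E.

HB.instance Definition _ := Measure.on prodm.

Let prodm_sigma_finite : sigma_finite setT prodm.
Proof.
have /sigma_finiteP[F [TF ndF Foo]] := sigma_finiteT m1.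
have /sigma_finiteP[G [TG ndG Goo]] := sigma_finiteT m2.
exists (fun n => F n `*` G n).
  rewrite -setXTT TF TG predeqE => -[x y]; split; last first.
    by move=> [n _ []/= ? ?]; split; exists n.
  move=> [/= [n _ Fnx] [k _ Gky]]; exists (maxn n k) => //; split.
    by move: x Fnx; exact/subsetPset/ndF/leq_maxl.
  by move: y Gky; exact/subsetPset/ndG/leq_maxr.
move=> k; have [? ?] := Foo k; have [? ?] := Goo k.
split; first exact: measurableX.
by rewrite /prodm product_measure1E// lte_mul_pinfty// ge0_fin_numE.
Qed.

HB.instance Definition _ := Measure_isSigmaFinite.Build _ _ _ prodm
  prodm_sigma_finite.

End prodm.

Section rv_measure.
Context {R : realType}.

Section step.
Variables (n : nat) (m : {sigma_finite_measure set 'rV[R]_n -> \bar R}).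

Let pm := prodm (@lebesgue_measure R) m.
Let vc := (fun p : measurableTypeR R * 'rV[R]_n => vcons p.1 p.2).

Let mvc : measurable_fun setT vc.
Proof. exact: measurable_vcons. Qed.

(** One step of the recursion of [Nint]: the first coordinate carries Lebesgue measure, the others
    [m]. Pushing the product forward along [vcons] lets Tonelli identify integrals against
    [rv_measure] with the iterated integrals of the definitions. *)
Definition mstep : set 'rV[R]_n.+1 -> \bar R := pushforward pm vc.

Let mstep0 : mstep set0 = 0%E.
Proof. by rewrite /mstep /pushforward preimage_set0; apply: measure0. Qed.
Let mstep_ge0 A : (0 <= mstep A)%E. Proof. exact: measure_ge0. Qed.
Let mstep_sigma_additive : semi_sigma_additive mstep.
Proof.
move=> F mF tF mUF; rewrite /mstep /pushforward preimage_bigcup.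
apply: measure_semi_sigma_additive.
- by move=> k; rewrite -[X in measurable X]setTI; exact: mvc.
- apply/trivIsetP => /= i j _ _ ij; rewrite -preimage_setI.
  by move/trivIsetP : tF => /(_ i j Logic.I Logic.I ij) ->; rewrite preimage_set0.
- by rewrite -preimage_bigcup -[X in measurable X]setTI; exact: mvc.
Qed.
HB.instance Definition _ := isMeasure.Build _ _ _ mstep
  mstep0 mstep_ge0 mstep_sigma_additive.

Let mstep_sf : sigma_finite setT mstep.
Proof.
have [F TF Foo] := sigma_finiteT pm.
(* The exhausting sets are transported by splitting off the head, which inverts [vcons]. *)
exists (fun k => (fun x : 'rV[R]_n.+1 => (x 0 0, vtail x)) @^-1` F k).
  by rewrite -preimage_bigcup -TF preimage_setT.
move=> i; have [mFi Fioo] := Foo i; split.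
  rewrite -[X in measurable X]setTI; exact: measurable_split.
rewrite /mstep /pushforward (_ : vc @^-1` _ = F i)//.
apply/seteqP; split=> -[t y]; rewrite /vc /= ?vcons0 ?vtail_cons//.
Qed.
HB.instance Definition _ := Measure_isSigmaFinite.Build _ _ _ mstep mstep_sf.
End step.

Definition m0 : set 'rV[R]_0 -> \bar R := dirac (0 : 'rV[R]_0).
HB.instance Definition _ := Measure.on m0.
Let m0_sf : sigma_finite setT m0.
Proof. apply: fin_num_fun_sigma_finite; [by rewrite measure0|]. 
  by move=> A _; rewrite /m0 diracE.
Qed.
HB.instance Definition _ := Measure_isSigmaFinite.Build _ _ _ m0 m0_sf.

Fixpoint rv_measure (n : nat) : {sigma_finite_measure set 'rV[R]_n -> \bar R} :=
  match n with
  | 0 => m0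
  | n'.+1 => mstep (rv_measure n')
  end.
End rv_measure.

(** * Translation and reflection invariance of the measure *)

Section lebesgue_shift.
Context {R : realType}.
Local Open Scope ereal_scope.
Notation leb := (@lebesgue_measure R).

Let addc (c : R) := fun x : measurableTypeR R => (x + c)%R : measurableTypeR R.
Let oppc := fun x : measurableTypeR R => (- x)%R : measurableTypeR R.

Let measurable_addc (c : R) : measurable_fun setT (addc c).
Proof. exact: (@measurable_funD _ _ _ setT id (cst c)). Qed.

Let measurable_oppc : measurable_fun setT oppc.
Proof. exact: (@measurable_funN _ _ _ setT id). Qed.

(** Uniqueness of Lebesgue measure reduces the claim to half-open intervals, where both sides are
    the length. *)
Lemma lebesgue_measureD (c : R) (A : set R) : measurable A ->
  pushforward leb (addc c) A = leb A.
Proof.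
move=> mA; apply/esym.
pose fM := isMeasurableFun.Build _ _ _ _ (addc c) (measurable_addc c).
pose f' : {mfun measurableTypeR R >-> measurableTypeR R} := HB.pack (addc c) fM.
apply: (@lebesgue_measure_unique R (measure_function_pushforward__canonical__measure_function_Measure leb (measurable_addc c))) => //=.
move=> _ [[a b]] _ <-.
rewrite /pushforward (_ : _ @^-1` _ = `](a - c)%R, (b - c)%R]%classic); last first.
  by apply/seteqP; split => x /=; rewrite /addc !in_itv/= ltrBlDr lerBrDr.
rewrite !lebesgue_measure_itv/= !lte_fin ltrD2r.
by case: ifP => // _; rewrite -!EFinB; congr EFin; ring.
Qed.

Lemma ge0_integral_lebD (c : R) (f : R -> \bar R) :
  measurable_fun setT f -> (forall x, 0 <= f x) ->
  \int[leb]_x f (x + c)%R = \int[leb]_x f x.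
Proof.
move=> mf f0.
have := @ge0_integral_pushforward _ _ _ _ R (addc c) (measurable_addc c) leb setT f measurableT mf (fun y _ => f0 y).
rewrite preimage_setT => <-.
by apply: eq_measure_integral => A mA _; exact: lebesgue_measureD.
Qed.

Lemma ge0_integral_lebN (f : R -> \bar R) :
  measurable_fun setT f -> (forall x, 0 <= f x) ->
  \int[leb]_x f (- x)%R = \int[leb]_x f x.
Proof.
move=> mf f0.
have := @ge0_integral_pushforward _ _ _ _ R oppc measurable_oppc leb setT f measurableT mf (fun y _ => f0 y).
rewrite preimage_setT => <-.
by apply: eq_measure_integral => A mA _; exact: lebesgue_measureN.
Qed.
End lebesgue_shift.

Section rv_integral.
Context {R : realType}.
Local Open Scope ereal_scope.
Notation leb := (@lebesgue_measure R).
Notation mu := (@rv_measure R).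

Lemma measurable_vcons_r n (t : R) :
  measurable_fun setT (fun y : 'rV[R]_n => vcons t y).
Proof.
apply/measurable_rvP => i; case: (unliftP ord0 i) => [j ->|->].
  under eq_fun do rewrite vconsS.
  exact: measurable_coord.
under eq_fun do rewrite vcons0.
exact: measurable_cst.
Qed.

Lemma ge0_integral_rvS n (f : 'rV[R]_n.+1 -> \bar R) :
  measurable_fun setT f -> (forall x, 0 <= f x) ->
  \int[mu n.+1]_x f x = \int[leb]_t \int[mu n]_y f (vcons t y).
Proof.
move=> mf f0.
have := @ge0_integral_pushforward _ _ _ _ R _ (@measurable_vcons R n) (prodm leb (mu n)) setT f measurableT mf (fun y _ => f0 y).
rewrite preimage_setT => ->.
have mF := measurableT_comp mf (@measurable_vcons R n).
by have := @fubini_tonelli1 _ _ _ _ R leb (mu n) _ mF (fun p => f0 _).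
Qed.

(** Tonelli in each coordinate. No finiteness is assumed, so the possibly infinite quantities in the
    hypothesis on [a] and in [Lpnorm] are covered. *)
Lemma NintE n (f : 'rV[R]_n -> \bar R) :
  measurable_fun setT f -> (forall x, 0 <= f x) -> Nint f = \int[mu n]_x f x.
Proof.
elim: n f => [|n IH] f mf f0 /=.
  by rewrite integral_dirac// diracT mul1e.
rewrite ge0_integral_rvS//; apply: eq_integral => t _.
rewrite IH//.
exact: (measurableT_comp mf (measurable_vcons_r t)).
Qed.

Lemma measurable_rvD n (v : 'rV[R]_n) : measurable_fun setT (fun x : 'rV[R]_n => x + v)%R.
Proof.
apply/measurable_rvP => i; under eq_fun do rewrite mxE.
apply: measurable_funD => //; exact: measurable_coord.
Qed.

Lemma measurable_rvN n : measurable_fun setT (fun x : 'rV[R]_n => - x)%R.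
Proof.
apply/measurable_rvP => i; under eq_fun do rewrite mxE.
apply: measurable_funN; exact: measurable_coord.
Qed.

Lemma vconsD n t (y : 'rV[R]_n) v : (vcons t y + v = vcons (t + v 0 0) (y + vtail v))%R.
Proof.
apply/rowP => i; rewrite mxE; case: (unliftP ord0 i) => [j ->|->].
  by rewrite !vconsS !mxE.
by rewrite !vcons0.
Qed.

Lemma vconsN n t (y : 'rV[R]_n) : (- vcons t y = vcons (- t) (- y))%R.
Proof.
apply/rowP => i; rewrite mxE; case: (unliftP ord0 i) => [j ->|->].
  by rewrite !vconsS !mxE.
by rewrite !vcons0.
Qed.

Lemma ge0_integral_rvD n (v : 'rV[R]_n) (f : 'rV[R]_n -> \bar R) :
  measurable_fun setT f -> (forall x, 0 <= f x) ->
  \int[mu n]_x f (x + v)%R = \int[mu n]_x f x.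
Proof.
elim: n v f => [|n IH] v f mf f0.
  by apply: eq_integral => x _; congr f; apply/rowP => -[].
rewrite !ge0_integral_rvS//; last exact: (measurableT_comp mf (measurable_rvD v)).
under eq_integral => t _.
  under eq_integral do rewrite vconsD.
  rewrite (IH (vtail v) (fun y => f (vcons (t + v 0 0)%R y)))//; last first.
    exact: (measurableT_comp mf (measurable_vcons_r _)).
  over.
apply: (@ge0_integral_lebD _ _ (fun t => \int[mu n]_x f (vcons t x))).
  have mF := measurableT_comp mf (@measurable_vcons R n).
  exact: (@measurable_fun_fubini_tonelli_F _ _ _ _ R (mu n) _ mF (fun p => f0 _)).
by move=> x; exact: integral_ge0.
Qed.

Lemma ge0_integral_rvN n (f : 'rV[R]_n -> \bar R) :
  measurable_fun setT f -> (forall x, 0 <= f x) ->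
  \int[mu n]_x f (- x)%R = \int[mu n]_x f x.
Proof.
elim: n f => [|n IH] f mf f0.
  by apply: eq_integral => x _; congr f; apply/rowP => -[].
rewrite !ge0_integral_rvS//; last exact: (measurableT_comp mf (@measurable_rvN _)).
under eq_integral => t _.
  under eq_integral do rewrite vconsN.
  rewrite (IH (fun y => f (vcons (- t)%R y)))//; last first.
    exact: (measurableT_comp mf (measurable_vcons_r _)).
  over.
apply: (@ge0_integral_lebN _ (fun t => \int[mu n]_x f (vcons t x))).
  have mF := measurableT_comp mf (@measurable_vcons R n).
  exact: (@measurable_fun_fubini_tonelli_F _ _ _ _ R (mu n) _ mF (fun p => f0 _)).
by move=> x; exact: integral_ge0.
Qed.

Lemma measurable_prod_coord n (g : R -> R) : measurable_fun setT g ->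
  measurable_fun setT (fun x : 'rV[R]_n => \prod_(i < n) g (x 0 i))%R.
Proof.
move=> mg; apply: measurable_prod => i _.
exact: (measurableT_comp mg (measurable_coord i)).
Qed.

(** Serves twice: for the total mass of [wt], and for the volume of a cube contained in the unit
    ball. *)
Lemma integral_prod_coord n (g : R -> R) : measurable_fun setT g ->
  (forall t, 0 <= g t)%R ->
  \int[mu n]_x (\prod_(i < n) g (x 0 i))%:E = (\int[leb]_t (g t)%:E) ^+ n.
Proof.
move=> mg g0; elim: n => [|n IH].
  have := @integral_dirac _ 'rV[R]_0 0%R R setT measurableT (fun x => (\prod_(i < 0) g (x 0 i))%:E).
  rewrite big_ord0 diracT mul1e => -> //; last first.
    by apply/measurable_EFinP; exact: measurable_prod_coord.
rewrite ge0_integral_rvS//; last 2 first.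
- by apply/measurable_EFinP; exact: measurable_prod_coord.
- by move=> x; rewrite lee_fin prodr_ge0.
under eq_integral => t _.
  under eq_integral => y _.
    rewrite big_ord_recl vcons0 EFinM.
    under eq_bigr do rewrite vconsS.
    over.
  rewrite ge0_integralZl//; last 3 first.
  - by apply/measurable_EFinP; exact: measurable_prod_coord.
  - by move=> x _; rewrite lee_fin prodr_ge0.
  - by rewrite lee_fin.
  rewrite IH.
  over.
have mgE : measurable_fun setT (EFin \o g) by apply/measurable_EFinP.
rewrite ge0_integralZr//; last 2 first.
- by move=> t _; rewrite lee_fin.
- by apply: expe_ge0; apply: integral_ge0 => *; rewrite lee_fin.
by rewrite expeS.
Qed.

End rv_integral.

(** * Measurability of continuous functions on products of row vectors *)

Section approx.
Context {R : realType}.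

Lemma measurable_pickle d (T : measurableType d) (C : countType) (g : T -> C) j :
  (forall c, measurable [set t | g t = c]) ->
  measurable [set t | pickle (g t) = j].
Proof.
move=> mg.
case: (boolP `[< exists c : C, pickle c = j >]) => [/asboolP[c cj]|/asboolPn nj].
  rewrite (_ : [set _ | _] = [set t | g t = c])//.
  apply/seteqP; split=> t /= => [|->//].
  by rewrite -cj => /(pcan_inj pickleK).
rewrite (_ : [set _ | _] = set0)//; apply/seteqP; split=> // t /= gj.
by apply: nj; exists (g t).
Qed.

(* The value set of each approximant is countable, so measurability only needs
   the fibres; no second countability of the target is used. *)
Definition approximable d (T : measurableType d) (X : topologicalType)
    (phi : T -> X) :=
  exists (C : countType) (k : nat -> T -> C) (e : nat -> C -> X),
    (forall m c, measurable [set t | k m t = c]) /\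
    forall t, (fun m => e m (k m t)) @ \oo --> phi t.

(** Each [F (e m (k m t))] factors through a countable set, hence is measurable, and continuity of
    [F] makes these functions converge pointwise to [F (phi t)]. *)
Lemma approximable_measurable d (T : measurableType d) (X : topologicalType)
  (phi : T -> X) (F : X -> R) :
  approximable phi -> continuous F -> measurable_fun setT (fun t => F (phi t)).
Proof.
move=> [C [k [e [mk ek]]]] cF.
apply: (@measurable_fun_cvg _ _ _ _ (fun m t => F (e m (k m t)))) => //.
- move=> m _ B mB; rewrite setTI.
  rewrite [X in measurable X](_ : _ = \bigcup_(j in [set j | exists2 c : C, pickle c = j & B (F (e m c))]) [set t | pickle (k m t) = j]).
    by apply: bigcup_measurable => j _; exact: measurable_pickle.
  apply/seteqP; split => [t Bt|t [j /= [c <- Bc]] /(pcan_inj pickleK) -> //].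
  by exists (pickle (k m t)) => //; exists (k m t).
- move=> t _; apply: (@cvg_comp _ _ _ (fun m => e m (k m t)) F _ (nbhs (phi t))); first exact: ek.
  exact: cF.
Qed.

Lemma approximable_pair d (T : measurableType d) (X Y : topologicalType)
  (phi : T -> X) (psi : T -> Y) :
  approximable phi -> approximable psi -> approximable (fun t => (phi t, psi t)).
Proof.
move=> [C [k [e [mk ek]]]] [C' [k' [e' [mk' ek']]]].
exists (C * C')%type, (fun m t => (k m t, k' m t)), (fun m c => (e m c.1, e' m c.2)).
split.
  move=> m [a b].
  rewrite (_ : [set _ | _] = [set t | k m t = a] `&` [set t | k' m t = b]).
    exact: measurableI.
  by apply/seteqP; split=> t /= => [[]|[-> ->]].
by move=> t; apply: cvg_pair => /=; [exact: ek|exact: ek'].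
Qed.

Lemma approximable_real d (T : measurableType d) (c : T -> R) :
  measurable_fun setT c -> approximable c.
Proof.
move=> mc.
(* Rounding down to multiples of [1 / m.+1]; the error is at most [1 / m.+1]. *)
exists int, (fun m t => Num.floor (m.+1%:R * c t)), (fun m z => z%:~R / m.+1%:R).
split.
  move=> m z.
  rewrite (_ : [set _ | _] = c @^-1` `[z%:~R / m.+1%:R, (z + 1)%:~R / m.+1%:R[%classic).
    by rewrite -[X in measurable X]setTI; exact: mc.
  apply/seteqP; split=> t /=; rewrite in_itv/= ler_pdivrMr// ltr_pdivlMr// (mulrC (c t)).
    by move=> <-; exact: floor_itv.
  exact: floor_def.
move=> t; apply/cvgrPdist_le => /= eps eps0.
near=> m.
set y := c t.
have /andP[h1 h2] := floor_itv (m.+1%:R * y).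
rewrite intrD in h2.
have m0 : 0 < m.+1%:R :> R by [].
have -> : y - (Num.floor (m.+1%:R * y))%:~R / m.+1%:R = (m.+1%:R * y - (Num.floor (m.+1%:R * y))%:~R) / m.+1%:R.
  by field; rewrite nat1r.
rewrite normrM ger0_norm ?subr_ge0// normfV ger0_norm// ler_pdivrMr//.
rewrite (@le_trans _ _ 1)//; first by rewrite lerBlDr addrC ltW.
rewrite -ler_pdivrMl// mulr1 (@le_trans _ _ m%:R)// ?ler_nat//.
near: m.
exact: nbhs_infty_ger.
Unshelve. all: by end_near. Qed.

Lemma cvg_rv n (u : nat -> 'rV[R]_n) (l : 'rV[R]_n) :
  (forall i, (fun m => u m 0 i) @ \oo --> l 0 i) -> u @ \oo --> l.
Proof.
move=> ul A [P lP PA].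
rewrite nbhs_filterE; apply: filterS (_ : \forall m \near \oo, forall i, P 0 i (u m 0 i)).
  by move=> m Pm; apply: PA => i j; rewrite ord1.
by apply: filter_forall => i; apply: ul; exact: lP.
Qed.

Lemma approximable_rv d (T : measurableType d) n (c : T -> 'rV[R]_n) :
  measurable_fun setT c -> approximable c.
Proof.
move=> /measurable_rvP mc.
have ax i : approximable (fun t => c t 0 i) by exact: approximable_real.
(* The coordinates may be approximated through different countable types. Encoding all of them in
   [nat] by [pickle] allows them to be assembled into a single finite function. *)
have /choice[C' /choice[f' H]] : forall i : 'I_n, exists C : (nat -> T -> nat), exists e : nat -> nat -> R,
  (forall m c, measurable [set t | C m t = c]) /\ forall t, (fun m => e m (C m t)) @ \oo --> c t 0 i.
  move=> i; have [C [k' [e [mk ek]]]] := ax i.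
  exists (fun m t => pickle (k' m t)), (fun m j => if @unpickle C j is Some z then e m z else 0).
  split; first by move=> m j; exact: measurable_pickle.
  move=> t; rewrite (_ : (fun _ => _) = (fun m => e m (k' m t)))//.
  by apply/funext => m; rewrite pickleK.
exists {ffun 'I_n -> nat}, (fun m t => [ffun i => C' i m t]),
  (fun m (g : {ffun 'I_n -> nat}) => \row_i f' i m (g i)).
split.
  move=> m g.
  rewrite (_ : [set _ | _] = \big[setI/setT]_(i < n) [set t | C' i m t = g i]).
    by apply: bigsetI_measurable => i _; have [+ _] := H i; exact.
  rewrite -bigcap_seq; apply/seteqP; split=> t /=.
    by move=> <- i _ /=; rewrite ffunE.
  move=> gt; apply/ffunP => i; rewrite ffunE; apply: gt => /=; exact: mem_index_enum.
move=> t; apply: cvg_rv => i.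
rewrite (_ : (fun _ => _) = (fun m => f' i m (C' i m t))).
  by have [_ +] := H i; exact.
by apply/funext => m; rewrite mxE ffunE.
Qed.

End approx.

(** * The weight *)

Section weight.
Context {R : realType}.
Notation mu := (@rv_measure R).
Notation leb := (@lebesgue_measure R).

Definition wt1 (t : R) : R := (1 + t ^+ 2)^-1.
(** A product of one-variable factors instead of a power of [1 + |x|^2]: it is integrable in every
    dimension without adjusting an exponent, it splits along [vcons], and its inverse is a
    polynomial that can be removed one coordinate at a time. *)
Definition wt n (x : 'rV[R]_n) : R := \prod_(i < n) wt1 (x 0 i).

Lemma one_sqr_gt0 (t : R) : 0 < 1 + t ^+ 2.
Proof. by rewrite ltr_pwDl// sqr_ge0. Qed.

Lemma wt1_gt0 t : 0 < wt1 t.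
Proof. by rewrite invr_gt0 one_sqr_gt0. Qed.

Lemma wt1_le1 t : wt1 t <= 1.
Proof. by rewrite invf_le1 ?one_sqr_gt0// lerDl sqr_ge0. Qed.

Lemma wt_gt0 n (x : 'rV[R]_n) : 0 < wt x.
Proof. by apply: prodr_gt0 => i _; exact: wt1_gt0. Qed.

Lemma wt_ge0 n (x : 'rV[R]_n) : 0 <= wt x.
Proof. exact/ltW/wt_gt0. Qed.

Lemma wt_le1 n (x : 'rV[R]_n) : wt x <= 1.
Proof.
by apply: prodr_ile1 => i _; rewrite wt1_le1 ltW// wt1_gt0.
Qed.

Lemma continuous_wt1 : continuous wt1.
Proof.
move=> t; apply: cvgV; first by rewrite gt_eqF// one_sqr_gt0.
apply: cvgD; first exact: cvg_cst.
exact: exprn_continuous.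
Qed.

Lemma measurable_wt1 : measurable_fun setT wt1.
Proof. exact: continuous_measurable_fun continuous_wt1. Qed.

Lemma measurable_wt n : measurable_fun setT (@wt n).
Proof. exact: measurable_prod_coord measurable_wt1. Qed.

Lemma integral_wt1_fin : (\int[leb]_t (wt1 t)%:E \is a fin_num)%E.
Proof.
(* The arctangent is a primitive of [wt1], so each half-line contributes [pi / 2]. *)
have half : (\int[leb]_(t in `[0%R, +oo[) (wt1 t)%:E = (pi / 2 - 0)%:E)%E.
  rewrite -{2}(@atan0 R) EFinB.
  apply: ge0_continuous_FTC2y.
  - by move=> x _; rewrite ltW// wt1_gt0.
  - exact/continuous_subspaceT/continuous_wt1.
  - exact: cvgy_atan.
  - by move=> x _; exact: derivable_atan.
  - by apply: cvg_at_right_filter; exact: continuous_atan.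
  - by move=> x _; rewrite derive1_atan.
have mE : measurable_fun setT (EFin \o wt1) by apply/measurable_EFinP; exact: measurable_wt1.
have halfN : (\int[leb]_(t in `]-oo, 0%R]) (wt1 t)%:E = (pi / 2 - 0)%:E)%E.
  rewrite -half (@ge0_integration_by_substitution0 _ (EFin \o wt1))//; last first.
    by move=> r; rewrite lee_fin ltW// wt1_gt0.
  by apply: eq_integral => t _; rewrite /wt1 /= sqrrN.
rewrite ge0_fin_numE; last by apply: integral_ge0 => *; rewrite lee_fin ltW// wt1_gt0.
rewrite -integral_itv_obnd_cbnd in half; last exact: measurable_funTS.
rewrite -(setUv `]-oo, (0:R)%R]%classic) setCitvl ge0_integral_setU//.
- by rewrite halfN half -EFinD ltry.
- exact: measurable_funTS.
- by move=> *; rewrite lee_fin ltW// wt1_gt0.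
- by rewrite -setCitvl; apply/disj_setPCl.
Qed.

End weight.

(** * Complex-valued integrals *)

Section cplx.
Context {R : realType}.
Notation C := R[i].
Implicit Types z w : C.

Lemma cReD z w : cRe (z + w) = cRe z + cRe w. Proof. by case: z w => [? ?] [? ?]. Qed.
Lemma cImD z w : cIm (z + w) = cIm z + cIm w. Proof. by case: z w => [? ?] [? ?]. Qed.
Lemma cReN z : cRe (- z) = - cRe z. Proof. by case: z => [? ?]. Qed.
Lemma cImN z : cIm (- z) = - cIm z. Proof. by case: z => [? ?]. Qed.
Lemma cReM z w : cRe (z * w) = cRe z * cRe w - cIm z * cIm w.
Proof. by case: z w => [? ?] [? ?]. Qed.
Lemma cImM z w : cIm (z * w) = cRe z * cIm w + cIm z * cRe w.
Proof. by case: z w => [? ?] [? ?]. Qed.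
Lemma cReJ z : cRe (conjc z) = cRe z. Proof. by case: z. Qed.
Lemma cImJ z : cIm (conjc z) = - cIm z. Proof. by case: z. Qed.

Lemma cplxP z w : cRe z = cRe w -> cIm z = cIm w -> z = w.
Proof. by case: z w => [? ?] [? ?] /= -> ->. Qed.

Lemma cabs_normc z : cabs z = ComplexField.Normc.normc z.
Proof. by case: z. Qed.

Lemma cabs_ge0 z : 0 <= cabs z. Proof. exact: sqrtr_ge0. Qed.
Lemma cabsM z w : cabs (z * w) = cabs z * cabs w.
Proof. by rewrite !cabs_normc ComplexField.Normc.normcM. Qed.
Lemma cabsD z w : cabs (z + w) <= cabs z + cabs w.
Proof. by rewrite !cabs_normc le_normcD. Qed.
Lemma cabsN z : cabs (- z) = cabs z.
Proof. by rewrite /cabs cReN cImN !sqrrN. Qed.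
Lemma cabsJ z : cabs (conjc z) = cabs z.
Proof. by rewrite /cabs cReJ cImJ sqrrN. Qed.
Lemma cabs_cofR (t : R) : cabs (cofR t) = `|t|.
Proof. by rewrite /cabs /= expr0n addr0 sqrtr_sqr. Qed.
Lemma cabs_expi (t : R) : cabs (cexpi t) = 1.
Proof. by rewrite /cabs /= cos2Dsin2 sqrtr1. Qed.

Lemma cabs_sqr z : cabs z ^+ 2 = cRe z ^+ 2 + cIm z ^+ 2.
Proof. by rewrite sqr_sqrtr// addr_ge0 ?sqr_ge0. Qed.

Lemma mul_conjc z : z * conjc z = cofR (cabs z ^+ 2).
Proof.
rewrite cabs_sqr; apply: cplxP; rewrite ?cReM ?cImM cReJ cImJ/=; ring.
Qed.

Lemma normRe_cabs z : `|cRe z| <= cabs z.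
Proof. by rewrite -sqrtr_sqr ler_sqrt ?addr_ge0 ?sqr_ge0// lerDl sqr_ge0. Qed.
Lemma normIm_cabs z : `|cIm z| <= cabs z.
Proof. by rewrite -sqrtr_sqr ler_sqrt ?addr_ge0 ?sqr_ge0// lerDr sqr_ge0. Qed.
Lemma cofRM (s t : R) : cofR (s * t) = cofR s * cofR t :> C.
Proof. by apply: cplxP; rewrite ?cReM ?cImM/=; ring. Qed.
Lemma cofR1 : cofR 1 = 1 :> C. Proof. by []. Qed.

Lemma cexpiD (s t : R) : cexpi (s + t) = cexpi s * cexpi t.
Proof. by apply: cplxP; rewrite ?cReM ?cImM/= ?cosD ?sinD; ring. Qed.
Lemma cexpi0 : cexpi 0 = 1 :> C.
Proof. by apply: cplxP; rewrite /= ?cos0 ?sin0. Qed.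
Lemma conj_cexpi (t : R) : conjc (cexpi t) = cexpi (- t).
Proof. by apply: cplxP; rewrite /= ?cosN ?sinN. Qed.
End cplx.

Section cint.
Context {R : realType} d (T : measurableType d) (mu : {measure set T -> \bar R}).
Notation C := R[i].
Implicit Types f g : T -> C.

Definition cmeas d' (T' : measurableType d') (f : T' -> C) :=
  measurable_fun setT (fun x => cRe (f x)) /\ measurable_fun setT (fun x => cIm (f x)).

Definition cintg f := cmeas f /\ (\int[mu]_x (cabs (f x))%:E < +oo)%E.

Definition CI f : C :=
  Complex (\int[mu]_x cRe (f x))%R (\int[mu]_x cIm (f x))%R.

Lemma cmeas_cabs f : cmeas f -> measurable_fun setT (fun x => cabs (f x)).
Proof.
move=> [mr mi]; apply: (measurableT_comp (@continuous_measurable_fun R Num.sqrt (@sqrt_continuous R))).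
by apply: measurable_funD; apply: measurable_funX.
Qed.

Lemma cmeasD f g : cmeas f -> cmeas g -> cmeas (fun x => f x + g x).
Proof.
move=> [fr fi] [gr gi]; split.
  by under eq_fun do rewrite cReD; exact: measurable_funD.
by under eq_fun do rewrite cImD; exact: measurable_funD.
Qed.

Lemma cmeasN f : cmeas f -> cmeas (fun x => - f x).
Proof.
move=> [fr fi]; split.
  by under eq_fun do rewrite cReN; exact: measurable_funN.
by under eq_fun do rewrite cImN; exact: measurable_funN.
Qed.

Lemma cmeasJ f : cmeas f -> cmeas (fun x => conjc (f x)).
Proof.
move=> [fr fi]; split.
  by under eq_fun do rewrite cReJ.
by under eq_fun do rewrite cImJ; exact: measurable_funN.
Qed.

Lemma cmeasM f g : cmeas f -> cmeas g -> cmeas (fun x => f x * g x).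
Proof.
move=> [fr fi] [gr gi]; split.
  under eq_fun do rewrite cReM.
  by apply: measurable_funB; exact: measurable_funM.
under eq_fun do rewrite cImM.
by apply: measurable_funD; exact: measurable_funM.
Qed.

Lemma cmeas_cst (z : C) : cmeas (fun _ : T => z).
Proof. by split; exact: measurable_cst. Qed.

Lemma cmeas_cofR (h : T -> R) : measurable_fun setT h -> cmeas (fun x => cofR (h x)).
Proof. by split=> //; exact: measurable_cst. Qed.

Lemma cmeas_expi (h : T -> R) : measurable_fun setT h -> cmeas (fun x => cexpi (h x)).
Proof.
move=> mh; split.
  exact: (measurableT_comp (continuous_measurable_fun (@continuous_cos R))).
exact: (measurableT_comp (continuous_measurable_fun (@continuous_sin R))).
Qed.

Lemma cintgRe f : cintg f -> mu.-integrable setT (EFin \o (fun x => cRe (f x))).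
Proof.
move=> [mf fi]; apply/integrableP; split; first by apply/measurable_EFinP; case: mf.
apply: le_lt_trans fi; apply: ge0_le_integral => //.
- by apply: measurableT_comp => //; apply/measurable_EFinP; case: mf.
- by apply/measurable_EFinP; exact: cmeas_cabs.
- by move=> x _; rewrite /= lee_fin normRe_cabs.
Qed.

Lemma cintgIm f : cintg f -> mu.-integrable setT (EFin \o (fun x => cIm (f x))).
Proof.
move=> [mf fi]; apply/integrableP; split; first by apply/measurable_EFinP; case: mf.
apply: le_lt_trans fi; apply: ge0_le_integral => //.
- by apply: measurableT_comp => //; apply/measurable_EFinP; case: mf.
- by apply/measurable_EFinP; exact: cmeas_cabs.
- by move=> x _; rewrite /= lee_fin normIm_cabs.
Qed.

Lemma cintg_le f (h : T -> R) : cmeas f -> measurable_fun setT h ->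
  (forall x, cabs (f x) <= h x) -> (\int[mu]_x (h x)%:E < +oo)%E -> cintg f.
Proof.
move=> mf mh fh hi; split=> //; apply: le_lt_trans hi; apply: ge0_le_integral => //.
- by move=> x _; rewrite lee_fin cabs_ge0.
- by apply/measurable_EFinP; exact: cmeas_cabs.
- exact/measurable_EFinP.
- by move=> x _; rewrite lee_fin.
Qed.

Lemma cintgD f g : cintg f -> cintg g -> cintg (fun x => f x + g x).
Proof.
move=> [mf fi] [mg gi].
apply: (@cintg_le _ (fun x => cabs (f x) + cabs (g x))).
- exact: cmeasD.
- by apply: measurable_funD; exact: cmeas_cabs.
- by move=> x; exact: cabsD.
- under eq_integral do rewrite EFinD.
  rewrite ge0_integralD//; first by rewrite lte_add_pinfty.
  + by move=> x _; rewrite lee_fin cabs_ge0.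
  + by apply/measurable_EFinP; exact: cmeas_cabs.
  + by move=> x _; rewrite lee_fin cabs_ge0.
  + by apply/measurable_EFinP; exact: cmeas_cabs.
Qed.

Lemma cintgN f : cintg f -> cintg (fun x => - f x).
Proof.
move=> [mf fi]; split; first exact: cmeasN.
by under eq_integral do rewrite cabsN.
Qed.

Lemma cintgJ f : cintg f -> cintg (fun x => conjc (f x)).
Proof.
move=> [mf fi]; split; first exact: cmeasJ.
by under eq_integral do rewrite cabsJ.
Qed.

Lemma cintgM_bd f g K : cintg f -> cmeas g -> (forall x, cabs (g x) <= K) ->
  cintg (fun x => g x * f x).
Proof.
move=> [mf fi] mg gK.
apply: (@cintg_le _ (fun x => `|K| * cabs (f x))).
- exact: cmeasM.
- by apply: measurable_funM; [exact: measurable_cst|exact: cmeas_cabs].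
- by move=> x; rewrite cabsM ler_wpM2r ?cabs_ge0// (le_trans (gK x))// ler_norm.
- under eq_integral do rewrite EFinM.
  rewrite ge0_integralZl//; first by rewrite lte_mul_pinfty ?lee_fin.
  + by apply/measurable_EFinP; exact: cmeas_cabs.
  + by move=> x _; rewrite lee_fin cabs_ge0.
Qed.

Lemma cintgZ f z : cintg f -> cintg (fun x => z * f x).
Proof. by move=> fi; apply: (cintgM_bd fi (cmeas_cst z)) => // x; exact: lexx. Qed.

Lemma CID f g : cintg f -> cintg g -> CI (fun x => f x + g x) = CI f + CI g.
Proof.
move=> fi gi; apply: cplxP; rewrite ?cReD ?cImD /=.
  under eq_Rintegral do rewrite cReD.
  by rewrite RintegralD//; exact: cintgRe.
under eq_Rintegral do rewrite cImD.
by rewrite RintegralD//; exact: cintgIm.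
Qed.

Let integrableZr (h : T -> R) k : mu.-integrable setT (EFin \o h) ->
  mu.-integrable setT (EFin \o (fun x => k * h x)).
Proof. by move=> /(integrableZl measurableT k). Qed.

Lemma CIZ f z : cintg f -> CI (fun x => z * f x) = z * CI f.
Proof.
move=> fi; have iR := cintgRe fi; have iI := cintgIm fi.
apply: cplxP; rewrite ?cReM ?cImM /=.
  under eq_Rintegral do rewrite cReM.
  rewrite RintegralB//; [|exact: integrableZr..].
  by rewrite !RintegralZl.
under eq_Rintegral do rewrite cImM.
rewrite RintegralD//; [|exact: integrableZr..].
by rewrite !RintegralZl.
Qed.

Lemma CIN f : cintg f -> CI (fun x => - f x) = - CI f.
Proof.
move=> fi; rewrite -[RHS]mulN1r -CIZ//; congr CI; apply/funext => x; by rewrite mulN1r.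
Qed.

Lemma CIB f g : cintg f -> cintg g -> CI (fun x => f x - g x) = CI f - CI g.
Proof. by move=> fi gi; rewrite CID ?CIN//; exact: cintgN. Qed.

Lemma CIJ f : cintg f -> CI (fun x => conjc (f x)) = conjc (CI f).
Proof.
move=> fi; apply: cplxP; rewrite ?cReJ ?cImJ /=.
  by under eq_Rintegral do rewrite cReJ.
under eq_Rintegral do rewrite cImJ -mulN1r.
rewrite RintegralZl//; last exact: cintgIm.
by rewrite mulN1r.
Qed.

Lemma eq_CI f g : f =1 g -> CI f = CI g.
Proof. by move=> /funext ->. Qed.

(** Multiplying [f] by a suitable unimodular constant [w] makes its integral real and equal to
    [cabs (CI f)], after which real parts are compared. When the integral vanishes no such [w] is
    available, but the bound is trivial. *)
Lemma cabs_CI f : cintg f -> ((cabs (CI f))%:E <= \int[mu]_x (cabs (f x))%:E)%E.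
Proof.
move=> fi; have [mf foo] := fi.
have ig : mu.-integrable setT (EFin \o (fun x => cabs (f x))).
  apply/integrableP; split; first by apply/measurable_EFinP; exact: cmeas_cabs.
  by under eq_integral do rewrite /= ger0_norm ?cabs_ge0//.
set z := CI f.
have [z0|z0] := eqVneq (cabs z) 0.
  by rewrite z0; apply: integral_ge0 => x _; rewrite lee_fin cabs_ge0.
pose w : C := conjc z * cofR (cabs z)^-1.
have w1 : cabs w = 1.
  by rewrite cabsM cabsJ cabs_cofR ger0_norm ?invr_ge0 ?cabs_ge0// mulfV.
have -> : cabs z = (\int[mu]_x cRe (w * f x))%R.
  have -> : (\int[mu]_x cRe (w * f x))%R = cRe (CI (fun x => w * f x)) by [].
  rewrite CIZ// -/z /w mulrAC (mulrC _ z) mul_conjc -cofRM /=.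
  by rewrite expr2 mulfK.
have iw := cintgRe (cintgZ w fi).
apply: (@le_trans _ _ (\int[mu]_x cabs (f x))%R%:E); last first.
  by rewrite /Rintegral fineK//; exact: integrable_fin_num.
rewrite lee_fin; apply: le_Rintegral => // x _.
by rewrite (le_trans (ler_norm _))// (le_trans (normRe_cabs _))// cabsM w1 mul1r.
Qed.

End cint.

(** * Fubini for complex integrands *)

Section cfubini.
Context {R : realType} d1 d2 (T1 : measurableType d1) (T2 : measurableType d2).
Variables (m1 : {sigma_finite_measure set T1 -> \bar R})
          (m2 : {sigma_finite_measure set T2 -> \bar R}).
Notation C := R[i].

(** No integrability is asked: the section integral is [fine] of a difference of two nonnegative
    ones, each measurable by Tonelli. Partial integrals are thus measurable before their finiteness
    is known. *)
Lemma measurable_Rintegral_section (f : T1 * T2 -> R) : measurable_fun setT f ->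
  measurable_fun setT (fun x => \int[m2]_y f (x, y))%R.
Proof.
move=> mf; apply: measurableT_comp; first exact: fine_measurable.
under eq_fun do rewrite integralE.
have mE : measurable_fun setT (EFin \o f) by apply/measurable_EFinP.
apply: emeasurable_funB.
  have := measurable_funepos mE.
  move=> /(@measurable_fun_fubini_tonelli_F _ _ _ _ R m2 _)/(_ (fun p => funepos_ge0 _ p)).
  by congr measurable_fun; apply/funext => x; apply: eq_integral => y _; rewrite !funeposE.
have := measurable_funeneg mE.
move=> /(@measurable_fun_fubini_tonelli_F _ _ _ _ R m2 _)/(_ (fun p => funeneg_ge0 _ p)).
by congr measurable_fun; apply/funext => x; apply: eq_integral => y _; rewrite !funenegE.
Qed.

Lemma cmeas_CI (h : T1 * T2 -> C) : cmeas h ->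
  cmeas (fun x => CI m2 (fun y => h (x, y))).
Proof.
by move=> [mr mi]; split; [exact: (measurable_Rintegral_section mr)|exact: (measurable_Rintegral_section mi)].
Qed.

Lemma cmeas_section1 (h : T1 * T2 -> C) x : cmeas h -> cmeas (fun y => h (x, y)).
Proof.
by move=> [mr mi]; split; [exact: (measurableT_comp mr (pair1_measurable x))|exact: (measurableT_comp mi (pair1_measurable x))].
Qed.

Lemma cmeas_section2 (h : T1 * T2 -> C) y : cmeas h -> cmeas (fun x => h (x, y)).
Proof.
by move=> [mr mi]; split; [exact: (measurableT_comp mr (pair2_measurable y))|exact: (measurableT_comp mi (pair2_measurable y))].
Qed.

Lemma cmeas_comp d (T : measurableType d) d' (T' : measurableType d') (g : T -> T') (h : T' -> C) :
  cmeas h -> measurable_fun setT g -> cmeas (fun t => h (g t)).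
Proof.
by move=> [mr mi] mg; split; [exact: (measurableT_comp mr mg)|exact: (measurableT_comp mi mg)].
Qed.

(** Integrable real majorants. Bounds on complex functions are kept in this form because majorants
    of separated variables multiply ([gdom_prod]) and restrict to every section. *)
Definition gdom d (T : measurableType d) (m : {measure set T -> \bar R}) (G : T -> R) :=
  [/\ measurable_fun setT G, (forall x, 0 <= G x) & (\int[m]_x (G x)%:E < +oo)%E].

Lemma gdom_cabs d (T : measurableType d) (m : {measure set T -> \bar R}) (f : T -> C) :
  cintg m f -> gdom m (fun x => cabs (f x)).
Proof. by move=> [mf foo]; split=> //; [exact: cmeas_cabs|move=> x; exact: cabs_ge0]. Qed.

Lemma gdomZ d (T : measurableType d) (m : {measure set T -> \bar R}) (G : T -> R) (k : R) :
  0 <= k -> gdom m G -> gdom m (fun x => k * G x).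
Proof.
move=> k0 [mG G0 Goo]; split; first exact: measurable_funM.
  by move=> x; exact: mulr_ge0.
under eq_integral do rewrite EFinM.
rewrite ge0_integralZl//; first by rewrite lte_mul_pinfty ?lee_fin.
  exact/measurable_EFinP.
by move=> x _; rewrite lee_fin.
Qed.

Lemma gdom_cintg d (T : measurableType d) (m : {measure set T -> \bar R}) (G : T -> R) (f : T -> C) :
  gdom m G -> cmeas f -> (forall x, cabs (f x) <= G x) -> cintg m f.
Proof. by move=> [mG G0 Goo] mf fG; exact: (cintg_le mf mG fG Goo). Qed.

Lemma ge0_fubini (f : T1 * T2 -> \bar R) : measurable_fun setT f ->
  (forall p, 0 <= f p)%E ->
  (\int[m1]_x \int[m2]_y f (x, y) = \int[m2]_y \int[m1]_x f (x, y))%E.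
Proof. by move=> mf f0; exact: (@fubini_tonelli _ _ _ _ R m1 m2 f mf f0). Qed.

Lemma measurable_int_section (f : T1 * T2 -> \bar R) : measurable_fun setT f ->
  (forall p, 0 <= f p)%E -> measurable_fun setT (fun x => \int[m2]_y f (x, y))%E.
Proof. by move=> mf f0; exact: (@measurable_fun_fubini_tonelli_F _ _ _ _ R m2 f mf f0). Qed.

Lemma gdom_prod G1 G2 : gdom m1 G1 -> gdom m2 G2 ->
  gdom (prodm m1 m2) (fun p => G1 p.1 * G2 p.2).
Proof.
move=> [mG1 G10 G1oo] [mG2 G20 G2oo].
have mG : measurable_fun setT (fun p : T1 * T2 => G1 p.1 * G2 p.2).
  by apply: measurable_funM; exact: measurableT_comp.
split=> //; first by move=> p; exact: mulr_ge0.
have H := @fubini_tonelli1 _ _ _ _ R m1 m2 (fun p => (G1 p.1 * G2 p.2)%:E).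
rewrite H//; last 2 first.
- exact/measurable_EFinP.
- by move=> p; rewrite lee_fin mulr_ge0.
rewrite /fubini_F /=.
under eq_integral => x _.
  under eq_integral do rewrite EFinM.
  rewrite ge0_integralZl//; last 3 first.
  - exact/measurable_EFinP.
  - by move=> y _; rewrite lee_fin.
  - by rewrite lee_fin.
  over.
rewrite ge0_integralZr//; last 3 first.
- exact/measurable_EFinP.
- by move=> x _; rewrite lee_fin.
- by apply: integral_ge0 => y _; rewrite lee_fin.
apply: lte_mul_pinfty => //.
  by apply: integral_ge0 => y _; rewrite lee_fin.
by rewrite ge0_fin_numE//; apply: integral_ge0 => y _; rewrite lee_fin.
Qed.

Lemma Rintegral_prod1 (f : T1 * T2 -> R) :
  (prodm m1 m2).-integrable setT (EFin \o f) ->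
  (forall x, m2.-integrable setT (EFin \o (fun y => f (x, y)))) ->
  (\int[prodm m1 m2]_p f p = \int[m1]_x \int[m2]_y f (x, y))%R.
Proof.
move=> fi fxi; rewrite {1}/Rintegral.
have := @integral12_prod_meas1 _ _ _ _ R m1 m2 _ fi => /= <-.
rewrite /Rintegral; congr fine; apply: eq_integral => x _.
by rewrite fineK//; exact: (integrable_fin_num _ (fxi x)).
Qed.

Lemma Rintegral_prod2 (f : T1 * T2 -> R) :
  (prodm m1 m2).-integrable setT (EFin \o f) ->
  (forall y, m1.-integrable setT (EFin \o (fun x => f (x, y)))) ->
  (\int[prodm m1 m2]_p f p = \int[m2]_y \int[m1]_x f (x, y))%R.
Proof.
move=> fi fxi; rewrite {1}/Rintegral.
have := @integral21_prod_meas1 _ _ _ _ R m1 m2 _ fi => /= <-.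
rewrite /Rintegral; congr fine; apply: eq_integral => x _.
by rewrite fineK//; exact: (integrable_fin_num _ (fxi x)).
Qed.

Lemma CI_prod1 (h : T1 * T2 -> C) : cintg (prodm m1 m2) h ->
  (forall x, cintg m2 (fun y => h (x, y))) ->
  CI (prodm m1 m2) h = CI m1 (fun x => CI m2 (fun y => h (x, y))).
Proof.
move=> hi hxi; apply: cplxP => /=.
  apply: (Rintegral_prod1 (f := fun p => cRe (h p))); first exact: cintgRe.
  by move=> x; exact: (cintgRe (hxi x)).
apply: (Rintegral_prod1 (f := fun p => cIm (h p))); first exact: cintgIm.
by move=> x; exact: (cintgIm (hxi x)).
Qed.

Lemma CI_prod2 (h : T1 * T2 -> C) : cintg (prodm m1 m2) h ->
  (forall y, cintg m1 (fun x => h (x, y))) ->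
  CI (prodm m1 m2) h = CI m2 (fun y => CI m1 (fun x => h (x, y))).
Proof.
move=> hi hxi; apply: cplxP => /=.
  apply: (Rintegral_prod2 (f := fun p => cRe (h p))); first exact: cintgRe.
  by move=> x; exact: (cintgRe (hxi x)).
apply: (Rintegral_prod2 (f := fun p => cIm (h p))); first exact: cintgIm.
by move=> x; exact: (cintgIm (hxi x)).
Qed.

(** A separated majorant gives integrability on the product and also on every section, not just
    almost every one, as [CI_prod1] and [CI_prod2] require. *)
Lemma CI_swap (h : T1 * T2 -> C) G1 G2 : cmeas h -> gdom m1 G1 -> gdom m2 G2 ->
  (forall x y, cabs (h (x, y)) <= G1 x * G2 y) ->
  CI m1 (fun x => CI m2 (fun y => h (x, y))) =
  CI m2 (fun y => CI m1 (fun x => h (x, y))).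
Proof.
move=> mh g1 g2 hG.
have [mG1 G10 G1oo] := g1; have [mG2 G20 G2oo] := g2.
have hi : cintg (prodm m1 m2) h.
  by apply: (gdom_cintg (gdom_prod g1 g2)) => // -[x y]; exact: hG.
rewrite -CI_prod1//; last first.
  move=> x; apply: (gdom_cintg (gdomZ (G10 x) g2)) => //; exact: cmeas_section1.
rewrite CI_prod2// => y.
apply: (gdom_cintg (gdomZ (G20 y) g1)); first exact: cmeas_section2.
by move=> x; rewrite mulrC.
Qed.

End cfubini.

(** * Integration by parts along translations *)

Lemma FTC_unit {R : realType} (f f' : R -> R) :
  (forall t, is_derive t (1:R) f (f' t)) -> continuous f' ->
  (\int[@lebesgue_measure R]_(t in `[0%R, 1%R]) f' t = f 1 - f 0)%R.
Proof.
move=> df cf'.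
have dv t : derivable f t 1 by have [] := df t.
have cf : continuous f by move=> t; apply/differentiable_continuous/derivable1_diffP/dv.
rewrite /Rintegral (@continuous_FTC2 _ f' f 0 1)//.
- exact: continuous_subspaceT.
- split=> //; first by apply: cvg_at_right_filter; exact: cf.
  by apply: cvg_at_left_filter; exact: cf.
- by move=> t _; rewrite derive1E; have [_ ->] := df t.
Qed.

Section flow.
Context {R : realType} d (T : measurableType d) (mu : {sigma_finite_measure set T -> \bar R}).
Variable sh : R -> T -> T.
Notation leb := (@lebesgue_measure R).
Hypothesis msh : measurable_fun setT (fun p : measurableTypeR R * T => sh p.1 p.2).
Hypothesis sh0 : forall x, sh 0 x = x.
Hypothesis shI : forall t (f : T -> \bar R), measurable_fun setT f ->
  (forall x, 0 <= f x)%E -> (\int[mu]_x f (sh t x) = \int[mu]_x f x)%E.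

Let msh1 t : measurable_fun setT (sh t).
Proof. exact: (measurableT_comp msh (pair1_measurable t)). Qed.

Lemma flow_integral t (f : T -> \bar R) : measurable_fun setT f ->
  (\int[mu]_x f (sh t x) = \int[mu]_x f x)%E.
Proof.
move=> mf; rewrite [LHS]integralE [RHS]integralE; congr (_ - _)%E.
  rewrite -(shI t (measurable_funepos mf)); last by move=> x; exact: funepos_ge0.
  by apply: eq_integral => x _; rewrite !funeposE.
rewrite -(shI t (measurable_funeneg mf)); last by move=> x; exact: funeneg_ge0.
by apply: eq_integral => x _; rewrite !funenegE.
Qed.

Lemma flow_integrable t (f : T -> R) : mu.-integrable setT (EFin \o f) ->
  mu.-integrable setT (EFin \o (fun x => f (sh t x))).
Proof.
move=> /integrableP[mf foo]; apply/integrableP; split.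
  exact: (measurableT_comp mf (msh1 t)).
rewrite (shI t (f := fun x => `|(f x)%:E|%E))//.
exact: measurableT_comp.
Qed.

(* Integrate [f (sh 1 x) - f x = int_0^1 f' (sh t x) dt] in [x]: invariance makes both sides computable. *)
Lemma flow_integral_deriv (f f' : T -> R) :
  mu.-integrable setT (EFin \o f) -> mu.-integrable setT (EFin \o f') ->
  (forall x t, is_derive t (1:R) (fun s => f (sh s x)) (f' (sh t x))) ->
  (forall x, continuous (fun t => f' (sh t x))) ->
  (\int[mu]_x f' x = 0)%R.
Proof.
move=> fi f'i df cf'.
pose D : set R := `[0, 1]%classic.
(* The indicator turns the integral over [[0, 1]] into one over the whole line, so that Fubini
   applies to a product of measures. *)
pose h (p : measurableTypeR R * T) : R := \1_D p.1 * f' (sh p.1 p.2).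
have mD : measurable D by exact: measurable_itv.
have lebD : leb D = 1%E by rewrite /D lebesgue_measure_itv/= lte_fin ltr01 oppr0 adde0.
have mf' : measurable_fun setT f' by case/integrableP: f'i => /measurable_EFinP.
have mh : measurable_fun setT h.
  apply: measurable_funM; last exact: (measurableT_comp mf' msh).
  exact: (measurableT_comp (measurable_indic mD) measurable_fst).
have h1 t : mu.-integrable setT (EFin \o (fun x => h (t, x))).
  exact: (integrableZl measurableT (\1_D t) (flow_integrable t f'i)).
have h2 x : leb.-integrable setT (EFin \o (fun t => h (t, x))).
  have := @continuous_compact_integrable R (fun t => f' (sh t x)) D (@segment_compact _ _ _) (@continuous_subspaceT _ _ _ _ (cf' x)).
  rewrite integrable_mkcond//; congr integrable.
  apply/funext => t; rewrite /h /= patchE indicE.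
  by case: (t \in D); rewrite ?mul1r ?mul0r.
have hi : (prodm leb mu).-integrable setT (EFin \o h).
  have mhE : measurable_fun setT (EFin \o h) by apply/measurable_EFinP.
  apply/(integrable12ltyP leb mu mhE) => /=.
  have -> : (\int[leb]_t \int[mu]_x `|(h (t, x))%:E| = \int[leb]_t ((\1_D t)%:E * \int[mu]_x `|(f' x)%:E|))%E.
    apply: eq_integral => t _.
    rewrite -(shI t (f := fun x => `|(f' x)%:E|%E))//; last first.
      by apply: measurableT_comp => //; apply/measurable_EFinP.
    rewrite -ge0_integralZl//.
    - by apply: eq_integral => x _; rewrite /h /= normrM EFinM ger0_norm.
    - apply: measurableT_comp => //; apply/measurable_EFinP.
      exact: (measurableT_comp mf' (msh1 t)).
  rewrite ge0_integralZr//.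
  - rewrite integral_indic// setIT lte_mul_pinfty//.
    + by rewrite [X in X \is a fin_num]lebD.
    + by case/integrableP: f'i.
  - by apply/measurable_EFinP; exact: measurable_indic.
  - by apply: integral_ge0 => x _; exact: abse_ge0.
have := Rintegral_prod2 hi h2; rewrite (Rintegral_prod1 hi h1).
have -> : (\int[leb]_t \int[mu]_x h (t, x) = \int[mu]_x f' x)%R.
  transitivity (\int[leb]_t (\1_D t * \int[mu]_x f' x))%R.
    apply: eq_Rintegral => t _; rewrite /h /= RintegralZl//; last exact: flow_integrable.
    by congr (_ * _); rewrite /Rintegral (flow_integral t (f := EFin \o f'))//; apply/measurable_EFinP.
  rewrite RintegralZr//.
    rewrite -[RHS]mul1r; congr (_ * _).
    by rewrite /Rintegral integral_indic//= setIT [X in fine X]lebD.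
  apply/integrableP; split; first by apply/measurable_EFinP; exact: measurable_indic.
  under eq_integral do rewrite /= ger0_norm//.
  by rewrite integral_indic// setIT [X in (X < _)%E]lebD ltry.
move=> ->.
transitivity (\int[mu]_x (f (sh 1 x) - f x))%R.
  apply: eq_Rintegral => x _.
  have := FTC_unit (df x) (cf' x); rewrite sh0 => <-.
  rewrite [RHS]Rintegral_mkcond; apply: eq_Rintegral => t _.
  by rewrite /h /= patchE indicE /D; case: (t \in _); rewrite ?mul1r ?mul0r.
rewrite RintegralB//; last exact: flow_integrable.
rewrite /Rintegral (flow_integral 1 (f := EFin \o f)) ?subrr//.
by case/integrableP: fi.
Qed.

End flow.

(** * Derivatives of complex functions of a real variable *)

Section cder1.
Context {R : realType}.
Notation C := R[i].
Implicit Types (phi psi : R -> C).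

Lemma is_derive1D (f g : R -> R) t a b : is_derive t (1:R) f a -> is_derive t (1:R) g b ->
  is_derive t (1:R) (fun s => f s + g s) (a + b).
Proof. by move=> df dg; exact: is_deriveD. Qed.

Lemma is_derive1N (f : R -> R) t a : is_derive t (1:R) f a ->
  is_derive t (1:R) (fun s => - f s) (- a).
Proof. by move=> df; exact: is_deriveN. Qed.

Lemma is_derive1M (f g : R -> R) t a b : is_derive t (1:R) f a -> is_derive t (1:R) g b ->
  is_derive t (1:R) (fun s => f s * g s) (a * g t + f t * b).
Proof.
move=> df dg; apply: is_derive_eq (is_deriveM df dg) _.
by rewrite /GRing.scale /= addrC (mulrC a).
Qed.

Lemma is_derive1_cst (c : R) t : is_derive t (1:R) (fun _ => c) 0.
Proof. exact: is_derive_cst. Qed.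

Lemma is_derive1_ext (f g : R -> R) t a : f =1 g -> is_derive t (1:R) f a -> is_derive t (1:R) g a.
Proof. by move=> /funext ->. Qed.

Definition cder1 phi phi' := forall t : R,
  is_derive t (1:R) (fun s => cRe (phi s)) (cRe (phi' t)) /\
  is_derive t (1:R) (fun s => cIm (phi s)) (cIm (phi' t)).

Definition ccont phi := continuous (fun s => cRe (phi s)) /\ continuous (fun s => cIm (phi s)).

Lemma cder1_cont phi phi' : cder1 phi phi' -> ccont phi.
Proof.
move=> h; split=> t; apply/differentiable_continuous/derivable1_diffP.
  by have [[]] := h t.
by have [_ []] := h t.
Qed.

Lemma ccontD phi psi : ccont phi -> ccont psi -> ccont (fun s => phi s + psi s).
Proof.
move=> [a b] [c e]; split => t.
  by under eq_fun do rewrite cReD; apply: cvgD; [exact: a|exact: c].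
by under eq_fun do rewrite cImD; apply: cvgD; [exact: b|exact: e].
Qed.

Lemma ccontM phi psi : ccont phi -> ccont psi -> ccont (fun s => phi s * psi s).
Proof.
move=> [a b] [c e]; split => t.
  rewrite /continuous_at cReM; under eq_fun do rewrite cReM.
  by apply: cvgB; apply: cvgM; [exact: a|exact: c|exact: b|exact: e].
rewrite /continuous_at cImM; under eq_fun do rewrite cImM.
by apply: cvgD; apply: cvgM; [exact: a|exact: e|exact: b|exact: c].
Qed.

Lemma cder1D phi phi' psi psi' : cder1 phi phi' -> cder1 psi psi' ->
  cder1 (fun s => phi s + psi s) (fun s => phi' s + psi' s).
Proof.
move=> h k t; have [hr hi] := h t; have [kr ki] := k t; split.
  rewrite cReD; apply: is_derive1_ext (is_derive1D hr kr) => s; by rewrite cReD.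
rewrite cImD; apply: is_derive1_ext (is_derive1D hi ki) => s; by rewrite cImD.
Qed.

Lemma cder1M phi phi' psi psi' : cder1 phi phi' -> cder1 psi psi' ->
  cder1 (fun s => phi s * psi s) (fun s => phi' s * psi s + phi s * psi' s).
Proof.
move=> h k t; have [hr hi] := h t; have [kr ki] := k t; split.
  apply: is_derive_eq; first apply: is_derive1_ext (is_derive1D (is_derive1M hr kr) (is_derive1N (is_derive1M hi ki))).
    by move=> s; rewrite cReM.
  by rewrite cReD !cReM; ring.
apply: is_derive_eq; first apply: is_derive1_ext (is_derive1D (is_derive1M hr ki) (is_derive1M hi kr)).
  by move=> s; rewrite cImM.
by rewrite cImD !cImM; ring.
Qed.

Lemma cder1J phi phi' : cder1 phi phi' -> cder1 (fun s => conjc (phi s)) (fun s => conjc (phi' s)).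
Proof.
move=> h t; have [hr hi] := h t; split.
  rewrite cReJ; apply: is_derive1_ext hr => s; by rewrite cReJ.
rewrite cImJ; apply: is_derive1_ext (is_derive1N hi) => s; by rewrite cImJ.
Qed.

Lemma cder1_cst (z : C) : cder1 (fun _ => z) (fun _ => 0).
Proof. by move=> t; split; exact: is_derive1_cst. Qed.

Lemma cder1Z z phi phi' : cder1 phi phi' -> cder1 (fun s => z * phi s) (fun s => z * phi' s).
Proof.
move=> h; have := cder1M (cder1_cst z) h.
by under [X in cder1 _ X -> _]eq_fun do rewrite mul0r add0r.
Qed.

Lemma cder1_cofR (f f' : R -> R) : (forall t, is_derive t (1:R) f (f' t)) ->
  cder1 (fun s => cofR (f s)) (fun s => cofR (f' s)).
Proof. by move=> h t; split => //=; exact: is_derive1_cst. Qed.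

Lemma is_derive1_affine (a b : R) t : is_derive t (1:R) (fun s => a + s * b) b.
Proof.
have h1 : is_derive t (1:R) (fun s : R => s) 1 by exact: is_derive_id.
have h := is_derive1D (is_derive1_cst a t) (is_derive1M h1 (is_derive1_cst b t)).
by rewrite mul1r mulr0 addr0 add0r in h.
Qed.

Definition Ci : C := Complex 0 1.

Lemma cder1_expi (a b : R) :
  cder1 (fun s => cexpi (a + s * b)) (fun s => (Ci * cofR b) * cexpi (a + s * b)).
Proof.
move=> t; split.
  have h := @is_derive1_comp R cos (fun s => a + s * b) t _ b (is_derive_cos (a + t * b)) (is_derive1_affine a b t).
  apply: is_derive_eq h _.
  by rewrite !cReM !cImM /=; ring.
have h := @is_derive1_comp R sin (fun s => a + s * b) t _ b (is_derive_sin (a + t * b)) (is_derive1_affine a b t).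
apply: is_derive_eq h _.
by rewrite !cImM !cReM /=; ring.
Qed.

End cder1.

Section flow_complex.
Context {R : realType} d (T : measurableType d) (mu : {sigma_finite_measure set T -> \bar R}).
Variable sh : R -> T -> T.
Hypothesis msh : measurable_fun setT (fun p : measurableTypeR R * T => sh p.1 p.2).
Hypothesis sh0 : forall x, sh 0 x = x.
Hypothesis shI : forall t (f : T -> \bar R), measurable_fun setT f ->
  (forall x, 0 <= f x)%E -> (\int[mu]_x f (sh t x) = \int[mu]_x f x)%E.
Notation C := R[i].

Definition cdiff (f f' : T -> C) := forall x, cder1 (fun s => f (sh s x)) (fun s => f' (sh s x)).

Lemma flow_CI t (f : T -> C) : cmeas f -> CI mu (fun x => f (sh t x)) = CI mu f.
Proof.
move=> [mr mi]; apply: cplxP; rewrite /= /Rintegral.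
  rewrite (flow_integral shI t (f := fun x => (cRe (f x))%:E))//; exact/measurable_EFinP.
rewrite (flow_integral shI t (f := fun x => (cIm (f x))%:E))//; exact/measurable_EFinP.
Qed.

Lemma flow_CI_deriv (f f' : T -> C) : cintg mu f -> cintg mu f' -> cdiff f f' ->
  (forall x, ccont (fun t => f' (sh t x))) -> CI mu f' = 0.
Proof.
move=> fi f'i df cf'; apply: cplxP => /=.
  apply: (flow_integral_deriv msh sh0 shI (cintgRe fi) (cintgRe f'i)).
    by move=> x t; have [] := df x t.
  by move=> x; have [] := cf' x.
apply: (flow_integral_deriv msh sh0 shI (cintgIm fi) (cintgIm f'i)).
  by move=> x t; have [] := df x t.
by move=> x; have [] := cf' x.
Qed.

(** The derivative of [f * g] along the flow integrates to zero because the flow preserves the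
    measure. Hence there are no boundary terms, and only the integrability of three products is
    asked for, with no decay condition. The flow is abstract so as to cover translations of [x]
    ([sh1]) and of a pair of frequencies ([sh2]). *)
Lemma flow_IBP (f f' g g' : T -> C) : cdiff f f' -> cdiff g g' ->
  (forall x, ccont (fun t => f' (sh t x))) -> (forall x, ccont (fun t => g' (sh t x))) ->
  cintg mu (fun x => f x * g x) -> cintg mu (fun x => f' x * g x) ->
  cintg mu (fun x => f x * g' x) ->
  CI mu (fun x => f' x * g x) = - CI mu (fun x => f x * g' x).
Proof.
move=> df dg cf' cg' i0 i1 i2; apply/eqP; rewrite -addr_eq0 -CID//; apply/eqP.
apply: (flow_CI_deriv i0) => //.
- exact: cintgD.
- by move=> x; exact: cder1M.
- move=> x; apply: ccontD; apply: ccontM => //.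
    exact: cder1_cont (dg x).
  exact: cder1_cont (df x).
Qed.

End flow_complex.

Section dotv.
Context {R : realType} (n : nat).
Implicit Types x y t : 'rV[R]_n.

Lemma dotvDl x y t : dotv (x + y) t = dotv x t + dotv y t.
Proof. by rewrite /dotv -big_split; apply: eq_bigr => i _; rewrite mxE mulrDl. Qed.
Lemma dotvZl (a : R) x t : dotv (a *: x) t = a * dotv x t.
Proof. by rewrite /dotv mulr_sumr; apply: eq_bigr => i _; rewrite mxE mulrA. Qed.
Lemma dotvC x y : dotv x y = dotv y x.
Proof. by apply: eq_bigr => i _; rewrite mulrC. Qed.
Lemma dotvDr x y t : dotv t (x + y) = dotv t x + dotv t y.
Proof. by rewrite dotvC dotvDl !(dotvC t). Qed.
Lemma dotvNl x t : dotv (- x) t = - dotv x t.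
Proof. by rewrite -scaleN1r dotvZl mulN1r. Qed.
Lemma dotvNr x t : dotv t (- x) = - dotv t x.
Proof. by rewrite dotvC dotvNl dotvC. Qed.
Lemma dotv_coord i t : dotv (coordv i) t = t 0 i.
Proof.
rewrite /dotv (bigD1 i)//= mxE !eqxx mul1r big1 ?addr0// => j ji.
by rewrite mxE (negbTE ji) mul0r.
Qed.

Lemma measurable_dotv d (T : measurableType d) (f g : T -> 'rV[R]_n) :
  measurable_fun setT f -> measurable_fun setT g ->
  measurable_fun setT (fun u => dotv (f u) (g u)).
Proof.
move=> mf mg; apply: measurable_sum => i.
by apply: measurable_funM; [exact: (measurableT_comp (measurable_coord i) mf)|exact: (measurableT_comp (measurable_coord i) mg)].
Qed.
End dotv.

Section rv_flow.
Context {R : realType} (n : nat).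
Notation V := 'rV[R]_n.
Notation mu := (@rv_measure R n).
Notation C := R[i].

Definition sh1 (v : V) (t : R) (x : V) : V := x + t *: v.

Lemma measurable_rv_add d (T : measurableType d) (f g : T -> V) :
  measurable_fun setT f -> measurable_fun setT g -> measurable_fun setT (fun x => f x + g x).
Proof.
move=> mf mg; apply/measurable_rvP => i; under eq_fun do rewrite mxE.
by apply: measurable_funD; [exact: (measurableT_comp (measurable_coord i) mf)|exact: (measurableT_comp (measurable_coord i) mg)].
Qed.

Lemma measurable_rv_opp d (T : measurableType d) (f : T -> V) :
  measurable_fun setT f -> measurable_fun setT (fun x => - f x).
Proof.
move=> mf; apply/measurable_rvP => i; under eq_fun do rewrite mxE.
by apply: measurable_funN; exact: (measurableT_comp (measurable_coord i) mf).
Qed.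

Lemma measurable_rv_scale d (T : measurableType d) (a : T -> R) (v : V) :
  measurable_fun setT a -> measurable_fun setT (fun x => a x *: v).
Proof.
move=> ma; apply/measurable_rvP => i; under eq_fun do rewrite mxE.
by apply: measurable_funM => //; exact: measurable_cst.
Qed.

Lemma measurable_sh1 v : measurable_fun setT (fun p : measurableTypeR R * V => sh1 v p.1 p.2).
Proof.
apply: measurable_rv_add; first exact: measurable_snd.
apply: (@measurable_rv_scale _ _ (fun p : measurableTypeR R * V => p.1)).
exact: measurable_fst.
Qed.

Lemma sh1_0 v x : sh1 v 0 x = x.
Proof. by rewrite /sh1 scale0r addr0. Qed.

Lemma sh1_inv v t (f : V -> \bar R) : measurable_fun setT f ->
  (forall x, 0 <= f x)%E -> (\int[mu]_x f (sh1 v t x) = \int[mu]_x f x)%E.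
Proof. by move=> mf f0; exact: ge0_integral_rvD. Qed.

Lemma CI_shift (v : V) (f : V -> C) : cmeas f -> CI mu (fun x => f (x + v)) = CI mu f.
Proof.
move=> mf; rewrite -(flow_CI (@sh1_inv v) 1 mf); apply: eq_CI => x.
by rewrite /sh1 scale1r.
Qed.

Lemma gdom_wt : gdom mu (@wt R n).
Proof.
split; [exact: measurable_wt|exact: wt_ge0|].
rewrite integral_prod_coord; [|exact: measurable_wt1|by move=> t; rewrite ltW// wt1_gt0].
have := @integral_wt1_fin R; set I := integral _ _ _ => fI.
rewrite -ge0_fin_numE; first by rewrite fin_numX.
by apply: expe_ge0; apply: integral_ge0 => t _; rewrite lee_fin ltW// wt1_gt0.
Qed.

Definition sh2 (v : V * V) (t : R) (z : V * V) : V * V := (z.1 + t *: v.1, z.2 + t *: v.2).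

Lemma measurable_sh2 v : measurable_fun setT (fun p : measurableTypeR R * (V * V) => sh2 v p.1 p.2).
Proof.
apply: measurable_fun_pair; apply: measurable_rv_add.
- exact: (measurableT_comp measurable_fst measurable_snd).
- by apply: (@measurable_rv_scale _ _ (fun p : measurableTypeR R * (V * V) => p.1)); exact: measurable_fst.
- exact: (measurableT_comp measurable_snd measurable_snd).
- by apply: (@measurable_rv_scale _ _ (fun p : measurableTypeR R * (V * V) => p.1)); exact: measurable_fst.
Qed.

Lemma sh2_0 v x : sh2 v 0 x = x.
Proof. by case: x => x y; rewrite /sh2 !scale0r !addr0. Qed.

Lemma sh2_inv v t (f : V * V -> \bar R) : measurable_fun setT f ->
  (forall x, 0 <= f x)%E -> (\int[prodm mu mu]_x f (sh2 v t x) = \int[prodm mu mu]_x f x)%E.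
Proof.
move=> mf f0.
have msh : measurable_fun setT (sh2 v t) by exact: (measurableT_comp (measurable_sh2 v) (pair1_measurable t)).
have H1 := @fubini_tonelli1 _ _ _ _ R mu mu _ (measurableT_comp mf msh) (fun x => f0 _).
have H2 := @fubini_tonelli1 _ _ _ _ R mu mu _ mf f0.
rewrite [LHS]H1 [RHS]H2 /fubini_F /=.
under eq_integral => x _.
  rewrite /sh2 /=.
  rewrite (ge0_integral_rvD (t *: v.2) (f := fun y => f (x + t *: v.1, y)))//; last first.
    exact: (measurableT_comp mf (pair1_measurable _)).
  over.
rewrite (ge0_integral_rvD (t *: v.1) (f := fun x => (\int[mu]_y f (x, y))%E))//.
- exact: measurable_int_section.
- by move=> x; exact: integral_ge0.
Qed.

End rv_flow.

(** * Decay of oscillatory integrals *)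

Section oscillatory.
Context {R : realType} (n : nat).
Notation V := 'rV[R]_n.
Notation mu := (@rv_measure R n).
Notation C := R[i].

Lemma cder1_phase (x tau v : V) :
  cder1 (fun s => cexpi (dotv (x + s *: v) tau))
        (fun s => (Ci * cofR (dotv v tau)) * cexpi (dotv (x + s *: v) tau)).
Proof.
have := cder1_expi (dotv x tau) (dotv v tau).
by congr (cder1 _ _); apply/funext => s; rewrite dotvDl dotvZl.
Qed.

Lemma cmeas_phase (tau : V) : cmeas (fun x => cexpi (dotv x tau)).
Proof. by apply: cmeas_expi; apply: measurable_dotv => //; exact: measurable_cst. Qed.

Variables (I : Type) (D : (I -> V -> C) -> Prop).
Hypothesis Dbd : forall P, D P -> forall j, exists K : R, forall x, cabs (P j x) <= K * wt x.
Hypothesis Dmeas : forall P, D P -> forall j, cmeas (P j).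
Hypothesis Dder : forall P, D P -> forall i : 'I_n, exists2 P', D P' &
  forall j x, cder1 (fun s => P j (x + s *: coordv i)) (fun s => P' j (x + s *: coordv i)).
Hypothesis DB : forall P Q, D P -> D Q -> D (fun j x => P j x - Q j x).

Lemma Dcintg P j : D P -> cintg mu (P j).
Proof.
move=> DP; have [K PK] := Dbd DP j.
apply: (gdom_cintg (gdomZ (normr_ge0 K) (gdom_wt n))); first exact: Dmeas.
by move=> x; rewrite (le_trans (PK x))// ler_wpM2r ?wt_ge0// ler_norm.
Qed.

Let Dcintg_phase P j tau : D P -> cintg mu (fun x => P j x * cexpi (dotv x tau)).
Proof.
move=> DP; have := cintgM_bd (Dcintg j DP) (cmeas_phase tau) (K := 1).
rewrite (_ : (fun x => P j x * _) = fun x => cexpi (dotv x tau) * P j x); last first.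
  by apply/funext => x; rewrite mulrC.
by apply => x; rewrite cabs_expi.
Qed.

Let step1 P P' i j tau : D P -> D P' ->
  (forall x, cder1 (fun s => P j (x + s *: coordv i)) (fun s => P' j (x + s *: coordv i))) ->
  (forall x, ccont (fun s => P' j (x + s *: coordv i))) ->
  CI mu (fun x => P' j x * cexpi (dotv x tau)) =
  - (Ci * cofR (tau 0 i)) * CI mu (fun x => P j x * cexpi (dotv x tau)).
Proof.
move=> DP DP' dP cP'.
have i2 : cintg mu (fun x => P j x * (Ci * cofR (tau 0 i) * cexpi (dotv x tau))).
  have := cintgZ (Ci * cofR (tau 0 i)) (Dcintg_phase j tau DP).
  by congr (cintg _ _); apply/funext => x; rewrite mulrCA.
rewrite (flow_IBP (measurable_sh1 (coordv i)) (@sh1_0 _ _ (coordv i)) (@sh1_inv _ _ (coordv i))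
  (f := P j) (g := fun x => cexpi (dotv x tau)) (g' := fun x => Ci * cofR (tau 0 i) * cexpi (dotv x tau)))//.
- rewrite mulNr -CIZ//; last exact: Dcintg_phase.
  by congr (- _); apply: eq_CI => x; rewrite mulrCA.
- by move=> x; have := cder1_phase x tau (coordv i); rewrite dotv_coord.
- move=> x; apply: (@ccontM _ (fun=> _)); last exact: cder1_cont (cder1_phase x tau (coordv i)).
  exact: cder1_cont (cder1_cst _).
- exact: Dcintg_phase.
- exact: Dcintg_phase.
Qed.

(** [Q] is chosen before [j] and [tau]. The index [j] will hold the window centre [k] and, for
    kernels, a pair of frequency points, so this order of quantifiers is the source of
    uniformity. *)
Let step P i : D P -> exists2 Q, D Q & forall j tau,
  CI mu (fun x => P j x * cexpi (dotv x tau)) =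
  cofR (wt1 (tau 0 i)) * CI mu (fun x => Q j x * cexpi (dotv x tau)).
Proof.
move=> DP; have [P1 DP1 dP1] := Dder DP i; have [P2 DP2 dP2] := Dder DP1 i.
(* [P3] is used only to know that [P2] is continuous along lines. *)
have [P3 DP3 dP3] := Dder DP2 i.
exists (fun j x => P j x - P2 j x); first exact: DB.
move=> j tau.
have E1 : CI mu (fun x => (P j x - P2 j x) * cexpi (dotv x tau)) =
   CI mu (fun x => P j x * cexpi (dotv x tau)) - CI mu (fun x => P2 j x * cexpi (dotv x tau)).
  by rewrite -CIB; [apply: eq_CI => x; rewrite mulrBl|exact: Dcintg_phase..].
rewrite E1 (step1 tau DP1 DP2 (dP2 j) (fun x => cder1_cont (dP3 j x))).
rewrite (step1 tau DP DP1 (dP1 j) (fun x => cder1_cont (dP2 j x))).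
set z := CI _ _; set t := tau 0 i.
have -> : z - - (Ci * cofR t) * (- (Ci * cofR t) * z) = cofR (1 + t ^+ 2) * z.
  rewrite (_ : cofR (1 + t ^+ 2) = 1 - (Ci * cofR t) * (Ci * cofR t)); first by ring.
  by apply: cplxP; rewrite ?(cReD, cImD, cReN, cImN, cReM, cImM) /=; ring.
by rewrite mulrA -cofRM /wt1 mulVf ?gt_eqF ?one_sqr_gt0// cofR1 mul1r.
Qed.

(* Integration by parts with [1 - d_i^2] in every coordinate; the class [D] need only be
   stable under the operations this involves. *)
Lemma oscillatory_decay P : D P -> exists2 Q, D Q & forall j tau,
  CI mu (fun x => P j x * cexpi (dotv x tau)) =
  cofR (wt tau) * CI mu (fun x => Q j x * cexpi (dotv x tau)).
Proof.
move=> DP; rewrite /wt.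
elim: (index_enum 'I_n) => [|i s [Q DQ PQ]].
  by exists P => // j tau; rewrite big_nil cofR1 mul1r.
have [Q' DQ' QQ'] := step i DQ.
by exists Q' => // j tau; rewrite PQ QQ' big_cons mulrA -cofRM (mulrC (wt1 _)).
Qed.

End oscillatory.

(** * Iterated directional derivatives *)

Lemma norm_sub_half {R : realType} (A B c e : R) :
  `|A - c| <= e / 2 -> `|B - c| <= e / 2 -> `|A - B| <= e.
Proof.
by rewrite !ler_norml => /andP[? ?] /andP[? ?]; apply/andP; split; lra.
Qed.

Lemma subr_swap {V : zmodType} (a b c d : V) : a - b - (c - d) = a - c - (b - d).
Proof. by rewrite !opprB !addrA (addrAC (a - b)) (addrAC a (- b)) (addrAC (a - c) (- b)). Qed.

Section line_derivative.
Context {R : realType} (X : normedModType R).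
Implicit Types (G : X -> R) (x v w : X).

Lemma is_derive_line G v : (forall x, derivable G x v) ->
  forall x t, is_derive t (1:R) (fun s => G (x + s *: v)) ('D_v G (x + t *: v)).
Proof.
move=> dG x t.
have E : (fun h : R => h^-1 *: (G (h *: v + (x + t *: v)) - G (x + t *: v))) =
  (fun h : R => h^-1 *: ((fun s => G (x + s *: v)) (h *: (1:R) + t) - (fun s => G (x + s *: v)) t)).
  apply/funext => h; congr (_ *: (G _ - _)).
  by rewrite (_ : h *: (1:R) = h) ?scalerDl 1?addrCA//; exact: mulr1.
have := dG (x + t *: v); rewrite /derivable E => dl.
by split => //; rewrite /derive E.
Qed.

(** The mean value theorem is used twice: in the direction [v] for the difference of two translates
    by [s *: w], then in the direction [w] for ['D_v G]. *)
Lemma second_difference_MVT G v w (s : R) x : 0 < s ->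
  (forall x, derivable G x v) -> (forall x, derivable ('D_v G) x w) ->
  exists a b : R, [/\ 0 <= a <= s, 0 <= b <= s &
    G (x + s *: v + s *: w) - G (x + s *: v) - (G (x + s *: w) - G x) =
    s ^+ 2 * 'D_w ('D_v G) (x + a *: v + b *: w)].
Proof.
move=> s0 dG ddG.
pose p (u : R) := G (x + s *: w + u *: v) - G (x + u *: v).
have dp (u : R) : is_derive u (1:R) p ('D_v G (x + s *: w + u *: v) - 'D_v G (x + u *: v)).
  by apply: is_derive1D; [exact: is_derive_line|apply: is_derive1N; exact: is_derive_line].
have cp : {within `[0, s], continuous p}.
  apply: continuous_subspaceT => u; apply/differentiable_continuous/derivable1_diffP.
  by have [] := dp u.
have [a a_in pa] := MVT s0 (fun u _ => dp u) cp.
pose q (u : R) := 'D_v G (x + a *: v + u *: w).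
have dq (u : R) : is_derive u (1:R) q ('D_w ('D_v G) (x + a *: v + u *: w)) by exact: is_derive_line.
have cq : {within `[0, s], continuous q}.
  apply: continuous_subspaceT => u; apply/differentiable_continuous/derivable1_diffP.
  by have [] := dq u.
have [b b_in qb] := MVT s0 (fun u _ => dq u) cq.
exists a, b; split.
- by move: a_in; rewrite in_itv/= => /andP[a0 a1]; rewrite !ltW.
- by move: b_in; rewrite in_itv/= => /andP[a0 a1]; rewrite !ltW.
have -> : G (x + s *: v + s *: w) - G (x + s *: v) - (G (x + s *: w) - G x) = p s - p 0.
  by rewrite /p !scale0r !addr0 (addrAC x).
rewrite pa subr0 (_ : _ - 'D_v G (x + a *: v) = q s - q 0); last first.
  by rewrite /q scale0r addr0 (addrAC x).
by rewrite qb subr0 expr2; ring.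
Qed.

(** Both mixed derivatives, each at a suitable point near [x], equal the same second difference
    divided by [r ^+ 2]. Continuity then makes their difference at [x] arbitrarily small. *)
Lemma derive_commute G v w x :
  (forall x, derivable G x v) -> (forall x, derivable ('D_v G) x w) ->
  (forall x, derivable G x w) -> (forall x, derivable ('D_w G) x v) ->
  continuous ('D_w ('D_v G)) -> continuous ('D_v ('D_w G)) ->
  'D_w ('D_v G) x = 'D_v ('D_w G) x.
Proof.
move=> d1 d2 d3 d4 c1 c2.
apply/eqP; rewrite -subr_eq0 -normr_le0; apply/ler_addgt0Pl => e e0; rewrite addr0.
pose f1 (p : R * R) := x + p.1 *: v + p.2 *: w.
pose f2 (p : R * R) := x + p.1 *: w + p.2 *: v.
have cf (v1 w1 : X) : continuous (fun p : R * R => x + p.1 *: v1 + p.2 *: w1).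
  move=> p; apply: cvgD; last by apply: cvgZr_tmp; exact: cvg_snd.
  by apply: cvgD; [exact: cvg_cst|apply: cvgZr_tmp; exact: cvg_fst].
have e20 : 0 < e / 2 by rewrite divr_gt0.
have H1 : \forall p \near (0, 0) : R * R, `|'D_w ('D_v G) x - 'D_w ('D_v G) (f1 p)| <= e / 2.
  have : ('D_w ('D_v G) \o f1) p @[p --> ((0:R), (0:R))] --> 'D_w ('D_v G) (f1 (0, 0)).
    by apply: (@continuous_comp _ _ _ f1 ('D_w ('D_v G)) (0, 0)); [exact: (cf v w (0, 0))|exact: c1].
  by move=> /cvgrPdist_le/(_ _ e20); rewrite /f1 /= !scale0r !addr0.
have H2 : \forall p \near (0, 0) : R * R, `|'D_v ('D_w G) x - 'D_v ('D_w G) (f2 p)| <= e / 2.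
  have : ('D_v ('D_w G) \o f2) p @[p --> ((0:R), (0:R))] --> 'D_v ('D_w G) (f2 (0, 0)).
    by apply: (@continuous_comp _ _ _ f2 ('D_v ('D_w G)) (0, 0)); [exact: (cf w v (0, 0))|exact: c2].
  by move=> /cvgrPdist_le/(_ _ e20); rewrite /f2 /= !scale0r !addr0.
have [r r0 Hr] : exists2 r : R, 0 < r & forall p : R * R, `|p.1| <= r -> `|p.2| <= r ->
   `|'D_w ('D_v G) x - 'D_w ('D_v G) (f1 p)| <= e / 2 /\ `|'D_v ('D_w G) x - 'D_v ('D_w G) (f2 p)| <= e / 2.
  have [[A B] /= [A0 B0] AB] := filterI H1 H2.
  move: A0 B0 => /(nbhs_ballP (0 : R))[r1 /= r10 Hr1] /(nbhs_ballP (0 : R))[r2 /= r20 Hr2].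
  have m0 : 0 < Num.min r1 r2 by rewrite lt_min r10.
  exists (Num.min r1 r2 / 2); first by rewrite divr_gt0.
  have rr : Num.min r1 r2 / 2 < Num.min r1 r2 by rewrite ltr_pdivrMr// ltr_pMr// ltr1n.
  move=> p p1 p2; apply: AB; split => /=.
    by apply: Hr1; rewrite -ball_normE /= sub0r normrN (le_lt_trans p1)// (lt_le_trans rr)// ge_min lexx.
  by apply: Hr2; rewrite -ball_normE /= sub0r normrN (le_lt_trans p2)// (lt_le_trans rr)// ge_min lexx orbT.
have [a [b [a_in b_in E1]]] := second_difference_MVT x r0 d1 d2.
have [a' [b' [a_in' b_in' E2]]] := second_difference_MVT x r0 d3 d4.
have E : 'D_w ('D_v G) (f1 (a, b)) = 'D_v ('D_w G) (f2 (a', b')).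
  have r20 : r ^+ 2 != 0 by rewrite expf_neq0// gt_eqF.
  move: E1 E2; rewrite (addrAC x (r *: v)) subr_swap => -> E2.
  exact: (mulfI r20 E2).
have nr (u : R) : 0 <= u <= r -> `|u| <= r by move=> /andP[u0 ur]; rewrite ger0_norm.
have [h1 _] := Hr (a, b) (nr _ a_in) (nr _ b_in).
have [_ h2] := Hr (a', b') (nr _ a_in') (nr _ b_in').
by rewrite -{}E /= in h2; exact: norm_sub_half h1 h2.
Qed.

End line_derivative.

Section words.
Context {R : realType} (X : normedModType R).
Notation C := R[i].
Implicit Types (F : X -> C) (s : seq X) (v w x : X).

(** The fold that occurs in [smoothC]. Words are preferred to multi-indices because letters can be
    added one at a time. *)
Definition dword s F : X -> C := foldr (fun v H => cderive v H) F s.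

Lemma dword_cat s s' F : dword (s ++ s') F = dword s (dword s' F).
Proof. by rewrite /dword foldr_cat. Qed.

Lemma smoothC_dword F s : smoothC F -> smoothC (dword s F).
Proof. by move=> sF s'; have := sF (s' ++ s); rewrite /dword foldr_cat. Qed.

Lemma smoothC_cder F v x : smoothC F ->
  cder1 (fun t => F (x + t *: v)) (fun t => cderive v F (x + t *: v)).
Proof.
move=> /(_ [::]) /= [dF _] t.
by split=> /=; apply: is_derive_line => y; have [] := dF v y.
Qed.

Lemma smoothC_cont F : smoothC F ->
  continuous (fun x => cRe (F x)) /\ continuous (fun x => cIm (F x)).
Proof. by move=> /(_ [::]) /= [_]. Qed.

Lemma cderive_commute F v w : smoothC F -> cderive v (cderive w F) = cderive w (cderive v F).
Proof.
move=> sF; apply/funext => x.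
have [d0 _] := sF [::].
have [dv _] := sF [:: v]; have [dw _] := sF [:: w].
have [_ [cvwr cvwi]] := sF [:: v; w]; have [_ [cwvr cwvi]] := sF [:: w; v].
apply: cplxP.
  exact: (@derive_commute _ _ (fun y => cRe (F y)) w v x (fun y => (d0 w y).1)
    (fun y => (dw v y).1) (fun y => (d0 v y).1) (fun y => (dv w y).1) cvwr cwvr).
exact: (@derive_commute _ _ (fun y => cIm (F y)) w v x (fun y => (d0 w y).2)
    (fun y => (dw v y).2) (fun y => (d0 v y).2) (fun y => (dv w y).2) cvwi cwvi).
Qed.

Lemma dword_move F s1 v s2 : smoothC F -> dword (s1 ++ v :: s2) F = dword (v :: s1 ++ s2) F.
Proof.
move=> sF; elim: s1 => [//|w s1 IH] /=.
rewrite -[LHS]/(cderive w (dword (s1 ++ v :: s2) F)) IH /=.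
rewrite -/(dword _ _) cderive_commute//; exact: smoothC_dword.
Qed.

Lemma dword_perm F s s' : smoothC F -> perm_eq s s' -> dword s F = dword s' F.
Proof.
move=> sF; elim: s s' => [|v s IH] s'.
  by move=> /perm_size /eqP; rewrite eq_sym size_eq0 => /eqP ->.
move=> ss'; have vs' : v \in s' by rewrite -(perm_mem ss') mem_head.
case/splitPr: vs' ss' => s1 s2 ss'.
rewrite dword_move//= -!/(dword _ _) (IH (s1 ++ s2))//.
by move: ss'; rewrite -cat1s -[v :: s2]cat1s perm_sym perm_catCA perm_sym perm_cat2l.
Qed.

Lemma Dmulti_word n (e : 'I_n -> X) (alpha : 'I_n -> nat) F :
  Dmulti e alpha F = dword (map e (flatten [seq nseq (alpha i) i | i <- enum 'I_n])) F.
Proof.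
rewrite /Dmulti; elim: (enum 'I_n) => [//|i s IH] /=.
rewrite map_cat dword_cat -IH.
by elim: (alpha i) => //= k ->.
Qed.

Lemma perm_count_enum n (s : seq 'I_n) :
  perm_eq (flatten [seq nseq (count_mem i s) i | i <- enum 'I_n]) s.
Proof.
apply/allP => j _ /=; apply/eqP.
rewrite count_flatten -map_comp sumnE big_map.
rewrite (bigD1_seq j) ?mem_enum ?enum_uniq//= count_nseq /= eqxx mul1n big1 ?addn0//.
by move=> i ij; rewrite count_nseq /= (negbTE ij).
Qed.

(** Symmetry of mixed derivatives allows a word to be sorted, so estimates stated for multi-indices
    apply to words. *)
Lemma dword_Dmulti n (e : 'I_n -> X) (s : seq 'I_n) F : smoothC F ->
  dword (map e s) F = Dmulti e (fun i => count_mem i s) F.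
Proof.
move=> sF; rewrite Dmulti_word; apply: dword_perm => //.
by rewrite perm_sym; apply: perm_map; exact: perm_count_enum.
Qed.

Lemma mabs_count n (s : seq 'I_n) : mabs (fun i => count_mem i s) = size s.
Proof.
rewrite /mabs -(perm_size (perm_count_enum s)) size_flatten /shape -map_comp sumnE big_map big_enum /=.
by apply: eq_bigr => i _; rewrite size_nseq.
Qed.

End words.

(** * Square integrals over slices of the symbol *)

Section slices.
Context {R : realType} (n : nat).
Notation V := 'rV[R]_n.
Notation X3 := (V * V * V)%type.
Notation mu := (@rv_measure R n).
Notation leb := (@lebesgue_measure R).
Local Open Scope ereal_scope.

Lemma continuous_measurable_rv (G : V -> R) : continuous G -> measurable_fun setT G.
Proof. by move=> cG; apply: (approximable_measurable _ cG); apply: approximable_rv. Qed.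

Lemma continuous_measurable3 (G : X3 -> R) : continuous G -> measurable_fun setT G.
Proof.
move=> cG.
have H : @approximable _ X3 X3 (fun p => (p.1.1, p.1.2, p.2)).
  apply: approximable_pair; first apply: approximable_pair.
  - by apply: approximable_rv; exact: measurableT_comp.
  - by apply: approximable_rv; exact: measurableT_comp.
  - by apply: approximable_rv; exact: measurable_snd.
have := approximable_measurable H cG.
by congr measurable_fun; apply/funext => -[[x y] z].
Qed.

Definition ballI (x0 x : V) : R := \1_[set y : V | (enorm (y - x0) < 1)%R] x.

Lemma measurable_enorm d (T : measurableType d) (f : T -> V) : measurable_fun setT f ->
  measurable_fun setT (fun t => enorm (f t)).
Proof.
move=> mf; apply: (measurableT_comp (@continuous_measurable_fun R Num.sqrt (@sqrt_continuous R))).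
exact: measurable_dotv.
Qed.

Lemma measurable_ballI2 : measurable_fun setT (fun p : V * V => ballI p.1 p.2).
Proof.
rewrite (_ : (fun _ => _) = \1_[set p : V * V | (enorm (p.2 - p.1) < 1)%R]); last first.
  by apply/funext => p; rewrite /ballI !indicE; congr (nat_of_bool _)%:R.
apply: measurable_indic.
have m : measurable_fun setT (fun p : V * V => enorm (p.2 - p.1)).
  apply: measurable_enorm; apply: measurable_rv_add; first exact: measurable_snd.
  by apply: measurable_rv_opp; exact: measurable_fst.
rewrite (_ : [set p | _] = (fun p : V * V => enorm (p.2 - p.1)) @^-1` `]-oo, 1%R[%classic).
  by rewrite -[X in measurable X]setTI; exact: m.
by apply/seteqP; split=> p /=; rewrite in_itv.
Qed.

Lemma measurable_ballI x0 : measurable_fun setT (ballI x0).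
Proof. exact: (measurableT_comp measurable_ballI2 (pair1_measurable x0)). Qed.

Lemma ballI_ge0 x0 x : (0 <= ballI x0 x)%R.
Proof. by rewrite /ballI indicE. Qed.

(** For [q] the squared modulus of a derivative of [a] in [x], this is the square of the quantity
    bounded in the hypothesis. A general nonnegative [q] is allowed because the interpolation also
    needs it for averages of such squares along lines. *)
Definition slice (q : X3 -> \bar R) (x0 zeta : V) : \bar R :=
  \int[mu]_x ((ballI x0 x)%:E * \int[mu]_eta q (x, (zeta - eta)%R, eta)).

Definition slice_bounded (q : X3 -> \bar R) : Prop :=
  exists K : R, forall x0 zeta, slice q x0 zeta <= K%:E.

Lemma measurable_slice_pt d (T : measurableType d) (fx fz fe : T -> V) (q : X3 -> \bar R) :
  measurable_fun setT q -> measurable_fun setT fx -> measurable_fun setT fz -> measurable_fun setT fe ->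
  measurable_fun setT (fun t => q (fx t, fz t, fe t)).
Proof.
by move=> mq mx mz me; apply: (measurableT_comp mq); apply: measurable_fun_pair => //; apply: measurable_fun_pair.
Qed.

Lemma measurable_subl (zeta : V) : measurable_fun setT (fun eta : V => zeta - eta)%R.
Proof. by apply: measurable_rv_add; [exact: measurable_cst|exact: measurable_rvN]. Qed.

Lemma measurable_slice_eta (q : X3 -> \bar R) (x zeta : V) : measurable_fun setT q ->
  measurable_fun setT (fun eta : V => q (x, (zeta - eta)%R, eta)).
Proof.
move=> mq; apply: measurable_slice_pt => //; first exact: measurable_subl.
Qed.

Lemma measurable_slice_x (q : X3 -> \bar R) (zeta : V) : measurable_fun setT q -> (forall p, 0 <= q p) ->
  measurable_fun setT (fun x : V => \int[mu]_eta q (x, (zeta - eta)%R, eta)).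
Proof.
move=> mq q0.
apply: (measurable_int_section mu (f := fun p : V * V => q (p.1, (zeta - p.2)%R, p.2))) => //.
apply: measurable_slice_pt => //.
by apply: measurable_rv_add; [exact: measurable_cst|apply: measurable_rv_opp; exact: measurable_snd].
Qed.

Lemma measurable_slice_integrand (q : X3 -> \bar R) (x0 zeta : V) : measurable_fun setT q -> (forall p, 0 <= q p) ->
  measurable_fun setT (fun x : V => (ballI x0 x)%:E * \int[mu]_eta q (x, (zeta - eta)%R, eta)).
Proof.
move=> mq q0; apply: emeasurable_funM; last exact: measurable_slice_x.
by apply/measurable_EFinP; exact: measurable_ballI.
Qed.

Lemma slice_integrand_ge0 (q : X3 -> \bar R) (x0 zeta x : V) : (forall p, 0 <= q p) ->
  0 <= (ballI x0 x)%:E * \int[mu]_eta q (x, (zeta - eta)%R, eta).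
Proof.
move=> q0; apply: mule_ge0; first by rewrite lee_fin ballI_ge0.
exact: integral_ge0.
Qed.

Lemma slice_le q q' x0 zeta : measurable_fun setT q -> measurable_fun setT q' ->
  (forall p, 0 <= q p) -> (forall p, q p <= q' p) -> slice q x0 zeta <= slice q' x0 zeta.
Proof.
move=> mq mq' q0 qq'.
have q0' p : 0 <= q' p by exact: le_trans (qq' p).
apply: ge0_le_integral => //.
- by move=> x _; exact: slice_integrand_ge0.
- exact: measurable_slice_integrand.
- exact: measurable_slice_integrand.
- move=> x _; apply: lee_wpmul2l; first by rewrite lee_fin ballI_ge0.
  by apply: ge0_le_integral => //; exact: measurable_slice_eta.
Qed.

Lemma slice_bounded_le q q' : measurable_fun setT q -> measurable_fun setT q' ->
  (forall p, 0 <= q p) -> (forall p, q p <= q' p) -> slice_bounded q' -> slice_bounded q.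
Proof.
move=> mq mq' q0 qq' [K HK]; exists K => x0 zeta.
by apply: le_trans (HK x0 zeta); exact: slice_le.
Qed.

Lemma slice_boundedD q q' : measurable_fun setT q -> measurable_fun setT q' ->
  (forall p, 0 <= q p) -> (forall p, 0 <= q' p) ->
  slice_bounded q -> slice_bounded q' -> slice_bounded (fun p => q p + q' p).
Proof.
move=> mq mq' q0 q0' [K HK] [K' HK']; exists (K + K')%R => x0 zeta.
rewrite EFinD; apply: le_trans (leeD (HK x0 zeta) (HK' x0 zeta)).
rewrite /slice -ge0_integralD//.
- rewrite le_eqVlt; apply/orP; left; apply/eqP; apply: eq_integral => x _.
  rewrite -ge0_muleDr//; [|exact: integral_ge0..].
  by congr (_ * _); rewrite ge0_integralD//; exact: measurable_slice_eta.
- by move=> x _; exact: slice_integrand_ge0.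
- exact: measurable_slice_integrand.
- by move=> x _; exact: slice_integrand_ge0.
- exact: measurable_slice_integrand.
Qed.

Lemma slice_boundedZ (k : R) q : (0 <= k)%R -> measurable_fun setT q -> (forall p, 0 <= q p) ->
  slice_bounded q -> slice_bounded (fun p => k%:E * q p).
Proof.
move=> k0 mq q0 [K HK]; exists (k * K)%R => x0 zeta.
rewrite EFinM; apply: le_trans (lee_wpmul2l _ (HK x0 zeta)); last by rewrite lee_fin.
rewrite /slice -ge0_integralZl//.
- rewrite le_eqVlt; apply/orP; left; apply/eqP; apply: eq_integral => x _.
  by rewrite muleCA; congr (_ * _); rewrite ge0_integralZl//; exact: measurable_slice_eta.
- exact: measurable_slice_integrand.
- by move=> x _; exact: slice_integrand_ge0.
Qed.

Definition sh3 (v w : V) (t : R) (p : X3) : X3 :=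
  (p.1.1, (p.1.2 + t *: v)%R, (p.2 + t *: w)%R).

(** After a substitution in [eta], a translation of the two frequencies only changes [zeta]. Bounds
    uniform in [zeta] are therefore invariant under such translations, which is what allows finite
    differences to be used. *)
Lemma slice_shift q x0 zeta (v w : V) t : measurable_fun setT q -> (forall p, 0 <= q p) ->
  slice (fun p => q (sh3 v w t p)) x0 zeta = slice q x0 (zeta + t *: v + t *: w)%R.
Proof.
move=> mq q0; apply: eq_integral => x _; congr (_ * _).
rewrite -(ge0_integral_rvD (t *: w) (f := fun eta : V => q (x, (zeta + t *: v + t *: w - eta)%R, eta)))//; last exact: measurable_slice_eta.
apply: eq_integral => eta _; congr (q (_, _, _)).
by rewrite /=; apply/rowP => i; rewrite !mxE; ring.
Qed.

Lemma slice_bounded_shift q (v w : V) t : measurable_fun setT q -> (forall p, 0 <= q p) ->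
  slice_bounded q -> slice_bounded (fun p => q (sh3 v w t p)).
Proof. by move=> mq q0 [K HK]; exists K => x0 zeta; rewrite slice_shift. Qed.

Definition unitI (t : R) : R := \1_`[0%R, 1%R]%classic t.

Lemma measurable_unitI : measurable_fun setT unitI.
Proof. exact: measurable_indic. Qed.

Lemma unitI_ge0 t : (0 <= unitI t)%R. Proof. by rewrite /unitI indicE. Qed.

Lemma integral_unitI : \int[leb]_t (unitI t)%:E = 1.
Proof.
by rewrite integral_indic// setIT [LHS]lebesgue_measure_itv/= lte_fin ltr01 oppr0 adde0.
Qed.

Lemma measurable_shift3 (v w : V) :
  measurable_fun setT (fun p : measurableTypeR R * X3 => sh3 v w p.1 p.2).
Proof.
have m1 := @measurable_fst _ _ (measurableTypeR R) X3.
have m2 := @measurable_snd _ _ (measurableTypeR R) X3.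
apply: measurable_fun_pair; first apply: measurable_fun_pair.
- exact: (measurableT_comp measurable_fst (measurableT_comp measurable_fst m2)).
- apply: measurable_rv_add; last exact: (measurable_rv_scale v m1).
  exact: (measurableT_comp measurable_snd (measurableT_comp measurable_fst m2)).
- apply: measurable_rv_add; last exact: (measurable_rv_scale w m1).
  exact: (measurableT_comp measurable_snd m2).
Qed.

Definition line_avg (q : X3 -> \bar R) (v w : V) (p : X3) : \bar R :=
  \int[leb]_t ((unitI t)%:E * q (sh3 v w t p)).

Let measurable_avg_integrand q v w : measurable_fun setT q ->
  measurable_fun setT (fun p : measurableTypeR R * X3 => (unitI p.1)%:E * q (sh3 v w p.1 p.2)).
Proof.
move=> mq; apply: emeasurable_funM; last exact: (measurableT_comp mq (measurable_shift3 v w)).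
by apply/measurable_EFinP; exact: (measurableT_comp measurable_unitI measurable_fst).
Qed.

Lemma measurable_line_avg q v w : measurable_fun setT q -> (forall p, 0 <= q p) ->
  measurable_fun setT (line_avg q v w).
Proof.
move=> mq q0.
apply: (measurable_int_section leb (f := fun p : X3 * measurableTypeR R => (unitI p.2)%:E * q (sh3 v w p.2 p.1))).
  exact: (measurableT_comp (measurable_avg_integrand v w mq) (@measurable_swap _ _ X3 (measurableTypeR R))).
by move=> p; apply: mule_ge0; rewrite ?lee_fin ?unitI_ge0.
Qed.

Lemma line_avg_ge0 q v w p : (forall p, 0 <= q p) -> 0 <= line_avg q v w p.
Proof. by move=> q0; apply: integral_ge0 => t _; apply: mule_ge0; rewrite ?lee_fin ?unitI_ge0. Qed.

(** Tonelli takes the average in [t] outside. For each [t] the shifted slice is a slice at another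
    [zeta] and obeys the same bound [K], and the interval of averaging has length one. *)
Lemma slice_bounded_avg q (v w : V) : measurable_fun setT q -> (forall p, 0 <= q p) ->
  slice_bounded q -> slice_bounded (line_avg q v w).
Proof.
move=> mq q0 [K HK]; exists K => x0 zeta.
pose g t x eta := (unitI t)%:E * q (sh3 v w t (x, (zeta - eta)%R, eta)).
have g0 t x eta : 0 <= g t x eta by apply: mule_ge0; rewrite ?lee_fin ?unitI_ge0.
have mg d (T : measurableType d) (ft : T -> measurableTypeR R) (fx fe : T -> V) : measurable_fun setT ft -> measurable_fun setT fx ->
    measurable_fun setT fe -> measurable_fun setT (fun u => g (ft u) (fx u) (fe u)).
  move=> mt mx me.
  have m : measurable_fun setT (fun u => (ft u, (fx u, (zeta - fe u)%R, fe u))).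
    apply: measurable_fun_pair => //; apply: measurable_fun_pair => //; apply: measurable_fun_pair => //.
    exact: (measurableT_comp (measurable_subl zeta) me).
  exact: (measurableT_comp (measurable_avg_integrand v w mq) m).
rewrite /slice /line_avg.
have E1 x : \int[mu]_eta \int[leb]_t g t x eta = \int[leb]_t \int[mu]_eta g t x eta.
  apply: (ge0_fubini _ _ (f := fun p : V * measurableTypeR R => g p.2 x p.1)) => //.
  by apply: mg; [exact: measurable_snd|exact: measurable_cst|exact: measurable_fst].
under eq_integral => x _.
  rewrite E1 -ge0_integralZl//; last 3 first.
  - have := measurable_int_section mu (f := fun p : measurableTypeR R * V => g p.1 x p.2) _ (fun p => g0 _ _ _).
    by apply; apply: mg; [exact: measurable_fst|exact: measurable_cst|exact: measurable_snd].
  - by move=> t _; exact: integral_ge0.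
  - by rewrite lee_fin ballI_ge0.
  over.
have mG : measurable_fun setT (fun p : V * measurableTypeR R => (ballI x0 p.1)%:E * \int[mu]_eta g p.2 p.1 eta).
  apply: emeasurable_funM.
    by apply/measurable_EFinP; exact: (measurableT_comp (measurable_ballI x0) measurable_fst).
  have := measurable_int_section mu (f := fun p : (V * measurableTypeR R) * V => g p.1.2 p.1.1 p.2) _ (fun p => g0 _ _ _).
  apply; apply: mg; last exact: measurable_snd.
    exact: (measurableT_comp measurable_snd measurable_fst).
  exact: (measurableT_comp measurable_fst measurable_fst).
have G0 x t : 0 <= (ballI x0 x)%:E * \int[mu]_eta g t x eta.
  by apply: mule_ge0; [rewrite lee_fin ballI_ge0|exact: integral_ge0].
rewrite (ge0_fubini _ _ (f := fun p : V * measurableTypeR R => (ballI x0 p.1)%:E * \int[mu]_eta g p.2 p.1 eta) mG (fun p => G0 _ _)) /=.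
apply: (@le_trans _ _ (\int[leb]_t ((unitI t)%:E * K%:E))); last first.
  rewrite ge0_integralZr//=.
  - by rewrite integral_unitI mul1e.
  - by apply/measurable_EFinP; exact: measurable_unitI.
  - by move=> t _; rewrite lee_fin unitI_ge0.
  - by apply: le_trans (HK 0%R 0%R); apply: integral_ge0 => x _; exact: slice_integrand_ge0.
apply: ge0_le_integral => //.
- by move=> t _; exact: integral_ge0.
- have := measurable_int_section mu (f := fun p : measurableTypeR R * V => (ballI x0 p.2)%:E * \int[mu]_eta g p.1 p.2 eta).
  apply; last by move=> p; exact: G0.
  exact: (measurableT_comp mG (@measurable_swap _ _ (measurableTypeR R) V)).
- have mU : measurable_fun setT (EFin \o unitI) by apply/measurable_EFinP; exact: measurable_unitI.
  by apply: emeasurable_funM => //; exact: mU.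
- move=> t _.
  apply: (@le_trans _ _ ((unitI t)%:E * slice (fun p => q (sh3 v w t p)) x0 zeta)); last first.
    by rewrite slice_shift//; apply: lee_wpmul2l => //; rewrite lee_fin unitI_ge0.
  have mq' : measurable_fun setT (fun p : X3 => q (sh3 v w t p)).
    exact: (measurableT_comp mq (measurableT_comp (measurable_shift3 v w) (pair1_measurable t))).
  rewrite -ge0_integralZl//; [|exact: (measurable_slice_integrand x0 zeta mq' (fun p => q0 _))|by move=> x _; exact: (slice_integrand_ge0 x0 zeta x (fun p => q0 (sh3 _ _ _ p)))|by rewrite lee_fin unitI_ge0].
  rewrite le_eqVlt; apply/orP; left; apply/eqP; apply: eq_integral => x _.
  rewrite muleCA; congr (_ * _).
  rewrite -ge0_integralZl//; [exact: (measurable_slice_eta x zeta mq')|by rewrite lee_fin unitI_ge0].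
Qed.

End slices.

(** * Interpolation between orders of differentiation *)

Section interpolation.
Context {R : realType} (n : nat).
Notation V := 'rV[R]_n.
Notation X3 := (V * V * V)%type.
Notation mu := (@rv_measure R n).
Notation leb := (@lebesgue_measure R).

(** Jensen's inequality on the unit interval, from the positivity of the integral of
    [(g t - c) ^+ 2] with [c] the mean of [g]. *)
Lemma sqr_Rintegral_unit (g : R -> R) : continuous g ->
  (((\int[leb]_(t in `[0%R, 1%R]) g t)%R ^+ 2)%:E <=
    \int[leb]_t ((unitI t)%:E * (g t ^+ 2)%:E))%E.
Proof.
move=> cg; set D : set R := `[0%R, 1%R]%classic.
have iD (h : R -> R) : continuous h -> leb.-integrable D (EFin \o h).
  by move=> ch; apply: continuous_compact_integrable; [exact: segment_compact|exact: continuous_subspaceT].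
have cg2 : continuous (fun t => g t ^+ 2).
  by move=> t; apply: (@continuous_comp _ _ _ g (fun x => x ^+ 2)); [exact: cg|exact: exprn_continuous].
set c := (\int[leb]_(t in D) g t)%R.
have ccst (k : R) : continuous (fun _ : R => k) by move=> t; exact: cvg_cst.
have cg1 : continuous (fun t => (2 * c) * g t).
  by move=> t; apply: cvgM; [exact: cvg_cst|exact: cg].
have mD : measurable (D : set (measurableTypeR R)) by exact: measurable_itv.
have lebD' : fine (leb D) = 1.
  by rewrite /D lebesgue_measure_itv/= lte_fin ltr01 oppr0 adde0.
have H : 0 <= (\int[leb]_(t in D) (g t ^+ 2 - (2 * c) * g t + c ^+ 2))%R.
  apply: Rintegral_ge0 => t _.
  by rewrite (_ : _ + _ = (g t - c) ^+ 2) ?sqr_ge0//; ring.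
have cg3 : continuous (fun t => g t ^+ 2 - (2 * c) * g t).
  by move=> t; apply: cvgB; [exact: cg2|exact: cg1].
rewrite (RintegralD _ (iD _ cg3) (iD _ (ccst (c ^+ 2))))// in H.
rewrite (RintegralB _ (iD _ cg2) (iD _ cg1))// in H.
rewrite (RintegralZl _ _ (iD _ cg))// in H.
have Hc : (\int[leb]_(t in D) (c ^+ 2))%R = c ^+ 2.
  by rewrite Rintegral_cst// lebD' mulr1.
rewrite Hc -/c in H.
have -> : (\int[leb]_t ((unitI t)%:E * (g t ^+ 2)%:E) = \int[leb]_(t in D) (g t ^+ 2)%:E)%E.
  rewrite [RHS]integral_mkcond; apply: eq_integral => t _.
  by rewrite patchE /unitI indicE -/D; case: (t \in D); rewrite ?mul1e ?mul0e.
have fi := iD _ cg2.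
rewrite -[leRHS]fineK; last exact: (integrable_fin_num _ fi).
rewrite lee_fin -subr_ge0.
set I := fine _; rewrite (_ : I - c ^+ 2 = I - 2 * c * c + c ^+ 2); last by ring.
exact: H.
Qed.

Variables (v w : V).
Notation sh := (sh3 v w).

Lemma sh3_0 p : sh 0 p = p.
Proof. by case: p => [[x y] z]; rewrite /sh3 /= !scale0r !addr0. Qed.

Lemma sh3C s t p : sh s (sh t p) = sh t (sh s p).
Proof. by case: p => [[x y] z]; rewrite /sh3 /= !(addrAC _ (t *: _)). Qed.

Definition line_diff (G G' : X3 -> R) := forall p t,
  is_derive t (1:R) (fun s => G (sh s p)) (G' (sh t p)).

Lemma line_diff_cont G G' (p : X3) : line_diff G G' -> continuous (fun t : R => G (sh t p)).
Proof.
by move=> dG t; apply/differentiable_continuous/derivable1_diffP; have [] := dG p t.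
Qed.

Lemma difference_avg G G' (p : X3) : line_diff G G' -> (forall p, continuous (fun t : R => G' (sh t p))) ->
  (((G (sh 1 p) - G p) ^+ 2)%:E <= line_avg (fun q => (G' q ^+ 2)%:E) v w p)%E.
Proof.
move=> dG cG'; have := sqr_Rintegral_unit (cG' p).
by rewrite (FTC_unit (dG p) (cG' p)) sh3_0.
Qed.

(** Taylor's formula with integral remainder: [G (sh 1 p) - G p - G' p] is the integral over the
    unit interval of [(1 - t) * G'' (sh t p)], and the factor [1 - t] is at most one. *)
Lemma derivative_difference_avg G G' G'' (p : X3) : line_diff G G' -> line_diff G' G'' ->
  (forall p, continuous (fun t : R => G'' (sh t p))) ->
  (((G' p - (G (sh 1 p) - G p)) ^+ 2)%:E <= line_avg (fun q => (G'' q ^+ 2)%:E) v w p)%E.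
Proof.
move=> dG dG' cG''.
(* Chosen so that its derivative is the integrand of the remainder: the terms in [G'] cancel. *)
pose f (t : R) := (1 - t) * G' (sh t p) + G (sh t p).
have df t : is_derive t (1:R) f ((1 - t) * G'' (sh t p)).
  have h1 : is_derive t (1:R) (fun s : R => s) 1 by exact: is_derive_id.
  have := is_derive1D (is_derive1M (is_derive1D (is_derive1_cst 1 t) (is_derive1N h1)) (dG' p t)) (dG p t).
  by move=> h; apply: is_derive_eq h _; ring.
have c1 : continuous (fun t : R => 1 - t).
  by move=> t; apply: cvgB; [exact: cvg_cst|exact: cvg_id].
have cf' : continuous (fun t : R => (1 - t) * G'' (sh t p)).
  by move=> t; apply: cvgM; [exact: c1|exact: cG''].
have := sqr_Rintegral_unit cf'; rewrite (FTC_unit df cf') /f subrr subr0 mul0r mul1r add0r sh3_0.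
rewrite (_ : (G (sh 1 p) - (G' p + G p)) ^+ 2 = (G' p - (G (sh 1 p) - G p)) ^+ 2); last by ring.
move=> /le_trans; apply.
have mE : measurable_fun setT (fun t : R => (unitI t)%:E * ((G'' (sh t p)) ^+ 2)%:E)%E.
  apply: emeasurable_funM; apply/measurable_EFinP; first exact: measurable_unitI.
  by apply: measurable_funX; apply: continuous_measurable_fun; exact: cG''.
apply: ge0_le_integral => //.
- by move=> t _; rewrite -EFinM lee_fin mulr_ge0 ?unitI_ge0 ?sqr_ge0.
- apply: emeasurable_funM; apply/measurable_EFinP; first exact: measurable_unitI.
  by apply: measurable_funX; apply: continuous_measurable_fun; exact: cf'.
move=> t _; rewrite -!EFinM lee_fin /unitI indicE.
case: (boolP (t \in _)) => [/set_mem|]; rewrite ?mul0r// !mul1r exprMn.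
rewrite /= in_itv/= => /andP[t0 t1].
rewrite ler_piMl ?sqr_ge0// -[leRHS](expr1n _ 2) ler_sqr ?nnegrE ?subr_ge0//.
by rewrite gerBl.
Qed.

Definition slice_L2 (G : X3 -> R) := slice_bounded (fun p => (G p ^+ 2)%:E).

Lemma measurable_sq3 (G : X3 -> R) : continuous G -> measurable_fun setT (fun p => (G p ^+ 2)%:E).
Proof.
by move=> cG; apply/measurable_EFinP; apply: measurable_funX; exact: continuous_measurable3.
Qed.

Lemma slice_L2_dom2 (G : X3 -> R) (q q' : X3 -> \bar R) : continuous G ->
  measurable_fun setT q -> measurable_fun setT q' ->
  (forall p, 0 <= q p)%E -> (forall p, 0 <= q' p)%E ->
  slice_bounded q -> slice_bounded q' ->
  (forall p, (G p ^+ 2)%:E <= 2%:E * q p + 2%:E * q' p)%E -> slice_L2 G.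
Proof.
move=> cG mq mq' q0 q0' bq bq' H.
apply: (slice_bounded_le _ _ _ H).
- exact: measurable_sq3.
- by apply: emeasurable_funD; apply: emeasurable_funM.
- by move=> p; rewrite lee_fin sqr_ge0.
- apply: slice_boundedD.
  + exact: emeasurable_funM.
  + exact: emeasurable_funM.
  + by move=> p; apply: mule_ge0.
  + by move=> p; apply: mule_ge0.
  + exact: slice_boundedZ.
  + exact: slice_boundedZ.
Qed.

Lemma sqrD_le2 (a b : R) : (a + b) ^+ 2 <= 2 * a ^+ 2 + 2 * b ^+ 2.
Proof. by rewrite -subr_ge0 (_ : _ - _ = (a - b) ^+ 2) ?sqr_ge0//; ring. Qed.

Lemma continuous_shift3 (G : X3 -> R) t : continuous G -> continuous (fun p : X3 => G (sh t p)).
Proof.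
move=> cG p; apply: (@continuous_comp _ _ _ (fun p : X3 => sh t p) G); last exact: cG.
have c1 : (fun q : X3 => q.1) @ p --> p.1 by exact: cvg_fst.
have c11 : (fun q : X3 => q.1.1) @ p --> p.1.1 by apply: (cvg_comp _ _ c1); exact: cvg_fst.
have c12 : (fun q : X3 => q.1.2) @ p --> p.1.2 by apply: (cvg_comp _ _ c1); exact: cvg_snd.
have c2 : (fun q : X3 => q.2) @ p --> p.2 by exact: cvg_snd.
have d12 : (fun q : X3 => q.1.2 + t *: v) @ p --> p.1.2 + t *: v by apply: cvgD; [exact: c12|exact: cvg_cst].
have d2 : (fun q : X3 => q.2 + t *: w) @ p --> p.2 + t *: w by apply: cvgD; [exact: c2|exact: cvg_cst].
exact: (cvg_pair (cvg_pair c11 d12) d2).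
Qed.

(* Apply the induction hypothesis to the first difference [A(. + u) - A], which is one derivative better. *)
Lemma slice_L2_interp m (A : nat -> X3 -> R) : (forall k, continuous (A k)) ->
  (forall k, line_diff (A k) (A k.+1)) ->
  slice_L2 (A 0%N) -> slice_L2 (A m.+1) -> slice_L2 (A m).
Proof.
elim: m A => [//|m IH] A cA dA A0 Am2.
pose B k (p : X3) := A k (sh 1 p) - A k p.
have cB k : continuous (B k).
  by have h := continuous_shift3 (t := 1) (cA k); move=> p; exact: (cvgB (h p) (cA k p)).
have dB k : line_diff (B k) (B k.+1).
  move=> p t; apply: is_derive1D; last by apply: is_derive1N; exact: dA.
  have := dA k (sh 1 p) t; rewrite /B sh3C.
  by apply: is_derive1_ext => s; rewrite sh3C.
have cl k p : continuous (fun t : R => A k (sh t p)) by exact: line_diff_cont (dA k).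
have msq k := measurable_sq3 (cA k).
have sq0 k p : (0 <= (A k p ^+ 2)%:E)%E by rewrite lee_fin sqr_ge0.
have avg2 : slice_bounded (line_avg (fun q => (A m.+2 q ^+ 2)%:E) v w).
  by apply: slice_bounded_avg.
(* [B 0] is controlled by [A 0] and its translate; [B m.+1] is controlled by an average of [A m.+2]
   along the line. *)
have BL : slice_L2 (B m).
  apply: (IH B cB dB).
    have bs := slice_bounded_shift v w 1 (msq 0%N) (sq0 0%N) A0.
    have ms := measurable_sq3 (continuous_shift3 (t := 1) (cA 0%N)).
    have H p : ((B 0%N p ^+ 2)%:E <= 2%:E * (A 0%N (sh 1 p) ^+ 2)%:E + 2%:E * (A 0%N p ^+ 2)%:E)%E.
      rewrite -!EFinM -EFinD lee_fin /B.
      by have := sqrD_le2 (A 0%N (sh 1 p)) (- A 0%N p); rewrite sqrrN.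
    have := slice_L2_dom2 (cB 0%N) ms (msq 0%N).
    by move=> /(_ (fun p => sq0 0%N (sh 1 p)) (sq0 0%N) bs A0 H).
  apply: slice_bounded_le avg2.
  - exact: measurable_sq3.
  - exact: measurable_line_avg.
  - by move=> p; rewrite lee_fin sqr_ge0.
  - by move=> p; apply: difference_avg.
(* [A m.+1] differs from [B m] by the Taylor remainder, which is controlled by [A m.+2]. *)
apply: (slice_L2_dom2 (q := fun p => (B m p ^+ 2)%:E) (q' := line_avg (fun q => (A m.+2 q ^+ 2)%:E) v w)) => //.
- exact: measurable_sq3.
- exact: measurable_line_avg.
- by move=> p; rewrite lee_fin sqr_ge0.
- by move=> p; exact: line_avg_ge0.
- move=> p; apply: (@le_trans _ _ (2%:E * (B m p ^+ 2)%:E + 2%:E * ((A m.+1 p - B m p) ^+ 2)%:E)%E).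
    by rewrite -!EFinM -EFinD lee_fin -[X in X ^+ 2](subrK (B m p)) addrC sqrD_le2.
  rewrite leeD2l//; apply: lee_wpmul2l => //.
  by apply: derivative_difference_avg.
Qed.

(** Descending induction from an order known to be bounded; each step uses only the order just
    reached and order zero. *)
Lemma slice_L2_down N (A : nat -> X3 -> R) : (forall k, continuous (A k)) ->
  (forall k, line_diff (A k) (A k.+1)) ->
  slice_L2 (A 0%N) -> slice_L2 (A N.+1) -> slice_L2 (A 1%N).
Proof.
move=> cA dA A0; elim: N => [h|N IH AN]; first exact: h.
apply: IH; exact: (slice_L2_interp cA dA A0 AN).
Qed.

End interpolation.

(** * Comparison of balls, Euclidean norms and the weight *)

Section decay.
Context {R : realType} (n : nat).
Notation V := 'rV[R]_n.
Notation mu := (@rv_measure R n).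

Lemma enorm_sqr (x : V) : enorm x ^+ 2 = \sum_(i < n) x 0 i ^+ 2.
Proof.
rewrite sqr_sqrtr; first by apply: eq_bigr => i _; rewrite expr2.
by apply: sumr_ge0 => i _; rewrite -expr2 sqr_ge0.
Qed.

Lemma coord_enorm (x : V) i : x 0 i ^+ 2 <= enorm x ^+ 2.
Proof.
by rewrite enorm_sqr (bigD1 i)//= lerDl sumr_ge0// => j _; rewrite sqr_ge0.
Qed.

Lemma ballI_le_wt (x0 x : V) : ballI x0 x <= 2 ^+ n * wt (x - x0).
Proof.
rewrite /ballI indicE; case: (boolP (_ \in _)) => [/set_mem /= h|_]; last first.
  by rewrite mulr_ge0 ?wt_ge0// exprn_ge0.
have -> : 2 ^+ n = \prod_(i < n) (2 : R) by rewrite prodr_const card_ord.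
rewrite /wt -big_split /=.
apply: (big_ind (fun z => 1 <= z)) => // [u v|i _]; first exact: mulr_ege1.
rewrite /wt1 ler_pdivlMr ?one_sqr_gt0// mul1r.
rewrite -[leRHS]/(1 + 1) lerD2l (le_trans (coord_enorm _ i))//.
by rewrite -[leRHS](expr1n _ 2) ler_sqr ?nnegrE// ?sqrtr_ge0// ltW.
Qed.

Lemma wt_ge_enorm (x : V) : ((1 + enorm x ^+ 2) ^+ n)^-1 <= wt x.
Proof.
rewrite -[X in _ <= X]invrK lef_pV2 ?posrE ?invr_gt0 ?wt_gt0// ?exprn_gt0 ?one_sqr_gt0//.
rewrite /wt -prodfV -[X in _ <= _ ^+ X](card_ord n) -prodr_const.
apply: ler_prod => i _; rewrite /wt1 invrK ltW ?one_sqr_gt0//= lerD2l.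
exact: coord_enorm.
Qed.

Lemma slice_bounded_wt (K : R) : 0 <= K ->
  slice_bounded (fun p : V * V * V => (K * wt p.2)%:E).
Proof.
move=> K0; have [mw w0 woo] := @gdom_wt R n.
pose I := (\int[mu]_x wt x)%R.
have EI : (\int[mu]_x (wt x)%:E = I%:E)%E.
  rewrite /I /Rintegral fineK// ge0_fin_numE//.
  by apply: integral_ge0 => x _; rewrite lee_fin.
have mwE : measurable_fun setT (EFin \o @wt R n) by apply/measurable_EFinP.
(* [K * I] comes from the integral in [eta], and [2 ^+ n * I] bounds the volume of the ball. *)
exists (2 ^+ n * I * (K * I)) => x0 zeta; rewrite /slice.
have EK : (\int[mu]_eta (K * wt eta)%:E = (K * I)%:E)%E.
  transitivity (K%:E * \int[mu]_eta (wt eta)%:E)%E; last by rewrite EI.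
  by rewrite -ge0_integralZl// => x _; rewrite lee_fin wt_ge0.
under eq_integral => x _ do rewrite EK.
have KI : 0 <= K * I.
  by rewrite mulr_ge0//; apply: Rintegral_ge0.
rewrite ge0_integralZr//; [|by apply/measurable_EFinP; exact: measurable_ballI|by move=> x _; rewrite lee_fin ballI_ge0].
rewrite [leRHS]EFinM; apply: lee_wpmul2r; first by rewrite lee_fin.
apply: (@le_trans _ _ (\int[mu]_x (2 ^+ n * wt (x - x0))%:E)%E).
  apply: ge0_le_integral => //.
  - by move=> x _; rewrite lee_fin ballI_ge0.
  - by apply/measurable_EFinP; exact: measurable_ballI.
  - apply/measurable_EFinP; apply: measurable_funM => //.
    exact: (measurableT_comp mw (measurable_rvD (- x0))).
  - by move=> x _; rewrite lee_fin ballI_le_wt.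
rewrite (ge0_integral_rvD (- x0) (f := fun x => (2 ^+ n * wt x)%:E)).
- rewrite EFinM -EI -ge0_integralZl//.
  by move=> x _; rewrite lee_fin wt_ge0.
- by apply/measurable_EFinP; exact: measurable_funM.
- by move=> x; rewrite lee_fin mulr_ge0// exprn_ge0.
Qed.

(** Undoes the square root in the hypothesis on [a]. An infinite [x] is excluded because its square
    root is infinite as well. *)
Lemma poweR_half_le (x : \bar R) (K : R) : (0 <= x)%E -> (x `^ 2^-1 <= K%:E)%E -> (x <= (K ^+ 2)%:E)%E.
Proof.
case: x => [r| |]//=.
- rewrite !lee_fin => r0; rewrite powR12_sqrt// => h.
  rewrite -(sqr_sqrtr r0) ler_sqr ?nnegrE ?sqrtr_ge0//.
  by rewrite (le_trans _ h)// sqrtr_ge0.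
- by rewrite invr_eq0 pnatr_eq0.
Qed.

End decay.

(** * Square integrability of all derivatives of the symbol on slices *)

Section symbol.
Context {R : realType} (n : nat).
Notation V := 'rV[R]_n.
Notation X3 := (V * V * V)%type.
Notation C := R[i].
Notation mu := (@rv_measure R n).
Variables (rho : R) (a : V -> V -> V -> C).
Hypothesis rho_gt0 : 0 < rho.
Hypothesis a_symbol : symbol_class 0 rho 0 a.
Hypothesis a_L2 : forall alpha : 'I_n -> nat, exists K : R, forall x0 zeta : V,
  (poweR
    (Nint (fun x : V =>
       (\1_[set y : V | (enorm (y - x0) < 1)%R] x)%:E *
       Nint (fun eta : V =>
         (cabs (Dmulti (@e_x R n) alpha (uncurry3 a) (x, (zeta - eta)%R, eta)) ^+ 2)%:E)))
    (2^-1) <= K%:E)%E.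

(** The blocks stand in the order of [symbol_class], first [xi], then [eta], then [x]. This is a
    normal form: a further derivative of any kind is moved into its block by commutation. *)
Definition da (sxi seta sx : seq 'I_n) : X3 -> C :=
  dword (map (@e_xi R n) sxi ++ map (@e_eta R n) seta ++ map (@e_x R n) sx) (uncurry3 a).

Lemma smoothC_a : smoothC (uncurry3 a). Proof. by case: a_symbol. Qed.

Lemma smoothC_da sxi seta sx : smoothC (da sxi seta sx).
Proof. exact: smoothC_dword smoothC_a. Qed.

Lemma cderive_xi sxi seta sx i : cderive (e_xi i) (da sxi seta sx) = da (i :: sxi) seta sx.
Proof. by []. Qed.

Lemma cderive_eta sxi seta sx i : cderive (e_eta i) (da sxi seta sx) = da sxi (i :: seta) sx.
Proof. by rewrite /da /= dword_move//; exact: smoothC_a. Qed.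

Lemma cderive_x sxi seta sx i : cderive (e_x i) (da sxi seta sx) = da sxi seta (i :: sx).
Proof. by rewrite /da /= !catA dword_move//; exact: smoothC_a. Qed.

Let line_xi i (x xi eta : V) (F : X3 -> C) :
  (fun s : R => F ((x, xi, eta) + s *: e_xi i)) = (fun s => F (x, xi + s *: coordv i, eta)).
Proof. by apply/funext => s; congr (F (_, _, _)); rewrite /= scaler0 addr0. Qed.

Let line_eta i (x xi eta : V) (F : X3 -> C) :
  (fun s : R => F ((x, xi, eta) + s *: e_eta i)) = (fun s => F (x, xi, eta + s *: coordv i)).
Proof. by apply/funext => s; congr (F (_, _, _)); rewrite /= scaler0 addr0. Qed.

Let line_x i (x xi eta : V) (F : X3 -> C) :
  (fun s : R => F ((x, xi, eta) + s *: e_x i)) = (fun s => F (x + s *: coordv i, xi, eta)).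
Proof. by apply/funext => s; congr (F (_, _, _)); rewrite /= scaler0 addr0. Qed.

Lemma cder1_xi sxi seta sx i x xi eta :
  cder1 (fun s => da sxi seta sx (x, xi + s *: coordv i, eta))
        (fun s => da (i :: sxi) seta sx (x, xi + s *: coordv i, eta)).
Proof.
have := smoothC_cder (e_xi i) (x, xi, eta) (smoothC_da sxi seta sx).
by rewrite cderive_xi !line_xi.
Qed.

Lemma cder1_eta sxi seta sx i x xi eta :
  cder1 (fun s => da sxi seta sx (x, xi, eta + s *: coordv i))
        (fun s => da sxi (i :: seta) sx (x, xi, eta + s *: coordv i)).
Proof.
have := smoothC_cder (e_eta i) (x, xi, eta) (smoothC_da sxi seta sx).
by rewrite cderive_eta !line_eta.
Qed.

Lemma cder1_x sxi seta sx i x xi eta :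
  cder1 (fun s => da sxi seta sx (x + s *: coordv i, xi, eta))
        (fun s => da sxi seta (i :: sx) (x + s *: coordv i, xi, eta)).
Proof.
have := smoothC_cder (e_x i) (x, xi, eta) (smoothC_da sxi seta sx).
by rewrite cderive_x !line_x.
Qed.

Lemma da_cont sxi seta sx : continuous (fun p => cRe (da sxi seta sx p)) /\
  continuous (fun p => cIm (da sxi seta sx p)).
Proof. exact: smoothC_cont (smoothC_da sxi seta sx). Qed.

Lemma cmeas_da sxi seta sx : cmeas (da sxi seta sx).
Proof. by have [cr ci] := da_cont sxi seta sx; split; exact: continuous_measurable3. Qed.

Lemma da_Dmulti sxi seta sx : da sxi seta sx =
  Dmulti (@e_xi R n) (fun i => count_mem i sxi) (Dmulti (@e_eta R n) (fun i => count_mem i seta)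
    (Dmulti (@e_x R n) (fun i => count_mem i sx) (uncurry3 a))).
Proof.
have E1 := dword_Dmulti (@e_x R n) sx smoothC_a.
have s1 := smoothC_dword (map (@e_x R n) sx) smoothC_a.
have E2 := dword_Dmulti (@e_eta R n) seta s1.
have s2 := smoothC_dword (map (@e_eta R n) seta) s1.
have E3 := dword_Dmulti (@e_xi R n) sxi s2.
rewrite -E1 -E2 -E3 /da.
rewrite (dword_cat (map (@e_xi R n) sxi)).
by rewrite (dword_cat (map (@e_eta R n) seta)).
Qed.

Lemma da_bound sxi seta sx : exists K : R, forall x xi eta,
  cabs (da sxi seta sx (x, xi, eta)) <=
    K * powR (1 + enorm xi ^+ 2 + enorm eta ^+ 2) (- (rho * (size sxi + size seta)%:R) / 2).
Proof.
have [_ /(_ (fun i => count_mem i sxi) (fun i => count_mem i seta) (fun i => count_mem i sx))] := a_symbol.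
move=> [K HK]; exists K => x xi eta; rewrite da_Dmulti.
by have := HK x xi eta; rewrite !mabs_count mul0r addr0 sub0r.
Qed.

Lemma bracket_ge1 (xi eta : V) : 1 <= 1 + enorm xi ^+ 2 + enorm eta ^+ 2.
Proof. by rewrite -addrA lerDl addr_ge0// sqr_ge0. Qed.

Lemma da_bounded sxi seta sx : exists2 K : R, 0 <= K & forall p, cabs (da sxi seta sx p) <= K.
Proof.
have [K HK] := da_bound sxi seta sx; exists `|K| => // -[[x xi] eta].
apply: le_trans (HK x xi eta) _.
apply: (@le_trans _ _ (`|K| * powR (1 + enorm xi ^+ 2 + enorm eta ^+ 2) (- (rho * (size sxi + size seta)%:R) / 2))).
  by rewrite ler_wpM2r ?powR_ge0// ler_norm.
rewrite ler_piMr// mulNr powRN invf_le1; last first.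
  by rewrite powR_gt0// (lt_le_trans _ (bracket_ge1 _ _)).
have e1 : powR (1:R) (rho * (size sxi + size seta)%:R / 2) = 1 by rewrite powR1.
rewrite -[leLHS]e1 ge0_ler_powR ?nnegrE//.
- by rewrite divr_ge0// mulr_ge0// ltW.
- by rewrite (le_trans _ (bracket_ge1 _ _)).
- exact: bracket_ge1.
Qed.

Definition slice_L2C (F : X3 -> C) := slice_L2 (fun p => cRe (F p)) /\ slice_L2 (fun p => cIm (F p)).

Lemma slice_L2C_dom sxi seta sx (q : X3 -> \bar R) : measurable_fun setT q -> slice_bounded q ->
  (forall p, ((cabs (da sxi seta sx p) ^+ 2)%:E <= q p)%E) -> slice_L2C (da sxi seta sx).
Proof.
move=> mq bq hq; have [cr ci] := da_cont sxi seta sx.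
split; apply: slice_bounded_le bq => //.
- exact: measurable_sq3.
- by move=> p; rewrite lee_fin sqr_ge0.
- by move=> p; apply: le_trans (hq p); rewrite lee_fin cabs_sqr lerDl sqr_ge0.
- exact: measurable_sq3.
- by move=> p; rewrite lee_fin sqr_ge0.
- by move=> p; apply: le_trans (hq p); rewrite lee_fin cabs_sqr lerDr sqr_ge0.
Qed.

Lemma measurable_cabs_da sxi seta sx : measurable_fun setT (fun p => (cabs (da sxi seta sx p) ^+ 2)%:E).
Proof.
by apply/measurable_EFinP; apply: measurable_funX; exact: cmeas_cabs (cmeas_da sxi seta sx).
Qed.

Lemma slice_L2C_x sx : slice_L2C (da [::] [::] sx).
Proof.
apply: (@slice_L2C_dom _ _ _ (fun p => (cabs (da [::] [::] sx p) ^+ 2)%:E)) => //.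
  exact: measurable_cabs_da.
have [K HK] := a_L2 (fun i => count_mem i sx).
have E : Dmulti (@e_x R n) (fun i => count_mem i sx) (uncurry3 a) = da [::] [::] sx.
  exact: (esym (dword_Dmulti (@e_x R n) sx smoothC_a)).
rewrite E in HK.
exists (K ^+ 2) => x0 zeta.
have mq := measurable_cabs_da [::] [::] sx.
have q0 p : (0 <= (cabs (da [::] [::] sx p) ^+ 2)%:E)%E by rewrite lee_fin sqr_ge0.
have := HK x0 zeta.
rewrite (_ : Nint _ = slice (fun p => (cabs (da [::] [::] sx p) ^+ 2)%:E) x0 zeta).
  apply: poweR_half_le; apply: integral_ge0 => x _.
  exact: (slice_integrand_ge0 x0 zeta x q0).
rewrite /slice -NintE; last 2 first.
- exact: (measurable_slice_integrand x0 zeta mq q0).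
- by move=> x; exact: (slice_integrand_ge0 x0 zeta x q0).
congr Nint; apply/funext => x; congr (_ * _)%E.
by rewrite -NintE//; exact: (measurable_slice_eta x zeta mq).
Qed.

Lemma exists_decay_order : exists N : nat, n%:R <= rho * N%:R.
Proof.
have h0 : 0 <= n%:R / rho by rewrite divr_ge0// ltW.
exists (Num.bound (n%:R / rho)).
by rewrite mulrC -ler_pdivrMr// ltW// archi_boundP.
Qed.

(** Squaring the symbol estimate gives the bracket to the power [-rho] times the number of frequency
    derivatives. This is at most [(1 + |eta|^2)^(-n)], hence at most [wt eta], whose slices are
    bounded. Derivatives in [x] leave the exponent unchanged. *)
Lemma slice_L2C_decay sxi seta sx : n%:R <= rho * (size sxi + size seta)%:R ->
  slice_L2C (da sxi seta sx).
Proof.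
move=> hN; have [K HK] := da_bound sxi seta sx.
have [mw w0 woo] := @gdom_wt R n.
apply: (@slice_L2C_dom _ _ _ (fun p => (K ^+ 2 * wt p.2)%:E)).
- by apply/measurable_EFinP; apply: measurable_funM => //; exact: (measurableT_comp mw measurable_snd).
- by apply: slice_bounded_wt; exact: sqr_ge0.
move=> [[x xi] eta] /=; rewrite lee_fin.
set b := 1 + enorm xi ^+ 2 + enorm eta ^+ 2.
have b1 : 1 <= b by exact: bracket_ge1.
have b0 : 0 < b by exact: lt_le_trans b1.
have h := HK x xi eta; rewrite -/b in h.
apply: (@le_trans _ _ ((K * powR b (- (rho * (size sxi + size seta)%:R) / 2)) ^+ 2)).
  by rewrite ler_sqr ?nnegrE ?cabs_ge0// (le_trans _ h)// cabs_ge0.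
rewrite exprMn ler_wpM2l ?sqr_ge0// -powR_mulrn ?powR_ge0// -powRrM divfK//.
rewrite powRN; apply: le_trans (wt_ge_enorm eta).
rewrite lef_pV2 ?posrE ?powR_gt0// ?exprn_gt0 ?one_sqr_gt0//.
apply: (@le_trans _ _ (b ^+ n)).
  by rewrite lerXn2r ?nnegrE ?(ltW b0)// ?(ltW (one_sqr_gt0 _))// lerD2r lerDl sqr_ge0.
by rewrite -powR_mulrn ?(ltW b0)// ler_powR.
Qed.

Lemma line_diff_da_xi i sxi seta sx (f : C -> R) : (f = cRe \/ f = cIm) ->
  line_diff (coordv i) 0 (fun p => f (da sxi seta sx p)) (fun p => f (da (i :: sxi) seta sx p)).
Proof.
move=> hf [[x xi] eta] t; rewrite /sh3 /=.
under [X in is_derive _ _ X]eq_fun do rewrite scaler0 addr0.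
rewrite scaler0 addr0.
by have [h1 h2] := cder1_xi sxi seta sx i x xi eta t; case: hf => ->.
Qed.

Lemma line_diff_da_eta i sxi seta sx (f : C -> R) : (f = cRe \/ f = cIm) ->
  line_diff 0 (coordv i) (fun p => f (da sxi seta sx p)) (fun p => f (da sxi (i :: seta) sx p)).
Proof.
move=> hf [[x xi] eta] t; rewrite /sh3 /=.
under [X in is_derive _ _ X]eq_fun do rewrite scaler0 addr0.
rewrite scaler0 addr0.
by have [h1 h2] := cder1_eta sxi seta sx i x xi eta t; case: hf => ->.
Qed.

(** Letters are added one at a time, those of [eta] before those of [xi]. The functions with [k]
    copies of the new letter [i] in front are successive derivatives along a line: member [0] is
    known by induction, member [N.+1] decays, and [slice_L2_down] yields member [1]. The base case
    is the hypothesis on [a]. *)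
Lemma slice_L2C_all sxi seta sx : slice_L2C (da sxi seta sx).
Proof.
have [N HN] := exists_decay_order.
(* The [m] frequency letters already present only improve the decay. *)
have HN1 (m : nat) : n%:R <= rho * (N.+1 + m)%:R.
  by rewrite (le_trans HN)// ler_wpM2l ?(ltW rho_gt0)// ler_nat addSn leqW// leq_addr.
have Heta t u : slice_L2C (da [::] t u).
  elim: t => [|i t IH]; first exact: slice_L2C_x.
  have dec : slice_L2C (da [::] (nseq N.+1 i ++ t) u).
    by apply: slice_L2C_decay; rewrite size_cat size_nseq add0n.
  split.
    have c k := (da_cont [::] (nseq k i ++ t) u).1.
    have d k := line_diff_da_eta i [::] (nseq k i ++ t) u (or_introl (erefl (@cRe R))).
    exact: (slice_L2_down (A := fun k p => cRe (da [::] (nseq k i ++ t) u p)) (N := N) c d (proj1 IH) (proj1 dec)).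
  have c k := (da_cont [::] (nseq k i ++ t) u).2.
  have d k := line_diff_da_eta i [::] (nseq k i ++ t) u (or_intror (erefl (@cIm R))).
  exact: (slice_L2_down (A := fun k p => cIm (da [::] (nseq k i ++ t) u p)) (N := N) c d (proj2 IH) (proj2 dec)).
elim: sxi => [|i t IH]; first exact: Heta.
have dec : slice_L2C (da (nseq N.+1 i ++ t) seta sx).
  by apply: slice_L2C_decay; rewrite size_cat size_nseq -addnA.
split.
  have c k := (da_cont (nseq k i ++ t) seta sx).1.
  have d k := line_diff_da_xi i (nseq k i ++ t) seta sx (or_introl (erefl (@cRe R))).
  exact: (slice_L2_down (A := fun k p => cRe (da (nseq k i ++ t) seta sx p)) (N := N) c d (proj1 IH) (proj1 dec)).
have c k := (da_cont (nseq k i ++ t) seta sx).2.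
have d k := line_diff_da_xi i (nseq k i ++ t) seta sx (or_intror (erefl (@cIm R))).
exact: (slice_L2_down (A := fun k p => cIm (da (nseq k i ++ t) seta sx p)) (N := N) c d (proj2 IH) (proj2 dec)).
Qed.

Lemma slice_bounded_da sxi seta sx : slice_bounded (fun p => (cabs (da sxi seta sx p) ^+ 2)%:E).
Proof.
have [hr hi] := slice_L2C_all sxi seta sx; have [cr ci] := da_cont sxi seta sx.
have := slice_boundedD (measurable_sq3 cr) (measurable_sq3 ci) _ _ hr hi.
move=> /(_ _ _)/wrap[|p|]; [by move=> p; rewrite lee_fin sqr_ge0|by rewrite lee_fin sqr_ge0|].
by congr slice_bounded; apply/funext => p; rewrite cabs_sqr EFinD.
Qed.

End symbol.

(** * Weights and localised amplitudes *)

Section algebra.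
Context {R : realType} (n : nat).
Notation V := 'rV[R]_n.
Notation mu := (@rv_measure R n).
Notation leb := (@lebesgue_measure R).
Implicit Types (q c : V -> R) (x : V) (i j : 'I_n).

Lemma is_derive1_ext2 (f g : R -> R) t a b : f =1 g -> a = b ->
  is_derive t (1:R) f a -> is_derive t (1:R) g b.
Proof. by move=> /funext -> ->. Qed.

Definition rder i q q' := forall x t,
  is_derive t (1:R) (fun s => q (x + s *: coordv i)) (q' (x + t *: coordv i)).

Lemma rderD i q q' p p' : rder i q q' -> rder i p p' ->
  rder i (fun x => q x + p x) (fun x => q' x + p' x).
Proof. by move=> h k x t; exact: is_derive1D. Qed.

Lemma rderM i q q' p p' : rder i q q' -> rder i p p' ->
  rder i (fun x => q x * p x) (fun x => q' x * p x + q x * p' x).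
Proof. by move=> h k x t; exact: is_derive1M. Qed.

Lemma rder_cst i (c : R) : rder i (fun=> c) (fun=> 0).
Proof. by move=> x t; exact: is_derive1_cst. Qed.

Lemma coord_line x i j (s : R) : (x + s *: coordv i) 0 j = x 0 j + s * (i == j)%:R.
Proof. by rewrite !mxE eqxx /= eq_sym. Qed.

Lemma rder_coord i j : rder i (fun x => x 0 j) (fun=> (i == j)%:R).
Proof.
move=> x t; have := is_derive1_affine (x 0 j) (i == j)%:R t.
by apply: is_derive1_ext => s; rewrite coord_line.
Qed.

Lemma is_derive1V (f : R -> R) t a : f t != 0 -> is_derive t (1:R) f a ->
  is_derive t (1:R) (fun s => (f s)^-1) (- a * (f t)^-1 ^+ 2).
Proof.
move=> ft df; have h := is_deriveV ft df.
apply: is_derive_eq h _; by rewrite /GRing.scale /= exprVn mulrC mulrN mulNr.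
Qed.

(** Together with [wt1] it is closed under differentiation: [wt1' = -2 r1 wt1] and
    [r1' = wt1 - 2 r1^2]. *)
Definition r1 (t : R) : R := t * wt1 t.

Lemma rder_wt1 i j : rder i (fun x => wt1 (x 0 j)) (fun x => (-2 * (i == j)%:R) * (r1 (x 0 j) * wt1 (x 0 j))).
Proof.
move=> x t.
have h := rderD (rder_cst i 1) (rderM (rder_coord i j) (rder_coord i j)) x t.
have nz : 1 + (x + t *: coordv i) 0 j * (x + t *: coordv i) 0 j != 0.
  by rewrite -expr2 gt_eqF ?one_sqr_gt0.
have h2 := is_derive1V (f := fun s : R => 1 + (x + s *: coordv i) 0 j * (x + s *: coordv i) 0 j) nz h.
have E : (fun s : R => wt1 ((x + s *: coordv i) 0 j)) =
    (fun s : R => (1 + (x + s *: coordv i) 0 j * (x + s *: coordv i) 0 j)^-1).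
  by apply/funext => s; rewrite /wt1 expr2.
rewrite E; apply: is_derive_eq h2 _.
by rewrite /r1 /wt1 -expr2; ring.
Qed.

Inductive alg (b : bool) : (V -> R) -> Prop :=
| alg_cst k : alg b (fun=> k)
| alg_w i : alg b (fun x => wt1 (x 0 i))
| alg_r i : alg b (fun x => r1 (x 0 i))
| alg_x i : b -> alg b (fun x => x 0 i)
| alg_add q p : alg b q -> alg b p -> alg b (fun x => q x + p x)
| alg_mul q p : alg b q -> alg b p -> alg b (fun x => q x * p x).

Lemma alg_der b q i : alg b q -> exists2 q', alg b q' & rder i q q'.
Proof.
elim => {q} [k|j|j|j bT|q p _ [q' aq' dq] _ [p' ap' dp]|q p aq [q' aq' dq] ap [p' ap' dp]].
- by exists (fun=> 0); [exact: alg_cst|exact: rder_cst].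
- exists (fun x => (-2 * (i == j)%:R) * (r1 (x 0 j) * wt1 (x 0 j))); last exact: rder_wt1.
  by apply: alg_mul; [exact: alg_cst|apply: alg_mul; [exact: alg_r|exact: alg_w]].
- exists (fun x => (i == j)%:R * wt1 (x 0 j) + (-2 * (i == j)%:R) * (r1 (x 0 j) * r1 (x 0 j))).
    apply: alg_add; first by apply: alg_mul; [exact: alg_cst|exact: alg_w].
    by apply: alg_mul; [exact: alg_cst|apply: alg_mul; exact: alg_r].
  move=> x t; apply: is_derive1_ext2 (rderM (rder_coord i j) (rder_wt1 i j) x t) => //.
  by rewrite /r1; ring.
- by exists (fun=> (i == j)%:R); [exact: alg_cst|exact: rder_coord].
- by exists (fun x => q' x + p' x); [exact: alg_add|exact: rderD].
- by exists (fun x => q' x * p x + q x * p' x); [apply: alg_add; exact: alg_mul|exact: rderM].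
Qed.

Lemma measurable_alg b q : alg b q -> measurable_fun setT q.
Proof.
have mw : measurable_fun setT (@wt1 R) := @measurable_wt1 R.
elim => {q} [k|j|j|j bT|q p _ mq _ mp|q p _ mq _ mp].
- exact: measurable_cst.
- exact: (measurableT_comp mw (measurable_coord j)).
- by apply: measurable_funM; [exact: measurable_coord|exact: (measurableT_comp mw (measurable_coord j))].
- exact: measurable_coord.
- exact: measurable_funD.
- exact: measurable_funM.
Qed.

Lemma norm_r1 (t : R) : `|r1 t| <= 1.
Proof.
rewrite /r1 normrM (ger0_norm (ltW (wt1_gt0 _))) ler_pdivrMr ?one_sqr_gt0// mul1r.
rewrite -[X in _ <= _ + X]real_normK ?num_real//; set u := `|t|.
have := sqr_ge0 (u - 2^-1); rewrite sqrrB => h.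
have -> : 1 + u ^+ 2 = u + (u ^+ 2 - u * 2^-1 *+ 2 + 2^-1 ^+ 2) + 3/4 by field.
by rewrite -addrA lerDl addr_ge0.
Qed.

Lemma alg_bounded q : alg false q -> exists2 K : R, 0 <= K & forall x, `|q x| <= K.
Proof.
elim => {q} [k|j|j|j //|q p _ [K K0 HK] _ [L L0 HL]|q p _ [K K0 HK] _ [L L0 HL]].
- by exists `|k|.
- by exists 1 => // x; rewrite ger0_norm ?wt1_le1// ltW// wt1_gt0.
- by exists 1 => // x; exact: norm_r1.
- by exists (K + L); [exact: addr_ge0|move=> x; rewrite (le_trans (ler_normD _ _))// lerD].
- by exists (K * L); [exact: mulr_ge0|move=> x; rewrite normrM ler_pM].
Qed.

Lemma wtV_ge1 x : 1 <= (wt x)^-1.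
Proof. by rewrite invf_ge1 ?wt_gt0// wt_le1. Qed.

Lemma alg_growth q : alg true q -> exists2 K : R, 0 <= K &
  exists m, forall x, `|q x| <= K * (wt x)^-1 ^+ m.
Proof.
have pw x m : 1 <= (wt x)^-1 ^+ m by rewrite exprn_ege1// wtV_ge1.
elim => {q} [k|j|j|j _|q p _ [K K0 [m HK]] _ [L L0 [l HL]]|q p _ [K K0 [m HK]] _ [L L0 [l HL]]].
- by exists `|k| => //; exists 0%N => x; rewrite mulr1.
- by exists 1 => //; exists 0%N => x; rewrite mulr1 ger0_norm ?wt1_le1// ltW// wt1_gt0.
- by exists 1 => //; exists 0%N => x; rewrite mulr1; exact: norm_r1.
(* [|x_j| <= (wt1 x_j)^-1 <= (wt x)^-1], because the other factors of [wt x] are at most one. *)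
- exists 1 => //; exists 1%N => x; rewrite mul1r expr1.
  have w1 := wt1_gt0 (x 0 j).
  have : `|x 0 j| * wt1 (x 0 j) <= 1 by have := norm_r1 (x 0 j); rewrite /r1 normrM (ger0_norm (ltW w1)).
  rewrite -ler_pdivlMr// mul1r => /le_trans; apply.
  rewrite lef_pV2 ?posrE ?wt_gt0// /wt (bigD1 j)//= ler_piMr// ?(ltW w1)//.
  by apply: prodr_ile1 => i; rewrite wt1_le1 ltW// wt1_gt0.
- exists (K + L); [exact: addr_ge0|exists (m + l)%N => x].
  rewrite (le_trans (ler_normD _ _))// mulrDl lerD//.
    by rewrite (le_trans (HK x))// ler_wpM2l// exprD ler_peMr// ltW// exprn_gt0// invr_gt0 wt_gt0.
  by rewrite (le_trans (HL x))// ler_wpM2l// exprD ler_peMl// ltW// exprn_gt0// invr_gt0 wt_gt0.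
- exists (K * L); [exact: mulr_ge0|exists (m + l)%N => x].
  by rewrite normrM exprD mulrACA ler_pM.
Qed.

Lemma alg_wt b : alg b (@wt R n).
Proof.
rewrite (_ : @wt R n = fun x => \prod_(i <- index_enum 'I_n) wt1 (x 0 i))//.
elim: (index_enum _) => [|i s IH].
  by rewrite (_ : (fun _ => _) = fun=> 1); [exact: alg_cst|apply/funext => x; rewrite big_nil].
rewrite (_ : (fun _ => _) = fun x => wt1 (x 0 i) * \prod_(i <- s) wt1 (x 0 i)).
  by apply: alg_mul => //; exact: alg_w.
by apply/funext => x; rewrite big_cons.
Qed.

(** One factor of the weight absorbs one coordinate: [x_i * wt1 x_i] is [r1 x_i], and the remaining
    factors of [wt] are untouched. *)
Lemma alg_coord_wt b i : alg b (fun x => x 0 i * wt x).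
Proof.
rewrite (_ : (fun _ => _) = fun x => r1 (x 0 i) * \prod_(j <- [seq j <- index_enum 'I_n | j != i]) wt1 (x 0 j)).
  apply: alg_mul; first exact: alg_r.
  elim: [seq _ <- _ | _] => [|j s IH].
    by rewrite (_ : (fun _ => _) = fun=> 1); [exact: alg_cst|apply/funext => x; rewrite big_nil].
  rewrite (_ : (fun _ => _) = fun x => wt1 (x 0 j) * \prod_(i <- s) wt1 (x 0 i)).
    by apply: alg_mul => //; exact: alg_w.
  by apply/funext => x; rewrite big_cons.
by apply/funext => x; rewrite /r1 /wt big_filter (bigD1 i)//= mulrA.
Qed.

Lemma rder_wt i : rder i (@wt R n) (fun x => -2 * r1 (x 0 i) * wt x).
Proof.
move=> x t.
pose P := \prod_(j < n | j != i) wt1 (x 0 j).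
have E s : wt (x + s *: coordv i) = wt1 ((x + s *: coordv i) 0 i) * P.
  rewrite /wt (bigD1 i)//=; congr (_ * _); apply: eq_bigr => j ji.
  by rewrite coord_line eq_sym (negbTE ji) mulr0 addr0.
apply: is_derive1_ext2 (is_derive1M (rder_wt1 i i x t) (is_derive1_cst P t)).
  by move=> s; rewrite E.
by rewrite E eqxx mulr1 mulr0 addr0 mulrA !mulrA.
Qed.

Lemma rder_wtX i N : rder i (fun x => wt x ^+ N) (fun x => (-2 * N%:R) * (r1 (x 0 i) * wt x ^+ N)).
Proof.
elim: N => [|N IH].
  have h := rder_cst i 1; move=> x t; apply: is_derive1_ext2 (h x t).
    by move=> s; rewrite expr0.
  by rewrite mulr0 mul0r.
move=> x t; apply: is_derive1_ext2 (rderM (rder_wt i) IH x t).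
  by move=> s; rewrite exprS.
by rewrite exprS -natr1; ring.
Qed.

(** Cut-offs that carry [N] factors of the weight. A derivative loses none of them, since the
    logarithmic derivative of [wt] is a bounded element of the algebra; multiplication by a
    coordinate loses one. *)
Definition Wc N c := exists2 q, alg false q & c = (fun x => wt x ^+ N * q x).

Lemma Wc_der N c i : Wc N c -> exists2 c', Wc N c' & rder i c c'.
Proof.
move=> [q aq ->]; have [q' aq' dq] := alg_der i aq.
exists (fun x => wt x ^+ N * ((-2 * N%:R) * r1 (x 0 i) * q x + q' x)).
  exists (fun x => (-2 * N%:R) * r1 (x 0 i) * q x + q' x) => //.
  apply: alg_add => //; apply: alg_mul => //; apply: alg_mul; [exact: alg_cst|exact: alg_r].
move=> x t; apply: is_derive1_ext2 (rderM (rder_wtX i N) dq x t) => //.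
by ring.
Qed.

Lemma Wc_coord N c i : Wc N.+1 c -> Wc N (fun x => x 0 i * c x).
Proof.
move=> [q aq ->]; exists (fun x => (x 0 i * wt x) * q x).
  by apply: alg_mul => //; exact: alg_coord_wt.
by apply/funext => x; rewrite exprSr; ring.
Qed.

Lemma Wc_weak N c : Wc N.+1 c -> Wc N c.
Proof.
move=> [q aq ->]; exists (fun x => wt x * q x); first by apply: alg_mul => //; exact: alg_wt.
by apply/funext => x; rewrite exprSr mulrA.
Qed.

Lemma Wc_wtX N : Wc N (fun x => wt x ^+ N).
Proof. by exists (fun=> 1); [exact: alg_cst|apply/funext => x; rewrite mulr1]. Qed.

Lemma Wc_bounded N c : Wc N c -> exists2 K : R, 0 <= K & forall x, `|c x| <= K * wt x ^+ N.
Proof.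
move=> [q aq ->]; have [K K0 HK] := alg_bounded aq; exists K => // x.
by rewrite normrM ger0_norm ?exprn_ge0 ?wt_ge0// mulrC ler_wpM2r ?exprn_ge0 ?wt_ge0.
Qed.

Lemma measurable_Wc N c : Wc N c -> measurable_fun setT c.
Proof.
move=> [q aq ->]; apply: measurable_funM; last exact: measurable_alg aq.
by apply: measurable_funX; exact: measurable_wt.
Qed.

Lemma ballIE x0 x : ballI x0 x = (enorm (x - x0) < 1)%R%:R.
Proof. by rewrite /ballI indicE; congr (nat_of_bool _)%:R; exact: asboolb. Qed.

Lemma ballI_sym x0 x : ballI x0 x = ballI 0 (x - x0).
Proof. by rewrite !ballIE subr0. Qed.

Lemma wt_ballI x0 x : wt x * ballI x0 x <= 3 ^+ n * (wt x0 * ballI x0 x).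
Proof.
rewrite !ballIE; case: ltP => [h|_]; last by rewrite !mulr0.
rewrite !mulr1.
have -> : 3 ^+ n = \prod_(i < n) (3 : R) by rewrite prodr_const card_ord.
rewrite /wt -big_split /=; apply: ler_prod => i _.
rewrite (ltW (wt1_gt0 _)) /= /wt1 ler_pdivlMr ?one_sqr_gt0// mulrC ler_pdivrMr ?one_sqr_gt0//.
have h1 : (x 0 i - x0 0 i) ^+ 2 <= 1.
  have := coord_enorm (x - x0) i; rewrite !mxE => /le_trans; apply.
  by rewrite -[leRHS](expr1n _ 2) ler_sqr ?nnegrE// ?sqrtr_ge0// ltW.
(* The claim [1 + b^2 <= 3 (1 + a^2)] holds because the difference of its sides is
   [2 (1 - (a - b)^2) + (2 a - b)^2 + a^2]. *)
have := sqr_ge0 (2 * x 0 i - x0 0 i); move: h1; set a := x 0 i; set b := x0 0 i => h1 h2.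
nra.
Qed.

Definition ball_vol : \bar R := (\int[mu]_x (ballI 0 x)%:E)%E.

Lemma ball_vol_gt0 : (0 < ball_vol)%E.
Proof.
(* The cube of side [1 / n.+1] at the origin lies in the open unit ball: its points have squared
   norm at most [n * dlt < 1], also when [n = 0]. *)
pose dlt : R := n.+1%:R^-1.
pose g (t : R) : R := \1_(`[0%R, dlt]%classic) t.
have d0 : 0 < dlt by rewrite invr_gt0.
have mg : measurable_fun setT g by exact: measurable_indic.
have Ig : (\int[leb]_t (g t)%:E = dlt%:E)%E.
  rewrite integral_indic// setIT [LHS]lebesgue_measure_itv/= lte_fin d0.
  by rewrite oppr0 adde0.
have g0 t : 0 <= g t by rewrite /g indicE.
have := integral_prod_coord n mg g0; rewrite Ig => E.
apply: (@lt_le_trans _ _ (dlt%:E ^+ n)%E).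
  by rewrite -EFin_expe lte_fin exprn_gt0.
rewrite -E; apply: ge0_le_integral => //.
- by move=> x _; rewrite lee_fin prodr_ge0.
- by apply/measurable_EFinP; exact: measurable_prod_coord.
- by apply/measurable_EFinP; exact: measurable_ballI.
move=> x _; rewrite lee_fin ballIE subr0.
case: ltP => [_|nx].
  by apply: prodr_ile1 => i; rewrite g0 /= /g indicE; case: (_ \in _).
case: (boolP [forall i, x 0 i \in `[0, dlt]]) => [/forallP h|/forallPn[i hi]]; last first.
  rewrite (bigD1 i)//= /g indicE (_ : (_ \in _) = false) ?mul0r//.
  by apply/negbTE; apply: contra hi => /set_mem.
exfalso; move: nx; apply/negP; rewrite -ltNge.
suff : enorm x ^+ 2 < 1 ^+ 2 by rewrite ltr_sqr ?nnegrE ?sqrtr_ge0.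
rewrite expr1n enorm_sqr.
apply: (@le_lt_trans _ _ (\sum_(i < n) dlt)).
  apply: ler_sum => i _; have := h i; rewrite in_itv/= => /andP[x0 xd].
  rewrite expr2 (le_trans (ler_wpM2l x0 xd))// ler_piMl ?(ltW d0)//.
  by rewrite (le_trans xd)// /dlt invf_le1// ler1n.
rewrite sumr_const card_ord -[X in X < _]mulr_natl /dlt ltr_pdivrMr// mul1r.
by rewrite ltr_nat.
Qed.

Lemma ball_vol_fin : ball_vol \is a fin_num.
Proof.
have [mw w0 woo] := @gdom_wt R n.
rewrite ge0_fin_numE; last by apply: integral_ge0 => x _; rewrite lee_fin ballI_ge0.
apply: (@le_lt_trans _ _ (\int[mu]_x ((2 ^+ n)%:E * (wt x)%:E))%E).
  apply: ge0_le_integral => //.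
  - by move=> x _; rewrite lee_fin ballI_ge0.
  - by apply/measurable_EFinP; exact: measurable_ballI.
  - by apply: emeasurable_funM => //; apply/measurable_EFinP.
  - by move=> x _; rewrite -EFinM lee_fin (le_trans (ballI_le_wt _ _))// subr0.
rewrite ge0_integralZl//; first by rewrite lte_mul_pinfty// lee_fin exprn_ge0.
  exact/measurable_EFinP.
by move=> x _; rewrite lee_fin.
Qed.

Lemma integral_ballI_center x : (\int[mu]_m (ballI m x)%:E = ball_vol)%E.
Proof.
under eq_integral do rewrite ballI_sym.
have mb : measurable_fun setT (fun x : V => (ballI 0 x)%:E).
  by apply/measurable_EFinP; exact: measurable_ballI.
have b0 (y : V) : (0 <= (ballI 0 y)%:E)%E by rewrite lee_fin ballI_ge0.
transitivity (\int[mu]_m (ballI 0 (m + x))%:E)%E; last exact: (ge0_integral_rvD x mb b0).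
rewrite -(ge0_integral_rvN (f := fun m : V => (ballI 0 (m + x))%:E)) => [|//|m]; last exact: b0.
  by apply: eq_integral => m _; rewrite addrC.
exact: (measurableT_comp mb (measurable_rvD x)).
Qed.

End algebra.

(** * Amplitudes and their norms on slices *)

Section amplitudes.
Context {R : realType} (n : nat).
Notation V := 'rV[R]_n.
Notation C := R[i].
Notation mu := (@rv_measure R n).
Variables (rho : R) (a : V -> V -> V -> C).
Hypothesis rho_gt0 : 0 < rho.
Hypothesis a_symbol : symbol_class 0 rho 0 a.
Hypothesis a_L2 : forall alpha : 'I_n -> nat, exists K : R, forall x0 zeta : V,
  (poweR
    (Nint (fun x : V =>
       (\1_[set y : V | (enorm (y - x0) < 1)%R] x)%:E *
       Nint (fun eta : V =>
         (cabs (Dmulti (@e_x R n) alpha (uncurry3 a) (x, (zeta - eta)%R, eta)) ^+ 2)%:E)))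
    (2^-1) <= K%:E)%E.
Notation D := (da a).

(* [P k x (xi, eta)] is the symbol seen from the window centred at [k], so [a] is evaluated at
   [x + k]; [N] counts the coordinate factors [x_i] that the cut-off [c] can still absorb. *)
Inductive amp (N : nat) : (V -> V -> V * V -> C) -> Prop :=
| amp_base z0 c sxi seta sx : Wc N c ->
    amp N (fun (k x : V) (z : V * V) => z0 * cofR (c x) * D sxi seta sx (x + k, z.1, z.2))
| amp_add P Q : amp N P -> amp N Q -> amp N (fun (k x : V) (z : V * V) => P k x z + Q k x z).

Lemma amp_scale N P (y : C) : amp N P -> amp N (fun (k x : V) (z : V * V) => y * P k x z).
Proof.
elim => [z0 c s t u Wcc|P1 Q1 _ h1 _ h2].
  rewrite (_ : (fun _ => _) = (fun (k x : V) (z : V * V) => (y * z0) * cofR (c x) * D s t u (x + k, z.1, z.2))).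
    exact: amp_base.
  by do 3 (apply/funext => ?); rewrite !mulrA.
rewrite (_ : (fun _ => _) = (fun (k x : V) (z : V * V) => y * P1 k x z + y * Q1 k x z)); first exact: amp_add.
by do 3 (apply/funext => ?); rewrite mulrDr.
Qed.

Lemma amp_sub N P Q : amp N P -> amp N Q -> amp N (fun (k x : V) (z : V * V) => P k x z - Q k x z).
Proof.
move=> aP /(amp_scale (-1)) aQ; have := amp_add aP aQ.
by congr amp; do 3 (apply/funext => ?); rewrite mulN1r.
Qed.

Lemma amp_weak N P : amp N.+1 P -> amp N P.
Proof.
elim => [z0 c s t u Wcc|P1 Q1 _ h1 _ h2]; last exact: amp_add.
by apply: amp_base; exact: Wc_weak.
Qed.

Lemma amp_coord N P i : amp N.+1 P -> amp N (fun (k x : V) (z : V * V) => cofR (x 0 i) * P k x z).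
Proof.
elim => [z0 c s t u Wcc|P1 Q1 _ h1 _ h2].
  rewrite (_ : (fun _ => _) = (fun (k x : V) (z : V * V) => z0 * cofR (x 0 i * c x) * D s t u (x + k, z.1, z.2))).
    by apply: amp_base; exact: Wc_coord.
  by do 3 (apply/funext => ?); rewrite cofRM !mulrA (mulrC z0).
rewrite (_ : (fun _ => _) = (fun (k x : V) (z : V * V) => cofR (x 0 i) * P1 k x z + cofR (x 0 i) * Q1 k x z)); first exact: amp_add.
by do 3 (apply/funext => ?); rewrite mulrDr.
Qed.

Lemma amp_dx N P i : amp N P -> exists2 P', amp N P' &
  forall k x z, cder1 (fun s => P k (x + s *: coordv i) z) (fun s => P' k (x + s *: coordv i) z).
Proof.
elim => [z0 c sxi seta sx Wcc|P1 Q1 _ [P1' aP1 dP1] _ [Q1' aQ1 dQ1]]; last first.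
  by exists (fun (k x : V) (z : V * V) => P1' k x z + Q1' k x z); [exact: amp_add|move=> k x z; exact: cder1D].
have [c' Wc' dc] := Wc_der i Wcc.
exists (fun (k x : V) (z : V * V) => z0 * cofR (c' x) * D sxi seta sx (x + k, z.1, z.2) +
                     z0 * cofR (c x) * D sxi seta (i :: sx) (x + k, z.1, z.2)).
  by apply: amp_add; exact: amp_base.
move=> k x z.
have h := cder1_x a_symbol sxi seta sx i (x + k) z.1 z.2.
have E (F : V * V * V -> C) : (fun s : R => F (x + k + s *: coordv i, z.1, z.2)) =
    (fun s => F (x + s *: coordv i + k, z.1, z.2)).
  by apply/funext => s; rewrite addrAC.
rewrite !E in h.
exact: (cder1M (cder1Z z0 (cder1_cofR (dc x))) h).
Qed.

Lemma amp_dxi N P i : amp N P -> exists2 P', amp N P' &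
  forall k x z, cder1 (fun s => P k x (sh2 (coordv i, 0) s z)) (fun s => P' k x (sh2 (coordv i, 0) s z)).
Proof.
elim => [z0 c sxi seta sx Wcc|P1 Q1 _ [P1' aP1 dP1] _ [Q1' aQ1 dQ1]]; last first.
  by exists (fun (k x : V) (z : V * V) => P1' k x z + Q1' k x z); [exact: amp_add|move=> k x z; exact: cder1D].
exists (fun (k x : V) (z : V * V) => z0 * cofR (c x) * D (i :: sxi) seta sx (x + k, z.1, z.2)).
  exact: amp_base.
move=> k x z.
have h := cder1_xi a_symbol sxi seta sx i (x + k) z.1 z.2.
have E (F : V * V * V -> C) : (fun s : R => F (x + k, z.1 + s *: coordv i, z.2)) =
    (fun s => F (x + k, (sh2 (coordv i, 0) s z).1, (sh2 (coordv i, 0) s z).2)).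
  by apply/funext => s; rewrite /sh2 /= scaler0 addr0.
rewrite !E in h.
exact: (cder1Z (z0 * cofR (c x)) h).
Qed.

Lemma amp_deta N P i : amp N P -> exists2 P', amp N P' &
  forall k x z, cder1 (fun s => P k x (sh2 (0, coordv i) s z)) (fun s => P' k x (sh2 (0, coordv i) s z)).
Proof.
elim => [z0 c sxi seta sx Wcc|P1 Q1 _ [P1' aP1 dP1] _ [Q1' aQ1 dQ1]]; last first.
  by exists (fun (k x : V) (z : V * V) => P1' k x z + Q1' k x z); [exact: amp_add|move=> k x z; exact: cder1D].
exists (fun (k x : V) (z : V * V) => z0 * cofR (c x) * D sxi (i :: seta) sx (x + k, z.1, z.2)).
  exact: amp_base.
move=> k x z.
have h := cder1_eta a_symbol sxi seta sx i (x + k) z.1 z.2.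
have E (F : V * V * V -> C) : (fun s : R => F (x + k, z.1, z.2 + s *: coordv i)) =
    (fun s => F (x + k, (sh2 (0, coordv i) s z).1, (sh2 (0, coordv i) s z).2)).
  by apply/funext => s; rewrite /sh2 /= scaler0 addr0.
rewrite !E in h.
exact: (cder1Z (z0 * cofR (c x)) h).
Qed.

Lemma amp_bounded N P : amp N P -> exists2 K : R, 0 <= K & forall k x z, cabs (P k x z) <= K * wt x ^+ N.
Proof.
elim => [z0 c sxi seta sx Wcc|P1 Q1 _ [K K0 HK] _ [L L0 HL]]; last first.
  exists (K + L); first exact: addr_ge0.
  by move=> k x z; rewrite (le_trans (cabsD _ _))// mulrDl lerD.
have [K K0 HK] := Wc_bounded Wcc.
have [L L0 HL] := da_bounded rho_gt0 a_symbol sxi seta sx.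
exists (cabs z0 * K * L); first by rewrite !mulr_ge0// cabs_ge0.
move=> k x z; rewrite !cabsM cabs_cofR -!mulrA ler_wpM2l ?cabs_ge0//.
by rewrite (mulrC L) mulrA ler_pM ?cabs_ge0.
Qed.

Lemma measurable_amp d (T : measurableType d) N P (fk fx fxi feta : T -> V) : amp N P ->
  measurable_fun setT fk -> measurable_fun setT fx ->
  measurable_fun setT fxi -> measurable_fun setT feta ->
  cmeas (fun t => P (fk t) (fx t) (fxi t, feta t)).
Proof.
move=> aP mk mx mxi meta; elim: aP => [z0 c sxi seta sx Wcc|P1 Q1 _ h1 _ h2]; last exact: cmeasD.
apply: cmeasM.
  apply: cmeasM; first exact: cmeas_cst.
  by apply: cmeas_cofR; exact: (measurableT_comp (measurable_Wc Wcc) mx).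
apply: (cmeas_comp (cmeas_da a_symbol sxi seta sx)).
apply: measurable_fun_pair => //; apply: measurable_fun_pair => //.
exact: measurable_rv_add.
Qed.

(** Passes from unit balls to the weight by averaging over centres: the ball volume times [wt x] is
    the integral over [m] of [wt x * ballI m x], and there [wt x <= 3 ^+ n * wt m]. The bounds on
    balls are then summed against the integrable function [wt m]. *)
Lemma weighted_slice_bound (q : V -> \bar R) (K : R) : measurable_fun setT q -> (forall x, 0 <= q x)%E ->
  (forall m, \int[mu]_x ((ballI m x)%:E * q x) <= K%:E)%E ->
  (\int[mu]_x ((wt x)%:E * q x) <= (fine (@ball_vol R n))^-1%:E * ((3 ^+ n)%:E * (\int[mu]_m (wt m)%:E) * K%:E))%E.
Proof.
move=> mq q0 HK; set v := fine (@ball_vol R n).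
have [mw w0 woo] := @gdom_wt R n.
have mwE : measurable_fun setT (EFin \o @wt R n) by apply/measurable_EFinP.
have v0 : 0 < v by rewrite fine_gt0// ball_vol_gt0 -ge0_fin_numE ?ball_vol_fin// ltW// ball_vol_gt0.
have vE : @ball_vol R n = v%:E by rewrite fineK// ball_vol_fin.
have mb := @measurable_ballI2 R n.
have K0 : (0 <= K%:E)%E.
  by apply: le_trans (HK 0); apply: integral_ge0 => x _; apply: mule_ge0 => //; rewrite lee_fin ballI_ge0.
have mb2 x : measurable_fun setT (fun m : V => (ballI m x)%:E).
  by apply/measurable_EFinP; exact: (measurableT_comp mb (pair2_measurable x)).
have mqw : measurable_fun setT (fun x => (wt x)%:E * q x)%E by exact: emeasurable_funM.
suff H : (v%:E * \int[mu]_x ((wt x)%:E * q x) <= (3 ^+ n)%:E * (\int[mu]_m (wt m)%:E) * K%:E)%E.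
  by rewrite lee_pdivlMl.
have mG : measurable_fun setT (fun p : V * V => (3 ^+ n)%:E * ((wt p.2)%:E * ((ballI p.2 p.1)%:E * q p.1)))%E.
  apply: emeasurable_funM => //; apply: emeasurable_funM.
    exact: (measurableT_comp mwE measurable_snd).
  apply: emeasurable_funM; last exact: (measurableT_comp mq measurable_fst).
  by apply/measurable_EFinP; exact: (measurableT_comp mb (@measurable_swap _ _ V V)).
have G0 p : (0 <= (3 ^+ n)%:E * ((wt p.2)%:E * ((ballI p.2 p.1)%:E * q p.1)))%E.
  by rewrite !mule_ge0// lee_fin ?ballI_ge0// exprn_ge0.
apply: (@le_trans _ _ (\int[mu]_x \int[mu]_m ((3 ^+ n)%:E * ((wt m)%:E * ((ballI m x)%:E * q x))))%E).
  rewrite -ge0_integralZl//; last 2 first.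
  - by move=> x _; rewrite mule_ge0// lee_fin.
  - by rewrite lee_fin ltW.
  apply: ge0_le_integral => //.
  - by move=> x _; rewrite !mule_ge0// lee_fin// ltW.
  - exact: emeasurable_funM.
  - exact: (measurable_int_section mu (f := fun p : V * V => (3 ^+ n)%:E * ((wt p.2)%:E * ((ballI p.2 p.1)%:E * q p.1)))%E mG G0).
  move=> x _.
  have <- : (\int[mu]_m ((wt x * ballI m x)%:E * q x) = v%:E * ((wt x)%:E * q x))%E.
    rewrite ge0_integralZr//; last 2 first.
    - by apply/measurable_EFinP; apply: measurable_funM => //; apply/measurable_EFinP; exact: mb2.
    - by move=> m _; rewrite lee_fin mulr_ge0// ballI_ge0.
    under eq_integral do rewrite EFinM.
    rewrite ge0_integralZl//; last 2 first.
    - by move=> m _; rewrite lee_fin ballI_ge0.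
    - by rewrite lee_fin.
    by rewrite integral_ballI_center vE muleA (muleC v%:E).
  apply: ge0_le_integral => //.
  - by move=> m _; rewrite mule_ge0// lee_fin mulr_ge0// ballI_ge0.
  - apply: emeasurable_funM => //.
    by apply/measurable_EFinP; apply: measurable_funM => //; apply/measurable_EFinP; exact: mb2.
  - exact: (measurableT_comp mG (pair1_measurable x)).
  - move=> m _; rewrite !muleA; apply: lee_wpmul2r => //.
    by rewrite -!EFinM lee_fin -mulrA wt_ballI.
have := ge0_fubini mu mu mG G0 => /= ->.
have mw3 : measurable_fun setT (fun m : V => (3 ^+ n)%:E * (wt m)%:E)%E.
  by apply: emeasurable_funM.
have w30 (m : V) : (0 <= (3 ^+ n)%:E * (wt m)%:E)%E by rewrite mule_ge0// lee_fin// exprn_ge0.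
have n30 : (0 <= (3 ^+ n)%:E :> \bar R)%E by rewrite lee_fin exprn_ge0.
rewrite -(ge0_integralZl _ measurableT mwE (fun m _ => w0 m) n30).
rewrite -(ge0_integralZr _ measurableT mw3 (fun m _ => w30 m) K0).
apply: ge0_le_integral => //.
- by move=> m _; apply: integral_ge0 => x _; exact: (G0 (x, m)).
- exact: (measurable_int_section mu (f := fun p : V * V => (3 ^+ n)%:E * ((wt p.1)%:E * ((ballI p.1 p.2)%:E * q p.2)))%E (measurableT_comp mG (@measurable_swap _ _ V V)) (fun p => G0 (p.2, p.1))).
- by apply: emeasurable_funM => //; apply: emeasurable_funM.
move=> m _.
have mbq : measurable_fun setT (fun x => (ballI m x)%:E * q x)%E.
  by apply: emeasurable_funM => //; apply/measurable_EFinP; exact: measurable_ballI.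
have bq0 x : (0 <= (ballI m x)%:E * q x)%E by rewrite mule_ge0// lee_fin ballI_ge0.
under eq_integral do rewrite muleA -EFinM.
rewrite ge0_integralZl//; last by rewrite lee_fin mulr_ge0// exprn_ge0.
by rewrite EFinM; apply: lee_wpmul2l; [rewrite -EFinM lee_fin mulr_ge0// exprn_ge0|exact: HK].
Qed.

(** The square of the cut-off is at most a multiple of [wt x], so [weighted_slice_bound] reduces the
    integral over all [x] to slices of derivatives of [a] over unit balls. Sums of amplitudes cost
    the factor two of [sqrD_le2]. *)
Lemma amp_L2 N P : amp N.+1 P -> exists2 K : R, 0 <= K & forall k zeta,
  (\int[mu]_x \int[mu]_eta ((cabs (P k x ((zeta - eta)%R, eta)) ^+ 2)%:E) <= K%:E)%E.
Proof.
have ms (P1 : V -> V -> V * V -> C) k zeta : amp N.+1 P1 ->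
    measurable_fun setT (fun p : V * V => (cabs (P1 k p.1 ((zeta - p.2)%R, p.2)) ^+ 2)%:E).
  move=> aP; apply/measurable_EFinP; apply: measurable_funX; apply: cmeas_cabs.
  apply: (measurable_amp aP) => //.
  by apply: measurable_rv_add => //; apply: measurable_rv_opp; exact: measurable_snd.
have s0 (P1 : V -> V -> V * V -> C) k x z : (0 <= (cabs (P1 k x z) ^+ 2)%:E)%E by rewrite lee_fin sqr_ge0.
elim => [z0 c sxi seta sx Wcc|P1 Q1 aP1 [K K0 HK] aQ1 [L L0 HL]]; last first.
  exists (2 * K + 2 * L); first by rewrite addr_ge0// mulr_ge0.
  move=> k zeta.
  apply: (@le_trans _ _ (\int[mu]_x \int[mu]_eta (2%:E * (cabs (P1 k x ((zeta - eta)%R, eta)) ^+ 2)%:E +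
     2%:E * (cabs (Q1 k x ((zeta - eta)%R, eta)) ^+ 2)%:E))%E).
    have m1 := ms _ k zeta (amp_add aP1 aQ1).
    have m2 : measurable_fun setT (fun p : V * V => 2%:E * (cabs (P1 k p.1 ((zeta - p.2)%R, p.2)) ^+ 2)%:E +
       2%:E * (cabs (Q1 k p.1 ((zeta - p.2)%R, p.2)) ^+ 2)%:E)%E.
      by apply: emeasurable_funD; apply: emeasurable_funM => //; exact: ms.
    have g2 (p : V * V) : (0 <= 2%:E * (cabs (P1 k p.1 ((zeta - p.2)%R, p.2)) ^+ 2)%:E +
       2%:E * (cabs (Q1 k p.1 ((zeta - p.2)%R, p.2)) ^+ 2)%:E)%E.
      by apply: adde_ge0; apply: mule_ge0.
    apply: ge0_le_integral => //.
    - by move=> x _; apply: integral_ge0 => eta _; rewrite lee_fin sqr_ge0.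
    - exact: (measurable_int_section mu m1 (fun p => s0 (fun (k x : V) (z : V * V) => P1 k x z + Q1 k x z) k _ _)).
    - exact: (measurable_int_section mu m2 g2).
    move=> x _; apply: ge0_le_integral => //.
    - by move=> eta _; rewrite lee_fin sqr_ge0.
    - exact: (measurableT_comp m1 (pair1_measurable x)).
    - exact: (measurableT_comp m2 (pair1_measurable x)).
    move=> eta _; rewrite -!EFinM -EFinD lee_fin.
    apply: le_trans (sqrD_le2 _ _); rewrite ler_sqr ?nnegrE ?cabs_ge0 ?addr_ge0 ?cabs_ge0//.
    exact: cabsD.
  have mP x := measurableT_comp (ms _ k zeta aP1) (pair1_measurable x).
  have mQ x := measurableT_comp (ms _ k zeta aQ1) (pair1_measurable x).
  have mP' := measurable_int_section mu (ms _ k zeta aP1) (fun p => s0 P1 k _ _).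
  have mQ' := measurable_int_section mu (ms _ k zeta aQ1) (fun p => s0 Q1 k _ _).
  under eq_integral => x _.
    rewrite ge0_integralD//; last 4 first.
    - by move=> eta _; exact: mule_ge0.
    - by apply: emeasurable_funM => //; exact: (mP x).
    - by move=> eta _; exact: mule_ge0.
    - by apply: emeasurable_funM => //; exact: (mQ x).
    rewrite ge0_integralZl//; last exact: (mP x).
    rewrite ge0_integralZl//; last exact: (mQ x).
    over.
  rewrite ge0_integralD//; last 4 first.
  - by move=> x _; apply: mule_ge0 => //; exact: integral_ge0.
  - exact: emeasurable_funM.
  - by move=> x _; apply: mule_ge0 => //; exact: integral_ge0.
  - exact: emeasurable_funM.
  rewrite ge0_integralZl//; last by move=> x _; exact: integral_ge0.
  rewrite ge0_integralZl//; last by move=> x _; exact: integral_ge0.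
  rewrite [leRHS]EFinD; apply: leeD; rewrite [leRHS]EFinM; exact: lee_wpmul2l.
have [K K0 HK] := Wc_bounded Wcc.
have [L HL] := slice_bounded_da rho_gt0 a_symbol a_L2 sxi seta sx.
pose B : \bar R := ((fine (@ball_vol R n))^-1%:E * ((3 ^+ n)%:E * (\int[mu]_m (wt m)%:E) * L%:E))%E.
have [mw w0 woo] := @gdom_wt R n.
have Bfin : B \is a fin_num.
  rewrite /B !fin_numM// ge0_fin_numE//.
  by apply: integral_ge0 => x _; rewrite lee_fin.
pose M := (cabs z0 * K) ^+ 2.
exists (M * `|fine B|); first by rewrite mulr_ge0// sqr_ge0.
move=> k zeta.
pose q x := (\int[mu]_eta ((cabs (D sxi seta sx (x, (zeta - eta)%R, eta)) ^+ 2)%:E))%E.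
have mda := measurable_cabs_da a_symbol sxi seta sx.
have d0 p : (0 <= (cabs (D sxi seta sx p) ^+ 2)%:E)%E by rewrite lee_fin sqr_ge0.
have mq : measurable_fun setT q by exact: (measurable_slice_x zeta mda d0).
have q0 x : (0 <= q x)%E by exact: integral_ge0.
have mqk : measurable_fun setT (fun x : V => q (x + k)%R) by exact: (measurableT_comp mq (measurable_rvD k)).
have mwE : measurable_fun setT (EFin \o @wt R n) by apply/measurable_EFinP.
(* Translating by [k] moves the centre [m] to [m + k], and the bound on slices is uniform in the
   centre. *)
have step1 : (\int[mu]_x ((wt x)%:E * q (x + k)%R) <= B)%E.
  apply: weighted_slice_bound => // m.
  have mbk : measurable_fun setT (fun x => (ballI (m + k) x)%:E * q x)%E.
    by apply: emeasurable_funM => //; apply/measurable_EFinP; exact: measurable_ballI.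
  have bk0 x : (0 <= (ballI (m + k) x)%:E * q x)%E by rewrite mule_ge0// lee_fin ballI_ge0.
  apply: le_trans (HL (m + k) zeta).
  rewrite /slice -(ge0_integral_rvD k mbk bk0).
  rewrite le_eqVlt; apply/orP; left; apply/eqP; apply: eq_integral => x _.
  by rewrite (ballI_sym m) (ballI_sym (m + k)) opprD addrACA subrr addr0.
have m1 := ms _ k zeta (amp_base z0 sxi seta sx Wcc).
apply: (@le_trans _ _ (\int[mu]_x (M%:E * ((wt x)%:E * q (x + k)%R)))%E).
  apply: ge0_le_integral => //.
  - by move=> x _; apply: integral_ge0 => eta _; rewrite lee_fin sqr_ge0.
  - exact: (measurable_int_section mu m1 (fun p => s0 (fun (k x : V) (z : V * V) => z0 * cofR (c x) * D sxi seta sx (x + k, z.1, z.2)) k _ _)).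
  - by apply: emeasurable_funM => //; apply: emeasurable_funM.
  move=> x _; rewrite /q muleA -EFinM -ge0_integralZl//; last 2 first.
  - exact: (measurable_slice_eta (x + k) zeta mda).
  - by rewrite lee_fin mulr_ge0// sqr_ge0.
  apply: ge0_le_integral => //.
  - by move=> eta _; rewrite lee_fin sqr_ge0.
  - exact: (measurableT_comp m1 (pair1_measurable x)).
  - by apply: emeasurable_funM => //; exact: (measurable_slice_eta (x + k) zeta mda).
  move=> eta _; rewrite -EFinM lee_fin !cabsM cabs_cofR exprMn ler_wpM2r ?sqr_ge0//.
  (* Squaring produces [2 * N.+1] factors of the weight, of which only one is kept. *)
  have cx : `|c x| ^+ 2 <= K ^+ 2 * wt x.
    apply: (@le_trans _ _ ((K * wt x ^+ N.+1) ^+ 2)).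
      by rewrite ler_sqr ?nnegrE// mulr_ge0// exprn_ge0// wt_ge0.
    rewrite exprMn ler_wpM2l ?sqr_ge0// -exprM -[leRHS]expr1.
    by apply: ler_wiXn2l; rewrite ?wt_ge0 ?wt_le1.
  have := ler_wpM2l (sqr_ge0 (cabs z0)) cx.
  by rewrite (mulrA (cabs z0 ^+ 2) (K ^+ 2)) -(exprMn _ (cabs z0) `|c x|) -(exprMn _ (cabs z0) K).
rewrite ge0_integralZl//; last 3 first.
- exact: emeasurable_funM.
- by move=> x _; rewrite mule_ge0// lee_fin.
- by rewrite lee_fin sqr_ge0.
rewrite (EFinM M); apply: lee_wpmul2l; first by rewrite lee_fin sqr_ge0.
apply: le_trans step1 _; rewrite -[leLHS]fineK// lee_fin; exact: ler_norm.
Qed.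

End amplitudes.

(** * The [T T^*] estimate *)

Lemma conj_mul {R : realType} (z w : R[i]) : conjc (z * w) = conjc z * conjc w.
Proof. by apply: cplxP; rewrite ?cReM ?cImM !cReJ !cImJ ?cReM ?cImM; ring. Qed.

Section section_integral.
Context {R : realType} d1 d2 (T1 : measurableType d1) (T2 : measurableType d2).
Variables (m1 : {sigma_finite_measure set T1 -> \bar R})
          (m2 : {sigma_finite_measure set T2 -> \bar R}).

Lemma cabs_CI_section (h : T1 * T2 -> R[i]) G1 G2 x : cmeas h -> 0 <= G1 x -> gdom m2 G2 ->
  (forall y, cabs (h (x, y)) <= G1 x * G2 y) ->
  cabs (CI m2 (fun y => h (x, y))) <= fine (\int[m2]_y (G2 y)%:E)%E * G1 x.
Proof.
move=> mh G10 g2 hG; have [mG2 G20 G2oo] := g2.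
have mE : measurable_fun setT (EFin \o G2) by apply/measurable_EFinP.
have fG2 : (\int[m2]_y (G2 y)%:E)%E \is a fin_num.
  by rewrite ge0_fin_numE// integral_ge0// => p _; rewrite lee_fin.
have ih : cintg m2 (fun y => h (x, y)).
  by apply: (gdom_cintg (gdomZ G10 g2)) => //; exact: cmeas_section1.
rewrite -lee_fin EFinM fineK// (le_trans (cabs_CI ih))//.
have G10E : (0 <= (G1 x)%:E)%E by rewrite lee_fin.
have G20E y : setT y -> (0 <= (G2 y)%:E)%E by rewrite lee_fin.
rewrite -(ge0_integralZr m2 measurableT mE G20E G10E).
apply: ge0_le_integral => //.
- by move=> p _; rewrite lee_fin cabs_ge0.
- by apply/measurable_EFinP; apply: cmeas_cabs; have [] := ih.
- exact: emeasurable_funM.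
- by move=> y _; rewrite -EFinM lee_fin mulrC.
Qed.

Lemma cintg_CI (h : T1 * T2 -> R[i]) G1 G2 : cmeas h -> gdom m1 G1 -> gdom m2 G2 ->
  (forall x y, cabs (h (x, y)) <= G1 x * G2 y) ->
  cintg m1 (fun x => CI m2 (fun y => h (x, y))).
Proof.
move=> mh g1 g2 hG; have [_ G20 _] := g2; have [_ G10 _] := g1.
have I0 : 0 <= fine (\int[m2]_y (G2 y)%:E)%E.
  by apply/fine_ge0/integral_ge0 => y _; rewrite lee_fin.
apply: (gdom_cintg (gdomZ I0 g1)); first exact: cmeas_CI.
by move=> x; apply: cabs_CI_section.
Qed.

End section_integral.

Section ttstar.
Context {R : realType} (n : nat) d (Z : measurableType d).
Variable nu : {sigma_finite_measure set Z -> \bar R}.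
Notation V := 'rV[R]_n.
Notation mu := (@rv_measure R n).
Notation C := R[i].

Lemma CI_mul (f g : Z -> C) : cintg nu f -> cintg nu g ->
  CI nu f * CI nu g = CI (prodm nu nu) (fun p => f p.1 * g p.2).
Proof.
move=> fi gi.
have mf := fi.1; have mg := gi.1.
have igx z : cintg nu (fun y => z * g y) by exact: cintgZ.
have mh : cmeas (fun p : Z * Z => f p.1 * g p.2).
  by apply: cmeasM; [exact: (cmeas_comp mf measurable_fst)|exact: (cmeas_comp mg measurable_snd)].
rewrite CI_prod1.
- rewrite mulrC -CIZ//; apply: eq_CI => x.
  by rewrite mulrC -CIZ.
- by apply: (gdom_cintg (gdom_prod (gdom_cabs fi) (gdom_cabs gi))) => // p; rewrite cabsM.
- move=> x; exact: (igx (f x)).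
Qed.

Lemma integral_cabs_sqr (T' : V -> C) : cmeas T' -> cintg mu (fun x => T' x * conjc (T' x)) ->
  (\int[mu]_x (cabs (T' x) ^+ 2)%:E = (cRe (CI mu (fun x => T' x * conjc (T' x))))%:E)%E.
Proof.
move=> mT iT; rewrite /= /Rintegral fineK; last first.
  exact: (integrable_fin_num _ (cintgRe iT)).
by apply: eq_integral => x _; rewrite mul_conjc.
Qed.

Variable theta : Z -> V.
Hypothesis mtheta : measurable_fun setT theta.

(** The square is expanded into an integral over pairs [p], and Fubini puts the [x] integral
    innermost, where the hypothesis on [Q] trades it for a factor decaying in
    [theta p.1 - theta p.2]. The map [theta] is a parameter because it is the sum of the frequencies
    in the bilinear estimate and the identity in [bessel]. [G] only ensures integrability and is
    absent from the bound. *)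
Lemma tt_star (Phi : V -> Z -> C) (Q : Z * Z -> V -> C) (U : Z -> C) (G : Z -> R) (K : R) :
  cmeas (fun p : V * Z => Phi p.1 p.2) -> (forall x z, cabs (Phi x z) <= K * wt x) ->
  cmeas (fun p : (Z * Z) * V => Q p.1 p.2) -> (forall p, cintg mu (Q p)) ->
  (forall p, CI mu (fun x => (Phi x p.1 * conjc (Phi x p.2)) * cexpi (dotv x (theta p.1 - theta p.2))) =
     cofR (wt (theta p.1 - theta p.2)) * CI mu (fun x => Q p x * cexpi (dotv x (theta p.1 - theta p.2)))) ->
  cmeas U -> gdom nu G -> (forall z, cabs (U z) <= G z) ->
  (\int[mu]_x (cabs (CI nu (fun z => Phi x z * cexpi (dotv x (theta z)) * U z)) ^+ 2)%:E <=
   \int[prodm nu nu]_p ((cabs (U p.1) * cabs (U p.2) * wt (theta p.1 - theta p.2))%:E *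
      \int[mu]_x (cabs (Q p x))%:E))%E.
Proof.
move=> mPhi bPhi mQ iQ hQ mU gG UG.
have [mG G0 Goo] := gG.
pose g x z := Phi x z * cexpi (dotv x (theta z)) * U z.
have mg : cmeas (fun p : V * Z => g p.1 p.2).
  apply: cmeasM; last exact: (cmeas_comp mU measurable_snd).
  apply: cmeasM => //; apply: cmeas_expi; apply: measurable_dotv => //.
  exact: (measurableT_comp mtheta measurable_snd).
(* [Z] is inhabited by [point], so the bound on [Phi] forces [K] to be nonnegative. *)
have K0 : 0 <= K by rewrite -(pmulr_lge0 K (wt_gt0 (0 : V))) (le_trans _ (bPhi 0 point))// cabs_ge0.
have bg x z : cabs (g x z) <= K * wt x * G z.
  rewrite !cabsM cabs_expi mulr1; apply: ler_pM => //; exact: cabs_ge0.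
have ig x : cintg nu (g x).
  have k0 : 0 <= K * wt x by rewrite mulr_ge0// wt_ge0.
  apply: (gdom_cintg (gdomZ k0 gG)) => //.
  exact: (cmeas_section1 x mg).
pose F x := CI nu (g x).
have mF : cmeas F by exact: (cmeas_CI nu mg).
pose h (q : V * (Z * Z)) := g q.1 q.2.1 * conjc (g q.1 q.2.2).
have m12 : measurable_fun setT (fun q : V * (Z * Z) => (q.1, q.2.1)).
  by apply: measurable_fun_pair => //; exact: (measurableT_comp measurable_fst measurable_snd).
have m22 : measurable_fun setT (fun q : V * (Z * Z) => (q.1, q.2.2)).
  by apply: measurable_fun_pair => //; exact: (measurableT_comp measurable_snd measurable_snd).
have mh : cmeas h.
  apply: cmeasM; first exact: (cmeas_comp mg m12).
  by apply: cmeasJ; exact: (cmeas_comp mg m22).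
have FE x : F x * conjc (F x) = CI (prodm nu nu) (fun p => h (x, p)).
  by rewrite /F -CIJ// (CI_mul (ig x) (cintgJ (ig x))).
pose G1 (x : V) := K ^+ 2 * wt x.
pose G2 (p : Z * Z) := G p.1 * G p.2.
have gG1 : gdom mu G1 by apply: gdomZ; [exact: sqr_ge0|exact: gdom_wt].
have gG2 : gdom (prodm nu nu) G2 by exact: gdom_prod.
have bh x p : cabs (h (x, p)) <= G1 x * G2 p.
  rewrite cabsM cabsJ /= (le_trans (ler_pM (cabs_ge0 _) (cabs_ge0 _) (bg x p.1) (bg x p.2)))//.
  rewrite mulrACA /G1 /G2 ler_wpM2r ?mulr_ge0// -expr2 exprMn ler_wpM2l ?sqr_ge0//.
  by rewrite expr2 ler_piMl ?wt_ge0// wt_le1.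
have iF : cintg mu (fun x => F x * conjc (F x)).
  rewrite (_ : (fun _ => _) = fun x => CI (prodm nu nu) (fun p => h (x, p))); last exact/funext.
  exact: (cintg_CI mh gG1 gG2 bh).
rewrite -/(F _) integral_cabs_sqr//.
have -> : CI mu (fun x => F x * conjc (F x)) = CI (prodm nu nu) (fun p => CI mu (fun x => h (x, p))).
  rewrite -(CI_swap mh gG1 gG2 bh); apply: eq_CI => x; exact: FE.
set J := fun p => CI mu _.
have JE p : J p = (U p.1 * conjc (U p.2)) * (cofR (wt (theta p.1 - theta p.2)) *
    CI mu (fun x => Q p x * cexpi (dotv x (theta p.1 - theta p.2)))).
  rewrite -hQ -CIZ.
    apply: eq_CI => x; rewrite /h /g /= !conj_mul conj_cexpi dotvDr dotvNr cexpiD.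
    by ring.
  have cPhi z : cmeas (fun x => Phi x z) by exact: (cmeas_section2 z mPhi).
  apply: (gdom_cintg gG1).
    by apply: cmeasM; [apply: cmeasM => //; exact: cmeasJ|exact: cmeas_phase].
  move=> x; rewrite !cabsM cabsJ cabs_expi mulr1.
  rewrite (le_trans (ler_pM (cabs_ge0 _) (cabs_ge0 _) (bPhi x p.1) (bPhi x p.2)))//.
  rewrite /G1 -expr2 exprMn ler_wpM2l ?sqr_ge0//.
  by rewrite expr2 ler_piMl ?wt_ge0// wt_le1.
have iJ : cintg (prodm nu nu) J.
  apply: (cintg_CI (cmeas_comp mh (@measurable_swap _ _ (Z * Z)%type V)) gG2 gG1) => p x.
  by rewrite mulrC; exact: bh.
apply: (@le_trans _ _ (cabs (CI (prodm nu nu) J))%:E).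
  by rewrite lee_fin (le_trans (ler_norm _))// normRe_cabs.
apply: le_trans (cabs_CI iJ) _.
have mQa : measurable_fun setT (fun p : (Z * Z) * V => (cabs (Q p.1 p.2))%:E).
  by apply/measurable_EFinP; exact: cmeas_cabs.
have mUU : measurable_fun setT (fun p : Z * Z => (cabs (U p.1) * cabs (U p.2) * wt (theta p.1 - theta p.2))%:E).
  have mcU := cmeas_cabs mU.
  apply/measurable_EFinP; apply: measurable_funM.
    by apply: measurable_funM; [exact: (measurableT_comp mcU measurable_fst)|exact: (measurableT_comp mcU measurable_snd)].
  apply: (measurableT_comp (@measurable_wt R n)); apply: measurable_rv_add.
    exact: (measurableT_comp mtheta measurable_fst).
  by apply: measurable_rv_opp; exact: (measurableT_comp mtheta measurable_snd).
apply: ge0_le_integral => //.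
- by move=> p _; rewrite lee_fin cabs_ge0.
- by apply/measurable_EFinP; apply: cmeas_cabs; have [] := iJ.
- apply: emeasurable_funM => //.
  by apply: (measurable_int_section mu mQa) => p; rewrite lee_fin cabs_ge0.
move=> p _; rewrite JE !cabsM cabsJ cabs_cofR ger0_norm ?wt_ge0// mulrA EFinM.
apply: lee_wpmul2l; first by rewrite lee_fin !mulr_ge0 ?cabs_ge0 ?wt_ge0.
have iQe : cintg mu (fun x => Q p x * cexpi (dotv x (theta p.1 - theta p.2))).
  have := cintgM_bd (iQ p) (cmeas_phase (theta p.1 - theta p.2)) (K := 1).
  rewrite (_ : (fun x => cexpi _ * Q p x) = fun x => Q p x * cexpi (dotv x (theta p.1 - theta p.2))); last first.
    by apply/funext => x; rewrite mulrC.
  by apply => x; rewrite cabs_expi.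
apply: le_trans (cabs_CI iQe) _.
by under eq_integral do rewrite cabsM cabs_expi mulr1.
Qed.

End ttstar.

(** * Schwartz functions and their Fourier transforms *)

Section derivative_under_integral.
Context {R : realType} d (T : measurableType d) (mu : {measure set T -> \bar R}).
Notation C := R[i].

Lemma is_derive_Rintegral (f f' : R -> T -> R) (G : T -> R) :
  (forall t y, is_derive t (1:R) (f^~ y) (f' t y)) ->
  (forall t, mu.-integrable setT (EFin \o f t)) ->
  mu.-integrable setT (EFin \o G) -> (forall t y, `|f' t y| <= G y) ->
  forall t, is_derive t (1:R) (fun s => \int[mu]_y f s y)%R (\int[mu]_y f' t y)%R.
Proof.
move=> df fi Gi fG t.
have It : `]t - 1, t + 1[%classic t.
  by rewrite /= in_itv/= ltrBlDr !ltrDl ltr01.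
have dE s y : partial1of2 f s y = f' s y.
  by rewrite partial1of2E; have [_ ->] := df s y.
have fi' x : `]t - 1, t + 1[%classic x -> mu.-integrable setT (EFin \o f x) by move=> _.
have df' x y : `]t - 1, t + 1[%classic x -> setT y -> derivable (f ^~ y) x 1.
  by move=> _ _; have [] := df x y.
have G0 y : 0 <= G y by rewrite (le_trans _ (fG 0 y)).
have fG' x y : `]t - 1, t + 1[%classic x -> setT y -> `|partial1of2 f x y| <= G y.
  by move=> _ _; rewrite dE.
have H1 := derivable_under_integral measurableT It fi' df' G0 Gi fG'.
have H2 := differentiation_under_integral measurableT It fi' df' G0 Gi fG'.
apply: (@DeriveDef _ _ _ _ _ _ _ H1).
rewrite -derive1E H2; apply: eq_Rintegral => y _; exact: dE.
Qed.

Lemma cder1_CI (h h' : R -> T -> C) (G : T -> R) :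
  (forall y, cder1 (h^~ y) (h'^~ y)) -> (forall t, cintg mu (h t)) ->
  gdom mu G -> (forall t y, cabs (h' t y) <= G y) ->
  cder1 (fun t => CI mu (h t)) (fun t => CI mu (h' t)).
Proof.
move=> dh hi [mG G0 Goo] hG t.
have Gi : mu.-integrable setT (EFin \o G).
  apply/integrableP; split; first exact/measurable_EFinP.
  by under eq_integral do rewrite /= ger0_norm ?G0//.
split.
  apply: (is_derive_Rintegral (f := fun s y => cRe (h s y)) (f' := fun s y => cRe (h' s y)) _ _ Gi).
  - by move=> s y; exact: (dh y s).1.
  - by move=> s; exact: cintgRe.
  - by move=> s y; exact: le_trans (normRe_cabs _) (hG s y).
apply: (is_derive_Rintegral (f := fun s y => cIm (h s y)) (f' := fun s y => cIm (h' s y)) _ _ Gi).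
- by move=> s y; exact: (dh y s).2.
- by move=> s; exact: cintgIm.
- by move=> s y; exact: le_trans (normIm_cabs _) (hG s y).
Qed.

End derivative_under_integral.

Section schwartz_class.
Context {R : realType} (n : nat).
Notation V := 'rV[R]_n.
Notation C := R[i].
Notation mu := (@rv_measure R n).
Variable f : V -> C.
Hypothesis f_schwartz : schwartz f.

(** Indexed by a list with repetitions because the factors are to be removed one at a time. Over all
    indices it is the inverse of [wt]; listing them twice gives the inverse of [wt ^+ 2]. *)
Definition sqpoly (L : seq 'I_n) (x : V) : R := \prod_(i <- L) (1 + x 0 i ^+ 2).

Lemma sqpoly_cat L L' x : sqpoly (L ++ L') x = sqpoly L x * sqpoly L' x.
Proof. by rewrite /sqpoly big_cat. Qed.

Lemma sqpoly_enum x : sqpoly (index_enum 'I_n) x = (wt x)^-1.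
Proof. by rewrite /sqpoly /wt -prodfV; apply: eq_bigr => i _; rewrite /wt1 invrK. Qed.

Lemma schwartz_mon_word (L s : seq 'I_n) : exists K : R, forall x : V,
  `|\prod_(i <- L) x 0 i| * cabs (dword (map (@coordv R n) s) f x) <= K.
Proof.
have [sf bf] := f_schwartz.
have [K HK] := bf (fun i => count_mem i L) (fun i => count_mem i s).
exists K => x.
have E : vmon x (fun i => count_mem i L) = \prod_(i <- L) x 0 i.
  rewrite /vmon -(perm_big _ (perm_count_enum L)) big_flatten big_map big_enum /=.
  by apply: eq_bigr => i _; rewrite big_nseq iter_mulr_1.
by have := HK x; rewrite cabsM cabs_cofR E -dword_Dmulti.
Qed.

(** Induction on [L] with an auxiliary monomial [t]: the factor [1 + x_i^2] splits the bound into
    the one for [t] and the one for [t] enlarged by two letters [i]. *)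
Lemma schwartz_sqpoly (L s : seq 'I_n) : exists K : R, forall x : V,
  sqpoly L x * cabs (dword (map (@coordv R n) s) f x) <= K.
Proof.
suff H t : exists K : R, forall x : V,
    sqpoly L x * `|\prod_(i <- t) x 0 i| * cabs (dword (map (@coordv R n) s) f x) <= K.
  have [K HK] := H [::]; exists K => x; have := HK x.
  by rewrite big_nil normr1 mulr1.
elim: L t => [|i L IH] t.
  have [K HK] := schwartz_mon_word t s; exists K => x.
  by rewrite /sqpoly big_nil mul1r.
have [K HK] := IH t; have [M HM] := IH [:: i, i & t].
exists (K + M) => x; apply: le_trans (lerD (HK x) (HM x)).
rewrite /sqpoly !big_cons -/(sqpoly L x) -mulrDl ler_wpM2r ?cabs_ge0//.
rewrite [leRHS](_ : _ = (1 + x 0 i ^+ 2) * sqpoly L x * `|\prod_(j <- t) x 0 j|)//.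
rewrite !normrM mulrA -normrM -expr2 normrX real_normK ?num_real//; ring.
Qed.

(** Peetre's inequality for this weight. In one coordinate, with [c = a + b], it reads
    [1 + a^2 <= 2 (1 + b^2) (1 + c^2)], and the difference of its sides is
    [1 + (a + 2 b)^2 + 2 (b c)^2]. *)
Lemma wt_shift (k x : V) : wt (x + k) <= 2 ^+ n * (wt k)^-1 * wt x.
Proof.
have -> : 2 ^+ n = \prod_(i < n) (2 : R) by rewrite prodr_const card_ord.
rewrite /wt -prodfV -!big_split /=; apply: ler_prod => i _.
rewrite (ltW (wt1_gt0 _)) /= /wt1 invrK !mxE ler_pdivlMr ?one_sqr_gt0//.
rewrite mulrC ler_pdivrMr ?one_sqr_gt0//.
set a := x 0 i; set b := k 0 i.
have := sqr_ge0 (a + 2 * b); have := sqr_ge0 (b * (a + b)); nra.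
Qed.

(** Polynomial multiples of derivatives of [f], seen from the centre [k]. Only [f] is translated and
    [q] is not, so multiplication by a coordinate of the window stays in the class. It contains the
    windowed functions and all that integration by parts makes of them. *)
Inductive sfam : (V -> V -> C) -> Prop :=
| sfam_base z0 q s : alg true q ->
    sfam (fun k x => z0 * cofR (q x) * dword (map (@coordv R n) s) f (x + k))
| sfam_add P Q : sfam P -> sfam Q -> sfam (fun k x => P k x + Q k x).

Lemma sfam_shift : sfam (fun k x => f (x + k)).
Proof.
rewrite (_ : (fun _ => _) = (fun k x => 1 * cofR 1 * dword (map (@coordv R n) [::]) f (x + k))).
  by apply: sfam_base; exact: alg_cst.
by do 2 (apply/funext => ?); rewrite cofR1 !mul1r.
Qed.

Lemma sfam_scale P (y : C) : sfam P -> sfam (fun k x => y * P k x).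
Proof.
elim => [z0 q s aq|P1 Q1 _ h1 _ h2].
  rewrite (_ : (fun _ => _) = (fun k x => (y * z0) * cofR (q x) * dword (map (@coordv R n) s) f (x + k))).
    exact: sfam_base.
  by do 2 (apply/funext => ?); rewrite !mulrA.
rewrite (_ : (fun _ => _) = (fun k x => y * P1 k x + y * Q1 k x)); first exact: sfam_add.
by do 2 (apply/funext => ?); rewrite mulrDr.
Qed.

Lemma sfam_sub P Q : sfam P -> sfam Q -> sfam (fun k x => P k x - Q k x).
Proof.
move=> aP /(sfam_scale (-1)) aQ; have := sfam_add aP aQ.
by congr sfam; do 2 (apply/funext => ?); rewrite mulN1r.
Qed.

Lemma sfam_alg P q : alg true q -> sfam P -> sfam (fun k x => cofR (q x) * P k x).
Proof.
move=> aq; elim => [z0 c s ac|P1 Q1 _ h1 _ h2].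
  rewrite (_ : (fun _ => _) = (fun k x => z0 * cofR (q x * c x) * dword (map (@coordv R n) s) f (x + k))).
    by apply: sfam_base; exact: alg_mul.
  by do 2 (apply/funext => ?); rewrite cofRM !mulrA (mulrC z0).
rewrite (_ : (fun _ => _) = (fun k x => cofR (q x) * P1 k x + cofR (q x) * Q1 k x)); first exact: sfam_add.
by do 2 (apply/funext => ?); rewrite mulrDr.
Qed.

Lemma sfam_der P : sfam P -> forall i, exists2 P', sfam P' &
  forall k x, cder1 (fun s => P k (x + s *: coordv i)) (fun s => P' k (x + s *: coordv i)).
Proof.
move=> + i; elim => [z0 q s aq|P1 Q1 _ [P1' aP1 dP1] _ [Q1' aQ1 dQ1]]; last first.
  by exists (fun k x => P1' k x + Q1' k x); [exact: sfam_add|move=> k x; exact: cder1D].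
have [q' aq' dq] := alg_der i aq.
exists (fun k x => z0 * cofR (q' x) * dword (map (@coordv R n) s) f (x + k) +
                   z0 * cofR (q x) * dword (map (@coordv R n) (i :: s)) f (x + k)).
  by apply: sfam_add; exact: sfam_base.
move=> k x.
have h := smoothC_cder (coordv i) (x + k) (smoothC_dword (map (@coordv R n) s) f_schwartz.1).
have E (F : V -> C) : (fun s : R => F (x + k + s *: coordv i)) = (fun s => F (x + s *: coordv i + k)).
  by apply/funext => t; rewrite addrAC.
rewrite !E in h.
exact: (cder1M (cder1Z z0 (cder1_cofR (dq x))) h).
Qed.

(** The decay of [f] is centred at [-k] in the variable [x]; Peetre's inequality recentres it at the
    price of a constant depending on [k]. This is harmless, as the bound is used only
    qualitatively. *)
Lemma sfam_bounded P : sfam P -> forall k, exists K : R, forall x, cabs (P k x) <= K * wt x.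
Proof.
move=> + k; elim => [z0 q s aq|P1 Q1 _ [K HK] _ [L HL]]; last first.
  by exists (K + L) => x; rewrite (le_trans (cabsD _ _))// mulrDl lerD.
have [K K0 [m HK]] := alg_growth aq.
(* [m] copies of the inverse weight compensate the growth of [q], and one more leaves a factor
   [wt]. *)
have [L HL] := schwartz_sqpoly (flatten (nseq m.+1 (index_enum 'I_n))) s.
have pw x : sqpoly (flatten (nseq m.+1 (index_enum 'I_n))) x = (wt x)^-1 ^+ m.+1.
  elim: m.+1 => [|j IH]; first by rewrite /sqpoly big_nil.
  by rewrite /= sqpoly_cat IH sqpoly_enum exprS.
pose c := 2 ^+ n * (wt k)^-1.
have c0 : 0 <= c by rewrite mulr_ge0 ?exprn_ge0// invr_ge0 wt_ge0.
exists (cabs z0 * K * (c ^+ m.+1 * L)) => x.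
rewrite !cabsM cabs_cofR -!mulrA ler_wpM2l ?cabs_ge0//.
have h1 := HL (x + k); rewrite pw in h1.
set D := cabs _ in h1 *.
have D0 : 0 <= D by exact: cabs_ge0.
have wk := wt_gt0 (x + k); have wx := wt_gt0 x.
rewrite exprVn mulrC ler_pdivrMr ?exprn_gt0// in h1.
have L0 : 0 <= L by rewrite -(pmulr_lge0 L (exprn_gt0 m.+1 wk)) (le_trans D0).
apply: (@le_trans _ _ (K * (wt x)^-1 ^+ m * (L * (c * wt x) ^+ m.+1))).
  apply: ler_pM => //; apply: le_trans h1 _; rewrite ler_wpM2l//.
  apply: lerXn2r; [by rewrite nnegrE ltW|by rewrite nnegrE mulr_ge0// ltW|exact: wt_shift].
rewrite exprMn exprVn [wt x ^+ m.+1]exprS le_eqVlt; apply/orP; left; apply/eqP.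
by field; rewrite expf_neq0// gt_eqF.
Qed.

Lemma sfam_meas P : sfam P -> forall k, cmeas (P k).
Proof.
move=> + k; elim => [z0 q s aq|P1 Q1 _ h1 _ h2]; last exact: cmeasD.
apply: cmeasM.
  apply: cmeasM; first exact: cmeas_cst.
  by apply: cmeas_cofR; exact: measurable_alg aq.
have [cr ci] := smoothC_cont (smoothC_dword (map (@coordv R n) s) f_schwartz.1).
split; [exact: (measurableT_comp (continuous_measurable_rv cr) (measurable_rvD k))
       |exact: (measurableT_comp (continuous_measurable_rv ci) (measurable_rvD k))].
Qed.

Lemma sfam_cintg P k : sfam P -> cintg mu (P k).
Proof. by move=> sP; exact: (Dcintg sfam_bounded sfam_meas k sP). Qed.

End schwartz_class.

(** * The Fourier transform of Schwartz functions *)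

Section fourier_transform.
Context {R : realType} (n : nat).
Notation V := 'rV[R]_n.
Notation C := R[i].
Notation mu := (@rv_measure R n).

Definition FT (u : V -> C) (xi : V) : C := CI mu (fun y => u y * cexpi (dotv y (- xi))).

Lemma cintg_FT (u : V -> C) xi : cintg mu u -> cintg mu (fun y => u y * cexpi (dotv y xi)).
Proof.
move=> ui; have := cintgM_bd ui (cmeas_phase xi) (K := 1).
rewrite (_ : (fun x => cexpi _ * u x) = fun x => u x * cexpi (dotv x xi)); last first.
  by apply/funext => x; rewrite mulrC.
by apply => x; rewrite cabs_expi.
Qed.

Lemma cmeas_FT (u : V -> C) : cmeas u -> cmeas (FT u).
Proof.
move=> mu_; apply: (cmeas_CI mu (h := fun p : V * V => u p.2 * cexpi (dotv p.2 (- p.1)))).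
apply: cmeasM; first exact: (cmeas_comp mu_ measurable_snd).
apply: cmeas_expi; apply: measurable_dotv => //; apply: measurable_rv_opp; exact: measurable_fst.
Qed.

Lemma wtN (x : V) : wt (- x) = wt x.
Proof. by apply: eq_bigr => i _; rewrite mxE /wt1 sqrrN. Qed.

Variable f : V -> C.
Hypothesis f_schwartz : schwartz f.

(** [sfam f] satisfies the closure conditions of [oscillatory_decay], with [k] as the index. One
    factor [wt xi] suffices, as it already makes the transform integrable. *)
Lemma FT_decay P k : sfam f P -> exists2 K : R, 0 <= K & forall xi, cabs (FT (P k) xi) <= K * wt xi.
Proof.
move=> sP.
have [Q sQ HQ] := oscillatory_decay (@sfam_bounded _ _ _ f_schwartz) (@sfam_meas _ _ _ f_schwartz)
  (@sfam_der _ _ _ f_schwartz) (@sfam_sub _ _ f) sP.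
have iQ := sfam_cintg f_schwartz k sQ.
exists (fine (\int[mu]_x (cabs (Q k x))%:E)%E).
  by apply/fine_ge0/integral_ge0 => x _; rewrite lee_fin cabs_ge0.
move=> xi; rewrite /FT HQ cabsM cabs_cofR ger0_norm ?wt_ge0// wtN mulrC ler_wpM2r ?wt_ge0//.
rewrite -lee_fin fineK; last first.
  by rewrite ge0_fin_numE; [have [] := iQ|apply: integral_ge0 => x _; rewrite lee_fin cabs_ge0].
apply: le_trans (cabs_CI (cintg_FT _ iQ)) _.
by under eq_integral do rewrite cabsM cabs_expi mulr1.
Qed.

(** Multiplication by [-i y_i], which the transform turns into the derivative in the coordinate [i]
    of [xi]. *)
Definition coord_op (i : 'I_n) (u : V -> C) (y : V) : C := - Ci * (cofR (y 0 i) * u y).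

Lemma sfam_coord_op P i : sfam f P -> sfam f (fun k => coord_op i (P k)).
Proof. by move=> sP; apply: sfam_scale; apply: sfam_alg => //; exact: alg_x. Qed.

Lemma FT_der P k i (xi : V) : sfam f P ->
  cder1 (fun s => FT (P k) (xi + s *: coordv i))
        (fun s => FT (coord_op i (P k)) (xi + s *: coordv i)).
Proof.
move=> sP.
have sP' := sfam_coord_op i sP.
have iP := sfam_cintg f_schwartz k sP; have iP' := sfam_cintg f_schwartz k sP'.
apply: (cder1_CI (mu := mu) (h := fun s y => P k y * cexpi (dotv y (- (xi + s *: coordv i))))
  (h' := fun s y => coord_op i (P k) y * cexpi (dotv y (- (xi + s *: coordv i)))) (G := fun y => cabs (coord_op i (P k) y))).
- move=> y.
  have E s : dotv y (- (xi + s *: coordv i)) = dotv y (- xi) + s * - y 0 i.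
    by rewrite opprD -scaleNr dotvDr (dotvC y (_ *: _)) dotvZl dotv_coord mulrN mulNr.
  have := cder1Z (P k y) (cder1_expi (dotv y (- xi)) (- y 0 i)).
  congr cder1; apply/funext => s; rewrite E//.
  rewrite /coord_op (_ : cofR (- y 0 i) = - cofR (y 0 i)); first by ring.
  by apply: cplxP; rewrite ?cReN ?cImN /= ?oppr0.
- by move=> t; exact: cintg_FT.
- exact: gdom_cabs.
- by move=> t y; rewrite cabsM cabs_expi mulr1.
Qed.

End fourier_transform.

(** * Agreement with the iterated integrals of the definitions *)

Section iterated_integral.
Context {R : realType}.
Notation C := R[i].

Lemma wt_vcons n (t : R) (y : 'rV[R]_n) : wt (vcons t y) = wt1 t * wt y.
Proof.
rewrite /wt big_ord_recl vcons0; congr (_ * _).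
by apply: eq_bigr => i _; rewrite vconsS.
Qed.

(** [Rint] takes real-valued inner integrals, so integrability is arranged on every section. The
    majorant provides it: it factors along [vcons], and the induction hypothesis applies with
    constant [K * wt1 t]. *)
Lemma RintE n (h : 'rV[R]_n -> R) (K : R) : measurable_fun setT h ->
  (forall x, `|h x| <= K * wt x) -> Defs.Rint h = (\int[rv_measure n]_x h x)%R.
Proof.
elim: n h K => [|n IH] h K mh hK.
  have mhE : measurable_fun setT (EFin \o h) by apply/measurable_EFinP.
  have E := @integral_dirac _ 'rV[R]_0 0 R setT measurableT (EFin \o h) mhE.
  have -> : (\int[@rv_measure R 0]_x h x)%R = fine (\d_(0%R : 'rV[R]_0) setT * (EFin \o h) 0%R)%E.
    by rewrite /Rintegral -E.
  by rewrite diracT mul1e.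
have mv := @measurable_vcons R n.
have mF : measurable_fun setT (fun p : measurableTypeR R * 'rV[R]_n => h (vcons p.1 p.2)).
  exact: (measurableT_comp mh mv).
have K0 : 0 <= K by rewrite -(pmulr_lge0 K (wt_gt0 (0 : 'rV[R]_n.+1))) (le_trans _ (hK 0)).
have hK' t (y : 'rV[R]_n) : `|h (vcons t y)| <= K * wt1 t * wt y.
  by rewrite (le_trans (hK _))// wt_vcons mulrA.
have gw := @gdom_wt R n.
have secint t : (rv_measure n).-integrable setT (EFin \o (fun y => h (vcons t y))).
  have g : gdom (rv_measure n) (fun y : 'rV[R]_n => K * wt1 t * wt y).
    by apply: gdomZ => //; rewrite mulr_ge0// ltW// wt1_gt0.
  have := @gdom_cintg R _ _ (rv_measure n) _ (fun y => cofR (h (vcons t y))) g.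
  move=> /(_ (cmeas_cofR (measurableT_comp mh (measurable_vcons_r t)))) H.
  by apply: (cintgRe (H _)) => y; rewrite cabs_cofR.
have gw1 : gdom (@lebesgue_measure R) (fun t : measurableTypeR R => K * wt1 t).
  apply: gdomZ => //; split; first exact: measurable_wt1.
    by move=> t; rewrite ltW// wt1_gt0.
  have := @integral_wt1_fin R; rewrite ge0_fin_numE//.
  by apply: integral_ge0 => t _; rewrite lee_fin ltW// wt1_gt0.
have Fint : (prodm (@lebesgue_measure R) (rv_measure n)).-integrable setT
    (EFin \o (fun p : measurableTypeR R * 'rV[R]_n => h (vcons p.1 p.2))).
  have := @gdom_cintg R _ _ (prodm (@lebesgue_measure R) (rv_measure n)) _ (fun p => cofR (h (vcons p.1 p.2))) (gdom_prod gw1 gw).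
  move=> /(_ (cmeas_cofR mF)) H.
  by apply: (cintgRe (H _)) => p; rewrite cabs_cofR.
have -> : (\int[@rv_measure R n.+1]_x h x)%R =
    (\int[prodm (@lebesgue_measure R) (rv_measure n)]_p h (vcons p.1 p.2))%R.
  rewrite /Rintegral; congr fine.
  have mhE : measurable_fun setT (EFin \o h) by apply/measurable_EFinP.
  have := @integral_pushforward _ _ _ _ R _ mv (prodm (@lebesgue_measure R) (rv_measure n)) setT (EFin \o h) mhE.
  by rewrite preimage_setT; apply.
rewrite (Rintegral_prod1 Fint secint) /=; apply: eq_Rintegral => t _.
exact: (IH _ _ (measurableT_comp mh (measurable_vcons_r t)) (hK' t)).
Qed.

Lemma cintE n (h : 'rV[R]_n -> C) (K : R) : cmeas h ->
  (forall x, cabs (h x) <= K * wt x) -> cint h = CI (rv_measure n) h.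
Proof.
move=> [mr mi] hK; apply: cplxP => /=.
  by apply: (RintE (K := K)) => // x; rewrite (le_trans (normRe_cabs _)).
by apply: (RintE (K := K)) => // x; rewrite (le_trans (normIm_cabs _)).
Qed.

Lemma fourierE n (f : 'rV[R]_n -> C) xi : schwartz f -> fourier f xi = FT f xi.
Proof.
move=> sf.
have sP := @sfam_shift R n f.
have [K HK] := sfam_bounded sf sP 0.
have mf := sfam_meas sf sP 0.
have fE : (fun y => f (y + 0)) = f by apply/funext => y; rewrite addr0.
rewrite fE in mf.
rewrite /fourier (cintE (K := K)) /FT.
- by apply: eq_CI => y; rewrite dotvNr.
- apply: cmeasM => //; rewrite (_ : (fun y => cexpi _) = fun y => cexpi (dotv y (- xi))).
    exact: cmeas_phase.
  by apply/funext => y; rewrite dotvNr.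
- by move=> y; rewrite cabsM cabs_expi mulr1; have := HK y; rewrite addr0.
Qed.

End iterated_integral.

Lemma measurable_wtV {R : realType} n : measurable_fun setT (fun x : 'rV[R]_n => (wt x)^-1).
Proof.
rewrite (_ : (fun _ => _) = fun x : 'rV[R]_n => \prod_(i < n) (fun t : R => 1 + t ^+ 2) (x 0 i)).
  by apply: (@measurable_prod_coord R n (fun t => 1 + t ^+ 2)); apply: measurable_funD => //; exact: measurable_funX.
by apply/funext => x; rewrite -sqpoly_enum.
Qed.

(** * A weighted mean-square bound for the Fourier transform *)

Section bessel.
Context {R : realType} (n : nat).
Notation V := 'rV[R]_n.
Notation C := R[i].
Notation mu := (@rv_measure R n).

Lemma mule_le_sqr (a b : \bar R) : (0 <= a)%E -> (0 <= b)%E -> (a * b <= a * a + b * b)%E.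
Proof.
move=> a0 b0; have [ab|/ltW ba] := leP a b.
  by apply: (@le_trans _ _ (b * b)%E); [exact: lee_wpmul2r|rewrite leeDr// mule_ge0].
by apply: (@le_trans _ _ (a * a)%E); [exact: lee_wpmul2l|rewrite leeDl// mule_ge0].
Qed.

Lemma integral_wt_sub (x : V) : (\int[mu]_y (wt (x - y))%:E = \int[mu]_y (wt y)%:E)%E.
Proof.
have mw : measurable_fun setT (EFin \o @wt R n) by apply/measurable_EFinP; exact: measurable_wt.
rewrite -(ge0_integral_rvN (f := fun y => (wt (x - y))%:E)); last 2 first.
- by apply/measurable_EFinP; apply: (measurableT_comp (@measurable_wt R n)); apply: measurable_rv_add => //; exact: measurable_rvN.
- by move=> y; rewrite lee_fin wt_ge0.
rewrite -(ge0_integral_rvD x mw); last by move=> y; rewrite lee_fin wt_ge0.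
by apply: eq_integral => y _; rewrite /= opprK addrC.
Qed.

(** Schur's test in a crude form: [H1 x * H2 y] is at most the sum of the two squares, and for each
    square the kernel is integrated in the other variable, where its mass is that of [wt]. *)
Lemma schur_wt (H1 H2 : V -> \bar R) : measurable_fun setT H1 -> measurable_fun setT H2 ->
  (forall x, 0 <= H1 x)%E -> (forall x, 0 <= H2 x)%E ->
  (\int[mu]_x \int[mu]_y (H1 x * H2 y * (wt (x - y))%:E) <=
   (\int[mu]_x (wt x)%:E) * (\int[mu]_x (H1 x * H1 x) + \int[mu]_x (H2 x * H2 x)))%E.
Proof.
move=> m1 m2 h1 h2; set W := (\int[mu]_x (wt x)%:E)%E.
have W0 : (0 <= W)%E by apply: integral_ge0 => x _; rewrite lee_fin wt_ge0.
have mw : measurable_fun setT (fun p : V * V => (wt (p.1 - p.2))%:E).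
  apply/measurable_EFinP; apply: (measurableT_comp (@measurable_wt R n)).
  by apply: measurable_rv_add => //; apply: measurable_rv_opp.
have w0 (x : V) : (0 <= (wt x)%:E)%E by rewrite lee_fin wt_ge0.
have m1p : measurable_fun setT (fun p : V * V => H1 p.1) by exact: (measurableT_comp m1 measurable_fst).
have m2p : measurable_fun setT (fun p : V * V => H2 p.2) by exact: (measurableT_comp m2 measurable_snd).
have mA : measurable_fun setT (fun p : V * V => H1 p.1 * H1 p.1 * (wt (p.1 - p.2))%:E)%E.
  by apply: emeasurable_funM => //; exact: emeasurable_funM.
have mB : measurable_fun setT (fun p : V * V => H2 p.2 * H2 p.2 * (wt (p.1 - p.2))%:E)%E.
  by apply: emeasurable_funM => //; exact: emeasurable_funM.
have mL : measurable_fun setT (fun p : V * V => H1 p.1 * H2 p.2 * (wt (p.1 - p.2))%:E)%E.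
  by apply: emeasurable_funM => //; exact: emeasurable_funM.
have A0 (p : V * V) : (0 <= H1 p.1 * H1 p.1 * (wt (p.1 - p.2))%:E)%E by rewrite !mule_ge0.
have B0 (p : V * V) : (0 <= H2 p.2 * H2 p.2 * (wt (p.1 - p.2))%:E)%E by rewrite !mule_ge0.
have L0 (p : V * V) : (0 <= H1 p.1 * H2 p.2 * (wt (p.1 - p.2))%:E)%E by rewrite !mule_ge0.
have m11 : measurable_fun setT (fun x : V => H1 x * H1 x)%E by exact: emeasurable_funM.
have m22 : measurable_fun setT (fun x : V => H2 x * H2 x)%E by exact: emeasurable_funM.
have IA : (\int[mu]_x \int[mu]_y (H1 x * H1 x * (wt (x - y))%:E) = W * \int[mu]_x (H1 x * H1 x))%E.
  rewrite -ge0_integralZl//; last by move=> x _; rewrite mule_ge0.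
  apply: eq_integral => x _; rewrite ge0_integralZl//.
  - by rewrite integral_wt_sub muleC.
  - exact: (measurableT_comp mw (pair1_measurable x)).
  - by rewrite mule_ge0.
have IB : (\int[mu]_x \int[mu]_y (H2 y * H2 y * (wt (x - y))%:E) = W * \int[mu]_x (H2 x * H2 x))%E.
  rewrite (ge0_fubini mu mu mB B0) /= -ge0_integralZl//; last by move=> x _; rewrite mule_ge0.
  apply: eq_integral => y _; rewrite ge0_integralZl//.
  - have -> : (\int[mu]_x (wt (x - y))%:E = \int[mu]_x (wt (y - x))%:E)%E.
      by apply: eq_integral => x _; rewrite -wtN opprB.
    by rewrite integral_wt_sub muleC.
  - exact: (measurableT_comp mw (pair2_measurable y)).
  - by rewrite mule_ge0.
rewrite ge0_muleDr; [|by apply: integral_ge0 => x _; rewrite mule_ge0..].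
rewrite -IA -IB -ge0_integralD//; last 4 first.
- by move=> x _; apply: integral_ge0 => y _; exact: (A0 (x, y)).
- exact: (measurable_int_section mu mA A0).
- by move=> x _; apply: integral_ge0 => y _; exact: (B0 (x, y)).
- exact: (measurable_int_section mu mB B0).
apply: ge0_le_integral => //.
- by move=> x _; apply: integral_ge0 => y _; exact: (L0 (x, y)).
- exact: (measurable_int_section mu mL L0).
- by apply: emeasurable_funD; [exact: (measurable_int_section mu mA A0)|exact: (measurable_int_section mu mB B0)].
move=> x _; rewrite -ge0_integralD//; last 4 first.
- by move=> y _; exact: (A0 (x, y)).
- exact: (measurableT_comp mA (pair1_measurable x)).
- by move=> y _; exact: (B0 (x, y)).
- exact: (measurableT_comp mB (pair1_measurable x)).
apply: ge0_le_integral => //.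
- by move=> y _; exact: (L0 (x, y)).
- exact: (measurableT_comp mL (pair1_measurable x)).
- by apply: emeasurable_funD; [exact: (measurableT_comp mA (pair1_measurable x))|exact: (measurableT_comp mB (pair1_measurable x))].
move=> y _; rewrite -ge0_muleDl ?mule_ge0//.
by apply: lee_wpmul2r => //; exact: mule_le_sqr.
Qed.

Lemma Wc_sub N (c e : V -> R) : Wc N c -> Wc N e -> Wc N (fun x => c x - e x).
Proof.
move=> [q aq ->] [p ap ->]; exists (fun x => q x + (-1) * p x).
  by apply: alg_add => //; apply: alg_mul => //; exact: alg_cst.
by apply/funext => x; ring.
Qed.

(** The kernel of [T T^*] when the amplitude is [wt] itself. [Wc 1] contains [wt ^+ 2] and is stable
    under derivatives and differences, so [oscillatory_decay] applies; the index is trivial here. *)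
Lemma fourier_wt_sqr : exists2 c : V -> R, Wc 1 c & forall tau,
  CI mu (fun x => cofR (wt x) * conjc (cofR (wt x)) * cexpi (dotv x tau)) =
  cofR (wt tau) * CI mu (fun x => cofR (c x) * cexpi (dotv x tau)).
Proof.
pose D (P : unit -> V -> C) := exists2 c, Wc 1 c & P = (fun _ x => cofR (c x)).
have Dbd P : D P -> forall j, exists K : R, forall x, cabs (P j x) <= K * wt x.
  move=> [c Wcc ->] j; have [K _ HK] := Wc_bounded Wcc; exists K => x.
  by rewrite cabs_cofR (le_trans (HK x)).
have Dmeas P : D P -> forall j, cmeas (P j).
  by move=> [c Wcc ->] j; apply: cmeas_cofR; exact: measurable_Wc Wcc.
have Dder P : D P -> forall i : 'I_n, exists2 P', D P' &
    forall j x, cder1 (fun s => P j (x + s *: coordv i)) (fun s => P' j (x + s *: coordv i)).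
  move=> [c Wcc ->] i; have [c' Wc' dc] := Wc_der i Wcc.
  exists (fun _ x => cofR (c' x)); first by exists c'.
  by move=> j x; apply: cder1_cofR; exact: dc.
have DB P Q : D P -> D Q -> D (fun j x => P j x - Q j x).
  move=> [c Wcc ->] [e Wce ->]; exists (fun x => c x - e x); first exact: Wc_sub.
  do 2 (apply/funext => ?); by apply: cplxP; rewrite ?cReD ?cImD ?cReN ?cImN /= ?oppr0 ?addr0.
have D0 : D (fun _ x => cofR (wt x ^+ 2)).
  by exists (fun x => wt x ^+ 2) => //; apply: Wc_weak; exact: Wc_wtX.
have [_ [c Wcc ->] H] := oscillatory_decay Dbd Dmeas Dder DB D0.
exists c => // tau; rewrite -(H tt); apply: eq_CI => x.
by congr (_ * _); rewrite mul_conjc cabs_cofR real_normK ?num_real.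
Qed.

Lemma young_weight (s t l : R) : 0 < l -> s * t <= l * s ^+ 2 + l^-1 * t ^+ 2.
Proof.
move=> l0; have := sqr_ge0 (l * s - t); rewrite sqrrB => h.
have h2 : 0 <= l * s ^+ 2 - s * t *+ 2 + l^-1 * t ^+ 2.
  rewrite (_ : _ + _ = l^-1 * ((l * s) ^+ 2 - l * s * t *+ 2 + t ^+ 2)); last by field; rewrite gt_eqF.
  by rewrite mulr_ge0// invr_ge0 ltW.
have h3 : 0 <= l * s ^+ 2 + l^-1 * t ^+ 2.
  by rewrite addr_ge0// mulr_ge0 ?sqr_ge0 ?invr_ge0 ?(ltW l0).
move: h2 h3; rewrite mulr2n; lra.
Qed.

(* Duality replaces Plancherel: [||FT u||^2 = <u, G>] with [G] the inverse transform of
   [FT u], and [wt * G] is controlled by [FT u] through the [T T^*] estimate. *)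
Lemma bessel : exists2 K : R, 0 <= K & forall (u : V -> C) (L L' : R), cmeas u ->
  (forall y, cabs (u y) <= L * wt y) -> (forall xi, cabs (FT u xi) <= L' * wt xi) ->
  (\int[mu]_xi (cabs (FT u xi) ^+ 2)%:E <=
   K%:E * \int[mu]_y ((cabs (u y) * (wt y)^-1) ^+ 2)%:E)%E.
Proof.
have [c Wcc Hc] := fourier_wt_sqr.
have [mw w0 woo] := @gdom_wt R n.
have [Kc Kc0 HKc] := Wc_bounded Wcc.
have gc : gdom mu (fun x => Kc * wt x) by apply: gdomZ => //; exact: gdom_wt.
have mc := measurable_Wc Wcc.
have ic : cintg mu (fun x => cofR (c x)).
  by apply: (gdom_cintg gc); [exact: cmeas_cofR|move=> x; rewrite cabs_cofR (le_trans (HKc x))].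
pose W := fine (\int[mu]_x (wt x)%:E)%E.
have WE : (\int[mu]_x (wt x)%:E)%E = W%:E.
  by rewrite fineK// ge0_fin_numE//; apply: integral_ge0 => x _; rewrite lee_fin.
pose I := fine (\int[mu]_x (cabs (cofR (c x)))%:E)%E.
have IE : (\int[mu]_x (cabs (cofR (c x)))%:E)%E = I%:E.
  by rewrite fineK// ge0_fin_numE; [have [] := ic|apply: integral_ge0 => x _; rewrite lee_fin cabs_ge0].
have W0 : 0 <= W by rewrite fine_ge0//; apply: integral_ge0 => x _; rewrite lee_fin.
have I0 : 0 <= I by rewrite fine_ge0//; apply: integral_ge0 => x _; rewrite lee_fin cabs_ge0.
(* Chosen so that [l^-1 * (I * W)] times [A + A] is at most half of [A]; the summand [1] keeps [l]
   positive. *)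
pose l : R := 4 * (I * W) + 1.
have l0 : 0 < l by rewrite ltr_wpDl// !mulr_ge0.
exists (2 * l); first by rewrite mulr_ge0// ltW.
move=> u L L' mu_ uL uL'.
have L'0 : 0 <= L' by rewrite -(pmulr_lge0 L' (wt_gt0 (0 : V))) (le_trans _ (uL' 0))// cabs_ge0.
have L0 : 0 <= L by rewrite -(pmulr_lge0 L (wt_gt0 (0 : V))) (le_trans _ (uL 0))// cabs_ge0.
have gL : gdom mu (fun y : V => L * wt y) by apply: gdomZ => //; exact: gdom_wt.
have gL' : gdom mu (fun y : V => L' * wt y) by apply: gdomZ => //; exact: gdom_wt.
have mU := cmeas_FT mu_.
set U := FT u.
set A := (\int[mu]_xi _)%E.
set B := (\int[mu]_y _)%E.
have mU2 : measurable_fun setT (fun xi => (cabs (U xi) ^+ 2)%:E).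
  by apply/measurable_EFinP; apply: measurable_funX; exact: cmeas_cabs.
have A0 : (0 <= A)%E by apply: integral_ge0 => x _; rewrite lee_fin sqr_ge0.
(* Finiteness of [A] allows half of it to be subtracted at the end. It rests on the majorant
   [L' * wt], whose constant does not enter the conclusion. *)
have Afin : A \is a fin_num.
  have [mg g0 goo] := gdomZ (sqr_ge0 L') (gdom_wt n).
  rewrite ge0_fin_numE//; apply: le_lt_trans goo; apply: ge0_le_integral => //.
  - by move=> x _; rewrite lee_fin sqr_ge0.
  - exact/measurable_EFinP.
  - move=> x _; rewrite lee_fin (@le_trans _ _ ((L' * wt x) ^+ 2))//.
      by rewrite ler_sqr ?nnegrE ?cabs_ge0 ?mulr_ge0.
    by rewrite exprMn ler_wpM2l ?sqr_ge0// expr2 ler_piMl ?wt_le1.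
(* Here the factor [wt y] is already part of [G]. *)
pose G y := CI mu (fun xi => cofR (wt y) * cexpi (dotv y xi) * U xi).
have mG : cmeas G.
  apply: (cmeas_CI mu (h := fun p : V * V => cofR (wt p.1) * cexpi (dotv p.1 p.2) * U p.2)).
  apply: cmeasM; last exact: (cmeas_comp mU measurable_snd).
  apply: cmeasM; first by apply: cmeas_cofR; exact: (measurableT_comp mw measurable_fst).
  by apply: cmeas_expi; apply: measurable_dotv.
have GA : (\int[mu]_y (cabs (G y) ^+ 2)%:E <= (I * W)%:E * (A + A))%E.
  have mid : measurable_fun setT (@id V) by [].
  have := @tt_star R n _ V mu id mid (fun x _ => cofR (wt x)) (fun _ x => cofR (c x)) U
    (fun x => L' * wt x) 1.
  move=> H; apply: le_trans (H _ _ _ _ _ mU gL' uL') _ => {H}.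
  - by apply: cmeas_cofR; exact: (measurableT_comp mw measurable_fst).
  - by move=> x _; rewrite cabs_cofR mul1r ger0_norm.
  - by apply: cmeas_cofR; exact: (measurableT_comp mc measurable_snd).
  - by [].
  - by move=> p; exact: Hc.
  under eq_integral do rewrite IE.
  have mUU : measurable_fun setT (fun p : V * V => (cabs (U p.1) * cabs (U p.2) * wt (p.1 - p.2))%:E).
    have mcU := cmeas_cabs mU.
    apply/measurable_EFinP; apply: measurable_funM.
      by apply: measurable_funM; [exact: (measurableT_comp mcU measurable_fst)|exact: (measurableT_comp mcU measurable_snd)].
    apply: (measurableT_comp mw); apply: measurable_rv_add => //.
    by apply: measurable_rv_opp.
  have UU0 (p : V * V) : (0 <= (cabs (U p.1) * cabs (U p.2) * wt (p.1 - p.2))%:E)%E.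
    by rewrite lee_fin !mulr_ge0 ?cabs_ge0.
  rewrite ge0_integralZr// (@fubini_tonelli1 _ _ _ _ R mu mu _ mUU UU0) /fubini_F /=.
  rewrite muleC EFinM -muleA; apply: lee_wpmul2l; first by rewrite lee_fin.
  have mcU : measurable_fun setT (fun xi => (cabs (U xi))%:E).
    by apply/measurable_EFinP; exact: cmeas_cabs.
  have U0 xi : (0 <= (cabs (U xi))%:E)%E by rewrite lee_fin cabs_ge0.
  by have := schur_wt mcU mcU U0 U0; rewrite WE.
(* One of the two factors [U] is unfolded as a transform and the integrals are exchanged, which
   pairs [u] with the inverse transform of [U]. *)
have AE : A%E = (cRe (CI mu (fun y => conjc (u y) * CI mu (fun xi => cexpi (dotv y xi) * U xi))))%:E.
  have iUU : cintg mu (fun xi => U xi * conjc (U xi)).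
    apply: (gdom_cintg (gdomZ (sqr_ge0 L') (gdom_wt n))).
      by apply: cmeasM => //; exact: cmeasJ.
    move=> xi; rewrite cabsM cabsJ -expr2 (@le_trans _ _ ((L' * wt xi) ^+ 2))//.
      by rewrite ler_sqr ?nnegrE ?cabs_ge0 ?mulr_ge0.
    by rewrite exprMn ler_wpM2l ?sqr_ge0// expr2 ler_piMl ?wt_le1.
  rewrite /A integral_cabs_sqr//; congr (cRe _)%:E.
  pose h (p : V * V) := conjc (u p.2) * (cexpi (dotv p.2 p.1) * U p.1).
  have iu : cintg mu u by exact: gdom_cintg gL mu_ uL.
  transitivity (CI mu (fun xi => CI mu (fun y => h (xi, y)))).
    apply: eq_CI => xi; rewrite {2}/U /FT -CIJ; last exact: cintg_FT.
    rewrite -CIZ; last by apply: cintgJ; exact: cintg_FT.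
    apply: eq_CI => y; rewrite /h conj_mul conj_cexpi dotvNr opprK.
    by rewrite mulrC -mulrA.
  rewrite (CI_swap (h := h) _ gL' gL).
  - apply: eq_CI => y; rewrite /h /= CIZ//.
    have iU : cintg mu U by exact: gdom_cintg gL' mU uL'.
    by have := cintg_FT y iU; congr (cintg _ _); apply/funext => xi; rewrite mulrC dotvC.
  - apply: cmeasM; first by apply: cmeasJ; exact: (cmeas_comp mu_ measurable_snd).
    apply: cmeasM; last exact: (cmeas_comp mU measurable_fst).
    by apply: cmeas_expi; apply: measurable_dotv.
  - move=> x y; rewrite /h !cabsM cabsJ cabs_expi mul1r mulrC.
    by apply: ler_pM; rewrite ?cabs_ge0.
have mB : measurable_fun setT (fun y => ((cabs (u y) * (wt y)^-1) ^+ 2)%:E).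
  apply/measurable_EFinP; apply: measurable_funX; apply: measurable_funM; first exact: cmeas_cabs.
  exact: measurable_wtV.
have mG2 : measurable_fun setT (fun y => (cabs (G y) ^+ 2)%:E).
  by apply/measurable_EFinP; apply: measurable_funX; exact: cmeas_cabs.
have B0 : (0 <= B)%E by apply: integral_ge0 => y _; rewrite lee_fin sqr_ge0.
have AB : (A <= l%:E * B + l^-1%:E * ((I * W)%:E * (A + A)))%E.
  pose h y := conjc (u y) * CI mu (fun xi => cexpi (dotv y xi) * U xi).
  have GE y : G y = cofR (wt y) * CI mu (fun xi => cexpi (dotv y xi) * U xi).
    rewrite /G -CIZ; first by apply: eq_CI => xi; rewrite mulrA.
    have iU : cintg mu U by exact: gdom_cintg gL' mU uL'.
    by have := cintg_FT y iU; congr (cintg _ _); apply/funext => xi; rewrite mulrC dotvC.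
  (* The weight contained in [G] is compensated by [(wt y)^-1] next to [u]: this is the weight lost
     in the statement. *)
  have hG y : cabs (h y) = (cabs (u y) * (wt y)^-1) * cabs (G y).
    rewrite GE !cabsM cabsJ cabs_cofR ger0_norm// mulrA; congr (_ * _).
    by rewrite mulfVK// gt_eqF ?wt_gt0.
  have mh : cmeas h.
    apply: cmeasM; first exact: cmeasJ.
    apply: (cmeas_CI mu (h := fun p : V * V => cexpi (dotv p.1 p.2) * U p.2)).
    apply: cmeasM; last exact: (cmeas_comp mU measurable_snd).
    by apply: cmeas_expi; apply: measurable_dotv.
  have ih : cintg mu h.
    have iU : cintg mu U by exact: gdom_cintg gL' mU uL'.
    pose h2 (p : V * V) := conjc (u p.1) * (cexpi (dotv p.1 p.2) * U p.2).
    have mh2 : cmeas h2.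
      apply: cmeasM; first by apply: cmeasJ; exact: (cmeas_comp mu_ measurable_fst).
      apply: cmeasM; last exact: (cmeas_comp mU measurable_snd).
      by apply: cmeas_expi; apply: measurable_dotv.
    have := cintg_CI mh2 gL gL'; rewrite /h2 /=.
    rewrite (_ : (fun x => CI _ _) = h); first apply.
      by move=> x y; rewrite !cabsM cabsJ cabs_expi mul1r; apply: ler_pM; rewrite ?cabs_ge0.
    apply/funext => y; rewrite /h -CIZ//.
    by have := cintg_FT y iU; congr (cintg _ _); apply/funext => xi; rewrite mulrC dotvC.
  have young : (\int[mu]_y (cabs (h y))%:E <= l%:E * B + l^-1%:E * \int[mu]_y (cabs (G y) ^+ 2)%:E)%E.
    have lE : (0 <= l%:E)%E by rewrite lee_fin ltW.
    have lVE : (0 <= l^-1%:E)%E by rewrite lee_fin invr_ge0 ltW.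
    have b0 y : setT y -> (0 <= ((cabs (u y) * (wt y)^-1) ^+ 2)%:E)%E by rewrite lee_fin sqr_ge0.
    have g0 y : setT y -> (0 <= (cabs (G y) ^+ 2)%:E)%E by rewrite lee_fin sqr_ge0.
    rewrite -(ge0_integralZl mu measurableT mB b0 lE) -(ge0_integralZl mu measurableT mG2 g0 lVE).
    rewrite -ge0_integralD//; last 4 first.
    - by move=> y _; rewrite mule_ge0// b0.
    - exact: emeasurable_funM.
    - by move=> y _; rewrite mule_ge0// g0.
    - exact: emeasurable_funM.
    apply: ge0_le_integral => //.
    - by move=> y _; rewrite lee_fin cabs_ge0.
    - by apply/measurable_EFinP; exact: cmeas_cabs.
    - by apply: emeasurable_funD; exact: emeasurable_funM.
    by move=> y _; rewrite hG -!EFinM -EFinD lee_fin; exact: young_weight.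
  rewrite {1}AE; apply: (@le_trans _ _ (cabs (CI mu h))%:E).
    by rewrite lee_fin (le_trans (ler_norm _))// normRe_cabs.
  apply: le_trans (cabs_CI ih) _; apply: le_trans young _.
  apply: leeD => //; apply: lee_wpmul2l => //.
  by rewrite lee_fin invr_ge0 ltW.
(* An infinite right-hand side is disposed of before passing to real numbers. *)
have [Binf|Bfin] := eqVneq B +oo%E.
  by rewrite Binf mulry gtr0_sg ?mul1e ?leey// mulr_gt0.
have BE : B = (fine B)%:E by rewrite fineK// ge0_fin_numE// lt_neqAle Bfin leey.
move: AB; rewrite -(fineK Afin) BE -!(EFinD, EFinM) !lee_fin.
have fA : 0 <= fine A by exact: fine_ge0.
move: (fine A) (fine B) fA => x y x0 H.
have h1 : l^-1 * (I * W * (x + x)) <= x / 2.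
  rewrite mulrC ler_pdivrMr// /l.
  have IW : 0 <= I * W by rewrite mulr_ge0.
  by move: (I * W) IW => v v0; nra.
have {}H : x <= l * y + x / 2 by apply: le_trans H _; rewrite lerD2l.
by rewrite -mulrA; move: (l * y) H => ly; lra.
Qed.

End bessel.

(** * Localisation of the operator *)

Lemma cder1_ext {R : realType} (phi phi' psi psi' : R -> R[i]) :
  cder1 phi phi' -> psi =1 phi -> psi' =1 phi' -> cder1 psi psi'.
Proof. by move=> + /funext -> /funext ->. Qed.

Section localisation.
Context {R : realType} (n : nat).
Notation V := 'rV[R]_n.
Notation C := R[i].
Notation mu := (@rv_measure R n).
Notation mu2 := (prodm (@rv_measure R n) (@rv_measure R n)).
Variables (rho : R) (a : V -> V -> V -> C).
Hypothesis rho_gt0 : 0 < rho.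
Hypothesis a_symbol : symbol_class 0 rho 0 a.
Notation amp := (amp a).

Definition phase2 (x : V) (z : V * V) : C := cexpi (dotv x (z.1 + z.2)).

Lemma cmeas_phase2 x : cmeas (phase2 x).
Proof.
apply: cmeas_expi; apply: measurable_dotv; first exact: measurable_cst.
by apply: measurable_rv_add.
Qed.

Lemma cmeas_ampz N P k x : amp N P -> cmeas (P k x).
Proof.
move=> aP; rewrite (_ : P k x = fun z => P k x (z.1, z.2)); last by apply/funext => -[].
by apply: (measurable_amp a_symbol aP).
Qed.

Lemma cintg_amp N P k x (U : V * V -> C) : amp N P -> cintg mu2 U ->
  cintg mu2 (fun z => P k x z * phase2 x z * U z).
Proof.
move=> aP iU; have [K K0 HK] := amp_bounded rho_gt0 a_symbol aP.
apply: (cintgM_bd iU (K := K * wt x ^+ N)).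
  by apply: cmeasM; [exact: cmeas_ampz aP|exact: cmeas_phase2].
by move=> z; rewrite cabsM cabs_expi mulr1.
Qed.

Section direction.
Variables (w : V * V) (i : 'I_n).
Hypothesis w_coord : forall x : V, dotv x (w.1 + w.2) = x 0 i.
Hypothesis amp_dw : forall N P, amp N P -> exists2 P', amp N P' &
  forall k x z, cder1 (fun s => P k x (sh2 w s z)) (fun s => P' k x (sh2 w s z)).

(** The phase depends on the sum of the frequencies, so a derivative along either of them brings
    down the same coordinate of [x], paid for with one factor of the weight. *)
Lemma amp_phase_der N P : amp N.+1 P -> exists2 P', amp N P' & forall k x z,
  cder1 (fun s => P k x (sh2 w s z) * phase2 x (sh2 w s z))
        (fun s => P' k x (sh2 w s z) * phase2 x (sh2 w s z)).
Proof.
move=> aP; have [P1 aP1 dP] := amp_dw aP.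
exists (fun (k x : V) (z : V * V) => P1 k x z + Ci * (cofR (x 0 i) * P k x z)).
  by apply: amp_add; [exact: amp_weak|apply: amp_scale; exact: amp_coord].
move=> k x z.
have E s : phase2 x (sh2 w s z) = cexpi (dotv x (z.1 + z.2) + s * x 0 i).
  by rewrite /phase2 /sh2 /= addrACA -scalerDr (dotvDr (z.1 + z.2) (s *: (w.1 + w.2)) x) (dotvC x (_ *: _)) dotvZl (dotvC (w.1 + w.2)) w_coord.
have de : cder1 (fun s => phase2 x (sh2 w s z)) (fun s => Ci * cofR (x 0 i) * phase2 x (sh2 w s z)).
  by have := cder1_expi (dotv x (z.1 + z.2)) (x 0 i); congr cder1; apply/funext => s; rewrite E.
have := cder1M (dP k x z) de; congr cder1; apply/funext => s.
by rewrite mulrDl; congr (_ + _); ring.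
Qed.

(* The third derivative of the amplitude is spent only on the continuity of the second. *)
Lemma amp_ibp N P : amp N.+3 P -> exists2 P', amp N P' & forall k x (U U1 U2 U3 : V * V -> C),
  cintg mu2 U -> cintg mu2 U1 -> cintg mu2 U2 ->
  (forall z, cder1 (fun s => U (sh2 w s z)) (fun s => U1 (sh2 w s z))) ->
  (forall z, cder1 (fun s => U1 (sh2 w s z)) (fun s => U2 (sh2 w s z))) ->
  (forall z, cder1 (fun s => U2 (sh2 w s z)) (fun s => U3 (sh2 w s z))) ->
  CI mu2 (fun z => P k x z * phase2 x z * (U z - U2 z)) =
  CI mu2 (fun z => P' k x z * phase2 x z * U z).
Proof.
move=> aP; have [P1 aP1 d1] := amp_phase_der aP; have [P2 aP2 d2] := amp_phase_der aP1.
have [P3 aP3 d3] := amp_phase_der aP2.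
exists (fun (k x : V) (z : V * V) => P k x z - P2 k x z).
  apply: amp_sub; last exact: amp_weak.
  by do 3 apply: amp_weak.
move=> k x U U1 U2 U3 iU iU1 iU2 dU dU1 dU2.
have sw (A B : V * V -> C) : cintg mu2 (fun z => A z * B z) -> cintg mu2 (fun z => B z * A z).
  by congr (cintg _ _); apply/funext => z; rewrite mulrC.
have H1 := flow_IBP (measurable_sh2 w) (@sh2_0 _ _ w) (@sh2_inv _ _ w)
  (f := U1) (f' := U2) (g := fun z => P k x z * phase2 x z) (g' := fun z => P1 k x z * phase2 x z)
  dU1 (d1 k x) (fun z => cder1_cont (dU2 z)) (fun z => cder1_cont (d2 k x z))
  (sw _ _ (cintg_amp k x aP iU1)) (sw _ _ (cintg_amp k x aP iU2)) (sw _ _ (cintg_amp k x aP1 iU1)).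
have H2 := flow_IBP (measurable_sh2 w) (@sh2_0 _ _ w) (@sh2_inv _ _ w)
  (f := U) (f' := U1) (g := fun z => P1 k x z * phase2 x z) (g' := fun z => P2 k x z * phase2 x z)
  dU (d2 k x) (fun z => cder1_cont (dU1 z)) (fun z => cder1_cont (d3 k x z))
  (sw _ _ (cintg_amp k x aP1 iU)) (sw _ _ (cintg_amp k x aP1 iU1)) (sw _ _ (cintg_amp k x aP2 iU)).
have E1 : (fun z => P k x z * phase2 x z * (U z - U2 z)) =
    (fun z => P k x z * phase2 x z * U z - P k x z * phase2 x z * U2 z).
  by apply/funext => z; rewrite mulrBr.
have E2 : (fun z => (P k x z - P2 k x z) * phase2 x z * U z) =
    (fun z => P k x z * phase2 x z * U z - P2 k x z * phase2 x z * U z).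
  by apply/funext => z; rewrite !mulrBl.
have i0 := cintg_amp k x aP iU; have i1 := cintg_amp k x aP iU2; have i2 := cintg_amp k x aP2 iU.
rewrite E1 E2 (CIB i0 i1) (CIB i0 i2); congr (_ - _).
rewrite (eq_CI _ (g := fun z => U2 z * (P k x z * phase2 x z))); last by move=> z; rewrite mulrC.
rewrite H1 H2 opprK; apply: eq_CI => z; by rewrite mulrC.
Qed.

End direction.

Definition FT2 (u v : V -> C) (z : V * V) : C := FT u z.1 * FT v z.2.

Lemma FT2_line_xi (u v : V -> C) i z s : FT2 u v (sh2 (@coordv R n i, (0 : V)) s z) =
  FT v z.2 * FT u (z.1 + s *: coordv i).
Proof. by rewrite /FT2 /sh2 /= scaler0 addr0 mulrC. Qed.

Lemma FT2_line_eta (u v : V -> C) i z s : FT2 u v (sh2 ((0 : V), @coordv R n i) s z) =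
  FT u z.1 * FT v (z.2 + s *: coordv i).
Proof. by rewrite /FT2 /sh2 /= scaler0 addr0. Qed.

Lemma cintg_FT2 (f g : V -> C) P Q k : schwartz f -> schwartz g -> sfam f P -> sfam g Q ->
  cintg mu2 (FT2 (P k) (Q k)).
Proof.
move=> sf sg sP sQ.
have [K K0 HK] := FT_decay sf k sP; have [L L0 HL] := FT_decay sg k sQ.
apply: (gdom_cintg (gdom_prod (gdomZ K0 (gdom_wt n)) (gdomZ L0 (gdom_wt n)))).
  apply: cmeasM.
    exact: (cmeas_comp (cmeas_FT (sfam_meas sf sP k)) measurable_fst).
  exact: (cmeas_comp (cmeas_FT (sfam_meas sg sQ k)) measurable_snd).
by move=> z; rewrite cabsM; apply: ler_pM; rewrite ?cabs_ge0.
Qed.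

Lemma alg_sqpoly (s : seq 'I_n) : alg true (@sqpoly R n s).
Proof.
elim: s => [|i s IH].
  by rewrite (_ : sqpoly _ = fun=> 1); [exact: alg_cst|apply/funext => x; rewrite /sqpoly big_nil].
rewrite (_ : sqpoly _ = fun x => (1 + x 0 i * x 0 i) * sqpoly s x).
  by apply: alg_mul => //; apply: alg_add; [exact: alg_cst|apply: alg_mul; exact: alg_x].
by apply/funext => x; rewrite /sqpoly big_cons expr2.
Qed.

Lemma FT_sqr_coord (f : V -> C) P (k : V) (i : 'I_n) xi : schwartz f -> sfam f P ->
  FT (fun y : V => cofR (1 + y 0 i ^+ 2) * P k y) xi =
  FT (P k) xi - FT (coord_op i (coord_op i (P k))) xi.
Proof.
move=> sf sP.
have i1 := cintg_FT (- xi) (sfam_cintg sf k sP).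
have i2 := cintg_FT (- xi) (sfam_cintg sf k (sfam_coord_op i (sfam_coord_op i sP))).
rewrite /FT -(CIB i1 i2); apply: eq_CI => y; rewrite -mulrBl /coord_op; congr (_ * _).
rewrite (_ : cofR (1 + y 0 i ^+ 2) = 1 - (Ci * Ci) * (cofR (y 0 i) * cofR (y 0 i))); first by ring.
by apply: cplxP; rewrite ?(cReD, cImD, cReN, cImN, cReM, cImM) /=; ring.
Qed.

(** Each letter [i] of [s] stands for a factor [1 + y_i^2], which is [1 - d_i^2] on the transform
    and is moved to the amplitude by [amp_ibp], at a cost of three weights. [P'] is chosen before
    the functions, [k] and [x]. *)
Lemma amp_ibp_xi (s : seq 'I_n) N P : amp (N + 3 * size s)%N P -> exists2 P', amp N P' &
  forall (f g : V -> C) Pf Pg k x, schwartz f -> schwartz g -> sfam f Pf -> sfam g Pg ->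
  CI mu2 (fun z => P k x z * phase2 x z * FT2 (fun y => cofR (sqpoly s y) * Pf k y) (Pg k) z) =
  CI mu2 (fun z => P' k x z * phase2 x z * FT2 (Pf k) (Pg k) z).
Proof.
elim: s N P => [|i s IH] N P.
  move=> aP0; have aP : amp N P by rewrite -[X in amp X _](addn0 N).
  exists P => [//|]; move=> f g Pf Pg k x sf sg sPf sPg.
  have E : (fun y : V => cofR (sqpoly [::] y) * Pf k y) = Pf k.
    by apply/funext => y; rewrite /sqpoly big_nil cofR1 mul1r.
  by rewrite E.
move=> aP0; have aP : amp (N + 3 * size s)%N.+3 P.
  by rewrite -[X in amp X _](_ : (N + 3 * size (i :: s))%N = _)//= mulnS addnCA.
have wc (x : V) : dotv x ((@coordv R n i, (0 : V)).1 + (@coordv R n i, (0 : V)).2) = x 0 i.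
  by rewrite /= addr0 dotvC dotv_coord.
have [P1 aP1 H1] := amp_ibp wc (fun N P aP => amp_dxi a_symbol i aP) aP.
have [P2 aP2 H2] := IH _ _ aP1.
exists P2; first exact: aP2.
move=> f g Pf Pg k x sf sg sPf sPg.
rewrite -(H2 f g Pf Pg k x sf sg sPf sPg).
pose Q k y := cofR (sqpoly s y) * Pf k y.
have sQ : sfam f Q by apply: sfam_alg => //; exact: alg_sqpoly.
have sQ1 := sfam_coord_op i sQ; have sQ2 := sfam_coord_op i sQ1.
pose Q1 k := coord_op i (Q k).
pose Q2 k := coord_op i (Q1 k).
pose Q3 k := coord_op i (Q2 k).
have dQ Q' z : sfam f Q' -> cder1 (fun s => FT2 (Q' k) (Pg k) (sh2 (@coordv R n i, (0 : V)) s z))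
    (fun s => FT2 (coord_op i (Q' k)) (Pg k) (sh2 (@coordv R n i, (0 : V)) s z)).
  move=> sQ'; have h0 := FT_der sf k i z.1 sQ'; have h := cder1Z (FT (Pg k) z.2) h0.
  by apply: (cder1_ext h) => t; rewrite FT2_line_xi.
rewrite -(H1 k x (FT2 (Q k) (Pg k)) (FT2 (Q1 k) (Pg k)) (FT2 (Q2 k) (Pg k)) (FT2 (Q3 k) (Pg k))).
- apply: eq_CI => z; congr (_ * _); rewrite /FT2 -mulrBl; congr (_ * _).
  apply: etrans (FT_sqr_coord k i z.1 sf sQ); congr (FT _ _); apply/funext => y.
  by rewrite /Q /sqpoly big_cons cofRM mulrA.
- exact: (cintg_FT2 k sf sg).
- by apply: (cintg_FT2 k sf sg) => //; exact: sQ1.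
- by apply: (cintg_FT2 k sf sg) => //; exact: sQ2.
- by move=> z; exact: dQ.
- by move=> z; exact: (dQ Q1 z sQ1).
- by move=> z; exact: (dQ Q2 z sQ2).
Qed.

Lemma amp_ibp_eta (s : seq 'I_n) N P : amp (N + 3 * size s)%N P -> exists2 P', amp N P' &
  forall (f g : V -> C) Pf Pg k x, schwartz f -> schwartz g -> sfam f Pf -> sfam g Pg ->
  CI mu2 (fun z => P k x z * phase2 x z * FT2 (Pf k) (fun y => cofR (sqpoly s y) * Pg k y) z) =
  CI mu2 (fun z => P' k x z * phase2 x z * FT2 (Pf k) (Pg k) z).
Proof.
elim: s N P => [|i s IH] N P.
  move=> aP0; have aP : amp N P by rewrite -[X in amp X _](addn0 N).
  exists P => [//|]; move=> f g Pf Pg k x sf sg sPf sPg.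
  have E : (fun y : V => cofR (sqpoly [::] y) * Pg k y) = Pg k.
    by apply/funext => y; rewrite /sqpoly big_nil cofR1 mul1r.
  by rewrite E.
move=> aP0; have aP : amp (N + 3 * size s)%N.+3 P.
  by rewrite -[X in amp X _](_ : (N + 3 * size (i :: s))%N = _)//= mulnS addnCA.
have wc (x : V) : dotv x (((0 : V), @coordv R n i).1 + ((0 : V), @coordv R n i).2) = x 0 i.
  by rewrite /= add0r dotvC dotv_coord.
have [P1 aP1 H1] := amp_ibp wc (fun N P aP => amp_deta a_symbol i aP) aP.
have [P2 aP2 H2] := IH _ _ aP1.
exists P2; first exact: aP2.
move=> f g Pf Pg k x sf sg sPf sPg.
rewrite -(H2 f g Pf Pg k x sf sg sPf sPg).
pose Q k y := cofR (sqpoly s y) * Pg k y.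
have sQ : sfam g Q by apply: sfam_alg => //; exact: alg_sqpoly.
have sQ1 := sfam_coord_op i sQ; have sQ2 := sfam_coord_op i sQ1.
pose Q1 k := coord_op i (Q k).
pose Q2 k := coord_op i (Q1 k).
pose Q3 k := coord_op i (Q2 k).
have dQ Q' z : sfam g Q' -> cder1 (fun s => FT2 (Pf k) (Q' k) (sh2 ((0 : V), @coordv R n i) s z))
    (fun s => FT2 (Pf k) (coord_op i (Q' k)) (sh2 ((0 : V), @coordv R n i) s z)).
  move=> sQ'; have h0 := FT_der sg k i z.2 sQ'; have h := cder1Z (FT (Pf k) z.1) h0.
  by apply: (cder1_ext h) => t; rewrite FT2_line_eta.
rewrite -(H1 k x (FT2 (Pf k) (Q k)) (FT2 (Pf k) (Q1 k)) (FT2 (Pf k) (Q2 k)) (FT2 (Pf k) (Q3 k))).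
- apply: eq_CI => z; congr (_ * _); rewrite /FT2 -mulrBr; congr (_ * _).
  apply: etrans (FT_sqr_coord k i z.2 sg sQ); congr (FT _ _); apply/funext => y.
  by rewrite /Q /sqpoly big_cons cofRM mulrA.
- exact: (cintg_FT2 k sf sg).
- by apply: (cintg_FT2 k sf sg) => //; exact: sQ1.
- by apply: (cintg_FT2 k sf sg) => //; exact: sQ2.
- by move=> z; exact: dQ.
- by move=> z; exact: (dQ Q1 z sQ1).
- by move=> z; exact: (dQ Q2 z sQ2).
Qed.

(** [a] is bounded and both transforms decay like [wt], so the integral converges absolutely on the
    product and for every fixed [xi]; the iterated integral of the definition is therefore one
    integral over pairs. *)
Lemma TbilE (f g : V -> C) x : schwartz f -> schwartz g ->
  Tbil a f g x = CI mu2 (fun z => da a [::] [::] [::] (x, z.1, z.2) * phase2 x z * FT2 f g z).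
Proof.
move=> sf sg.
have f0 (h : V -> C) : (fun y => h (y + 0)) = h by apply/funext => y; rewrite addr0.
have [K K0 HK] := FT_decay sf 0 (@sfam_shift R n f); have [L L0 HL] := FT_decay sg 0 (@sfam_shift R n g).
have mf := cmeas_FT (sfam_meas sf (@sfam_shift R n f) 0); have mg := cmeas_FT (sfam_meas sg (@sfam_shift R n g) 0).
rewrite f0 in HK mf; rewrite f0 in HL mg.
have [M M0 HM] := da_bounded rho_gt0 a_symbol [::] [::] [::].
pose h (z : V * V) := da a [::] [::] [::] (x, z.1, z.2) * phase2 x z * FT2 f g z.
have mda : cmeas (fun z : V * V => da a [::] [::] [::] (x, z.1, z.2)).
  apply: (cmeas_comp (cmeas_da a_symbol [::] [::] [::])).
  by apply: measurable_fun_pair => //; apply: measurable_fun_pair.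
have mh : cmeas h.
  apply: cmeasM; first by apply: cmeasM => //; exact: cmeas_phase2.
  by apply: cmeasM; [exact: (cmeas_comp mf measurable_fst)|exact: (cmeas_comp mg measurable_snd)].
have gK : gdom mu (fun y : V => M * K * wt y) by apply: gdomZ; [exact: mulr_ge0|exact: gdom_wt].
have gL : gdom mu (fun y : V => L * wt y) by apply: gdomZ => //; exact: gdom_wt.
have bh xi eta : cabs (h (xi, eta)) <= (M * K * wt xi) * (L * wt eta).
  rewrite !cabsM cabs_expi mulr1 /= mulrA -(mulrA M); apply: ler_pM; rewrite ?mulr_ge0 ?cabs_ge0//.
  by apply: ler_pM; rewrite ?cabs_ge0.
have -> : CI mu2 (fun z => da a [::] [::] [::] (x, z.1, z.2) * phase2 x z * FT2 f g z) =
    CI mu (fun xi => CI mu (fun eta => h (xi, eta))).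
  apply: (CI_prod1 (h := h)).
    by apply: (gdom_cintg (gdom_prod gK gL)) => // -[xi eta]; exact: bh.
  move=> xi; apply: (gdom_cintg (gdomZ _ gL)) (bh xi); first by have [_ /(_ xi)] := gK.
  exact: (cmeas_section1 xi mh).
have inner xi : cint (fun eta => a x xi eta * fourier f xi * fourier g eta * cexpi (dotv x (xi + eta))) =
    CI mu (fun eta => h (xi, eta)).
  have E eta : a x xi eta * fourier f xi * fourier g eta * cexpi (dotv x (xi + eta)) = h (xi, eta).
    rewrite !fourierE// /h /FT2 /phase2 /=; change (da a [::] [::] [::] (x, xi, eta)) with (a x xi eta).
    by ring.
  rewrite (_ : (fun eta => _) = fun eta => h (xi, eta)); last exact/funext.
  apply: (cintE (K := M * K * wt xi * L)); first exact: (cmeas_section1 xi mh).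
  by move=> eta; rewrite -mulrA; exact: bh.
rewrite /Tbil (_ : (fun xi => cint _) = (fun xi => CI mu (fun eta => h (xi, eta)))); last exact/funext.
apply: (cintE (K := fine (\int[mu]_y (L * wt y)%:E)%E * (M * K))); first exact: (cmeas_CI mu mh).
move=> xi; rewrite -mulrA; apply: (cabs_CI_section (G1 := fun y => M * K * wt y) mh _ gL).
  by have [_ /(_ xi)] := gK.
exact: bh.
Qed.

(* Two factors of the weight, because [bessel] loses one. *)
Definition window (f : V -> C) (k y : V) : C := cofR (wt y ^+ 2) * f (y + k).

Lemma sfam_window (f : V -> C) : sfam f (window f).
Proof.
rewrite (_ : window f = (fun k x => 1 * cofR (wt x ^+ 2) * dword (map (@coordv R n) [::]) f (x + k))).
  apply: sfam_base; rewrite (_ : (fun x => _) = fun x => wt x * wt x); last exact/funext.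
  by apply: alg_mul; exact: alg_wt.
by do 2 (apply/funext => ?); rewrite mul1r.
Qed.

Definition enum2 : seq 'I_n := index_enum 'I_n ++ index_enum 'I_n.

Lemma window_inv (f : V -> C) k : (fun y => cofR (sqpoly enum2 y) * window f k y) = (fun y => f (y + k)).
Proof.
apply/funext => y; rewrite /window mulrA -cofRM sqpoly_cat sqpoly_enum expr2 mulrACA mulVf ?gt_eqF ?wt_gt0//.
by rewrite mulr1 cofR1 mul1r.
Qed.

Lemma FT_shift (f : V -> C) k xi : schwartz f -> FT (fun y => f (y + k)) xi = cexpi (dotv k xi) * FT f xi.
Proof.
move=> sf.
have mf : cmeas f.
  by have [cr ci] := smoothC_cont sf.1; split; exact: continuous_measurable_rv.
have mfe : cmeas (fun y => f y * cexpi (dotv y (- xi))) by apply: cmeasM => //; exact: cmeas_phase.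
have iP := sfam_cintg sf k (sfam_shift f).
rewrite {2}/FT -(CI_shift k mfe) -CIZ; last first.
  have := cintgZ (cexpi (dotv k (- xi))) (cintg_FT (- xi) iP); congr (cintg _ _).
  by apply/funext => y; rewrite dotvDl cexpiD; ring.
apply: eq_CI => y; rewrite dotvDl cexpiD !dotvNr.
rewrite [RHS](_ : _ = (cexpi (dotv k xi) * cexpi (- dotv k xi)) * (f (y + k) * cexpi (- dotv y xi))); last by ring.
by rewrite -cexpiD subrr cexpi0 mul1r.
Qed.

Lemma local_representation : exists2 P, amp 1 P & exists N, forall (f g : V -> C) k x, schwartz f -> schwartz g ->
  cofR (wt x ^+ N) * Tbil a f g (x + k) =
  CI mu2 (fun z => P k x z * phase2 x z * FT2 (window f k) (window g k) z).
Proof.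
(* [enum2] lists every coordinate twice, for the inverse of [wt ^+ 2], and is used once in [xi] and
   once in [eta]. Each entry costs three weights: two derivatives, and a third that only provides
   continuity. The remaining one is what [amp_L2] requires. *)
pose N := (1 + 3 * size enum2 + 3 * size enum2)%N.
pose P0 (k x : V) (z : V * V) := 1 * cofR (wt x ^+ N) * da a [::] [::] [::] (x + k, z.1, z.2).
have aP0 : amp N P0 by apply: amp_base; exact: Wc_wtX.
have [P1 aP1 H1] := amp_ibp_xi aP0; have [P2 aP2 H2] := amp_ibp_eta aP1.
exists P2; first exact: aP2.
exists N => f g k x sf sg.
have s1 := sfam_window f; have s2 := sfam_window g.
have s3 : sfam g (fun k y : V => cofR (sqpoly enum2 y) * window g k y).
  by apply: sfam_alg => //; exact: alg_sqpoly.
rewrite -(H2 f g _ _ k x sf sg s1 s2) -(H1 f g _ _ k x sf sg s1 s3) !window_inv.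
rewrite TbilE// -CIZ; last first.
  have ap : amp 0 (fun (k x : V) (z : V * V) => 1 * cofR 1 * da a [::] [::] [::] (x + k, z.1, z.2)).
    by apply: amp_base; exists (fun=> 1); [exact: alg_cst|apply/funext => y; rewrite expr0 mul1r].
  have f0 (h : V -> C) : (fun y => h (y + 0)) = h by apply/funext => y; rewrite addr0.
  have := cintg_amp 0 (x + k) ap (cintg_FT2 0 sf sg (sfam_shift f) (sfam_shift g)).
  by rewrite !f0; congr (cintg _ _); apply/funext => z; rewrite cofR1 !mul1r addr0.
(* Translating [f] and [g] by [k] multiplies the transforms by the phases of [k] at [xi] and at
   [eta], which complete the phase at [x] to the phase at [x + k]. *)
apply: eq_CI => z; rewrite /FT2 !FT_shift// /P0 /phase2 dotvDl (dotvDr _ _ k) !cexpiD.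
by ring.
Qed.

End localisation.

Lemma poweR2 {R : realType} (x : \bar R) : (0 <= x)%E -> (x `^ 2 = x * x)%E.
Proof.
case: x => [r| |//] r0; last by rewrite poweRyr// mulyy.
by rewrite poweR_EFin -EFinM powR_mulrn// expr2.
Qed.

Lemma cauchy_schwarz {R : realType} d (T : measurableType d) (m : {measure set T -> \bar R})
    (f g : T -> R) : measurable_fun setT f -> measurable_fun setT g ->
  (forall x, 0 <= f x) -> (forall x, 0 <= g x) ->
  ((\int[m]_x (f x * g x)%:E) * (\int[m]_x (f x * g x)%:E) <=
   (\int[m]_x (f x ^+ 2)%:E) * (\int[m]_x (g x ^+ 2)%:E))%E.
Proof.
move=> mf mg f0 g0.
have half2 : (2^-1 + 2^-1 = 1 :> R)%R by field.
have h := hoelder m mf mg (ltr0Sn _ 1) (ltr0Sn _ 1) half2.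
have E1 : ('N[m]_1[EFin \o (f \* g)%R] = \int[m]_x (f x * g x)%:E)%E.
  by rewrite Lnorm1; apply: eq_integral => x _; rewrite /= ger0_norm// mulr_ge0.
have E2 (e : T -> R) : (forall x, 0 <= e x) ->
    ('N[m]_2%:E[EFin \o e] * 'N[m]_2%:E[EFin \o e] = \int[m]_x (e x ^+ 2)%:E)%E.
  move=> e0; rewrite -poweR2 ?Lnorm_ge0// powR_Lnorm//; apply: eq_integral => x _.
  by rewrite /= ger0_norm// powR_mulrn.
rewrite -(E2 f f0) -(E2 g g0) -E1 muleACA.
have N0 (e : T -> \bar R) p : (0 <= 'N[m]_p[e])%E by exact: Lnorm_ge0.
apply: (@le_trans _ _ ('N[m]_1[EFin \o (f \* g)%R] * ('N[m]_2%:E[EFin \o f] * 'N[m]_2%:E[EFin \o g])))%E.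
  exact: lee_wpmul2l.
by apply: lee_wpmul2r => //; exact: mule_ge0.
Qed.

(** * The change of variables to [zeta = xi + eta] *)

Section shear.
Context {R : realType} (n : nat).
Notation V := 'rV[R]_n.
Notation C := R[i].
Notation mu := (@rv_measure R n).
Notation mu2 := (prodm (@rv_measure R n) (@rv_measure R n)).

Definition antidiag (zeta eta : V) : V * V := (zeta - eta, eta).

Lemma measurable_antidiag d (T : measurableType d) (f g : T -> V) : measurable_fun setT f ->
  measurable_fun setT g -> measurable_fun setT (fun t => antidiag (f t) (g t)).
Proof.
move=> mf mg; apply: measurable_fun_pair => //; apply: measurable_rv_add => //.
exact: measurable_rv_opp.
Qed.

Lemma integral_antidiag (F : V * V -> \bar R) : measurable_fun setT F -> (forall z, 0 <= F z)%E ->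
  (\int[mu2]_z F z = \int[mu]_zeta \int[mu]_eta F (antidiag zeta eta))%E.
Proof.
move=> mF F0.
have mA : measurable_fun setT (fun p : V * V => F (antidiag p.1 p.2)).
  by apply: (measurableT_comp mF); exact: measurable_antidiag.
rewrite (fubini_tonelli2 _ mF F0) /fubini_G (ge0_fubini mu mu mA (fun p => F0 _)) /=.
apply: eq_integral => eta _.
have ms : measurable_fun setT (fun xi => F (xi, eta)) by exact: (measurableT_comp mF (pair2_measurable eta)).
by rewrite -(ge0_integral_rvD (- eta) ms (fun xi => F0 _)).
Qed.

(** The integral of [h] over the slice of pairs with sum [zeta]; for a tensor product it is the
    convolution of the two factors. *)
Definition convol (h : V * V -> \bar R) (zeta : V) : \bar R := (\int[mu]_eta h (antidiag zeta eta))%E.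

Lemma measurable_convol h : measurable_fun setT h -> (forall z, 0 <= h z)%E -> measurable_fun setT (convol h).
Proof.
move=> mh h0; apply: (measurable_int_section mu (f := fun p : V * V => h (antidiag p.1 p.2))) => //.
by apply: (measurableT_comp mh); exact: measurable_antidiag.
Qed.

Lemma convol_ge0 h zeta : (forall z, 0 <= h z)%E -> (0 <= convol h zeta)%E.
Proof. by move=> h0; exact: integral_ge0. Qed.

(** The kernel sees [z] and [z'] only through their sums. In the variables [zeta], [eta] the
    integrals over [eta] can be carried out first, and what is left is the situation of [schur_wt]
    in [n] variables. *)
Lemma schur_antidiag (h1 h2 : V * V -> \bar R) : measurable_fun setT h1 -> measurable_fun setT h2 ->
  (forall z, 0 <= h1 z)%E -> (forall z, 0 <= h2 z)%E ->
  (\int[mu2]_z \int[mu2]_z' (h1 z * h2 z' * (wt ((z.1 + z.2) - (z'.1 + z'.2)))%:E) <=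
   (\int[mu]_x (wt x)%:E) * (\int[mu]_x (convol h1 x * convol h1 x) + \int[mu]_x (convol h2 x * convol h2 x)))%E.
Proof.
move=> m1 m2 h10 h20.
have c10 x := convol_ge0 x h10; have c20 x := convol_ge0 x h20.
have mc1 := measurable_convol m1 h10; have mc2 := measurable_convol m2 h20.
have mw : measurable_fun setT (fun p : V * V => (wt (p.1 - p.2))%:E).
  apply/measurable_EFinP; apply: (measurableT_comp (@measurable_wt R n)).
  by apply: measurable_rv_add => //; apply: measurable_rv_opp.
have w0 (x : V) : (0 <= (wt x)%:E)%E by rewrite lee_fin wt_ge0.
have aE zeta eta : (antidiag zeta eta).1 + (antidiag zeta eta).2 = zeta by rewrite /= subrK.
have mz2 : measurable_fun setT (fun z : V * V => z.1 + z.2) by exact: measurable_rv_add.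
pose G (zeta : V) := (\int[mu]_zeta' (convol h2 zeta' * (wt (zeta - zeta'))%:E))%E.
have mGi : measurable_fun setT (fun p : V * V => convol h2 p.2 * (wt (p.1 - p.2))%:E)%E.
  by apply: emeasurable_funM => //; exact: (measurableT_comp mc2 measurable_snd).
have Gi0 (p : V * V) : (0 <= convol h2 p.2 * (wt (p.1 - p.2))%:E)%E by exact: mule_ge0.
have mG : measurable_fun setT G by exact: (measurable_int_section mu mGi Gi0).
have G0 x : (0 <= G x)%E by apply: integral_ge0 => y _; exact: (Gi0 (x, y)).
have inner z : (\int[mu2]_z' (h1 z * h2 z' * (wt ((z.1 + z.2) - (z'.1 + z'.2)))%:E) = h1 z * G (z.1 + z.2)%R)%E.
  have mwz : measurable_fun setT (fun z' : V * V => (wt ((z.1 + z.2) - (z'.1 + z'.2)))%:E).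
    apply/measurable_EFinP; apply: (measurableT_comp (@measurable_wt R n)).
    by apply: measurable_rv_add; [exact: measurable_cst|exact: measurable_rv_opp].
  under eq_integral do rewrite -muleA.
  have mhz : measurable_fun setT (fun z' : V * V => h2 z' * (wt ((z.1 + z.2) - (z'.1 + z'.2)))%:E)%E.
    exact: emeasurable_funM.
  have hz0 (z' : V * V) : (0 <= h2 z' * (wt ((z.1 + z.2) - (z'.1 + z'.2)))%:E)%E by exact: mule_ge0.
  rewrite ge0_integralZl//; congr (_ * _)%E.
  rewrite (integral_antidiag mhz hz0); apply: eq_integral => zeta' _.
  under eq_integral do rewrite aE.
  rewrite ge0_integralZr//.
  by apply: (measurableT_comp m2); exact: measurable_antidiag.
under eq_integral do rewrite inner.
have mhG : measurable_fun setT (fun z : V * V => h1 z * G (z.1 + z.2)%R)%E.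
  by apply: emeasurable_funM => //; exact: (measurableT_comp mG mz2).
have hG0 (z : V * V) : (0 <= h1 z * G (z.1 + z.2)%R)%E by exact: mule_ge0.
rewrite (integral_antidiag mhG hG0).
apply: le_trans (schur_wt mc1 mc2 c10 c20).
rewrite le_eqVlt; apply/orP; left; apply/eqP; apply: eq_integral => zeta _.
under eq_integral do rewrite aE.
rewrite ge0_integralZr//; last by apply: (measurableT_comp m1); exact: measurable_antidiag.
rewrite -/(convol h1 zeta) /G -ge0_integralZl//.
- by apply: eq_integral => y _; rewrite muleA.
- exact: (measurableT_comp mGi (pair1_measurable zeta)).
- by move=> y _; exact: (Gi0 (zeta, y)).
Qed.

(** Cauchy-Schwarz on a single slice. It separates the amplitude, whose slice norms are bounded,
    from the transforms, whose squares are to be integrated over all slices. *)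
Lemma convol_sqr (p q : V * V -> R) zeta : measurable_fun setT p -> measurable_fun setT q ->
  (forall z, 0 <= p z) -> (forall z, 0 <= q z) ->
  (convol (fun z => (p z * q z)%:E) zeta * convol (fun z => (p z * q z)%:E) zeta <=
   convol (fun z => (p z ^+ 2)%:E) zeta * convol (fun z => (q z ^+ 2)%:E) zeta)%E.
Proof.
move=> mp mq p0 q0; apply: cauchy_schwarz => //.
  by apply: (measurableT_comp mp); exact: measurable_antidiag.
by apply: (measurableT_comp mq); exact: measurable_antidiag.
Qed.

End shear.

Lemma eqe_le {R : realType} (x y : \bar R) : x = y -> (x <= y)%E.
Proof. by move=> ->. Qed.

(** * The local mean-square estimate *)

Section local_estimate.
Context {R : realType} (n : nat).
Notation V := 'rV[R]_n.
Notation C := R[i].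
Notation mu := (@rv_measure R n).
Notation mu2 := (prodm (@rv_measure R n) (@rv_measure R n)).
Variables (rho : R) (a : V -> V -> V -> C).
Hypothesis rho_gt0 : 0 < rho.
Hypothesis a_symbol : symbol_class 0 rho 0 a.
Hypothesis a_L2 : forall alpha : 'I_n -> nat, exists K : R, forall x0 zeta : V,
  (poweR
    (Nint (fun x : V =>
       (\1_[set y : V | (enorm (y - x0) < 1)%R] x)%:E *
       Nint (fun eta : V =>
         (cabs (Dmulti (@e_x R n) alpha (uncurry3 a) (x, (zeta - eta)%R, eta)) ^+ 2)%:E)))
    (2^-1) <= K%:E)%E.
Notation amp := (amp a).
Notation Z := (V * V)%type.

(* The kernels of [T T^*], as a class on which [oscillatory_decay] operates. *)
Inductive amp_pair : (V * (Z * Z) -> V -> C) -> Prop :=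
| amp_pair_base P1 P2 : amp 1 P1 -> amp 1 P2 ->
    amp_pair (fun j x => P1 j.1 x j.2.1 * conjc (P2 j.1 x j.2.2))
| amp_pair_add P Q : amp_pair P -> amp_pair Q -> amp_pair (fun j x => P j x + Q j x).

Lemma amp_pair_sub P Q : amp_pair P -> amp_pair Q -> amp_pair (fun j x => P j x - Q j x).
Proof.
move=> pP pQ; apply: amp_pair_add => //; elim: pQ => [P1 P2 a1 a2|Q1 Q2 _ h1 _ h2].
  have := amp_pair_base (amp_scale (-1) a1) a2; congr amp_pair.
  by do 2 (apply/funext => ?); rewrite mulN1r mulNr.
rewrite (_ : (fun _ => _) = (fun j x => - Q1 j x + - Q2 j x)); first exact: amp_pair_add.
by do 2 (apply/funext => ?); rewrite opprD.
Qed.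

Lemma amp_pair_der P : amp_pair P -> forall i, exists2 P', amp_pair P' &
  forall j x, cder1 (fun s => P j (x + s *: coordv i)) (fun s => P' j (x + s *: coordv i)).
Proof.
move=> + i; elim => [P1 P2 a1 a2|P1 Q1 _ [P1' aP1 dP1] _ [Q1' aQ1 dQ1]]; last first.
  by exists (fun j x => P1' j x + Q1' j x); [exact: amp_pair_add|move=> j x; exact: cder1D].
have [P1' a1' d1] := amp_dx a_symbol i a1; have [P2' a2' d2] := amp_dx a_symbol i a2.
exists (fun j x => P1' j.1 x j.2.1 * conjc (P2 j.1 x j.2.2) + P1 j.1 x j.2.1 * conjc (P2' j.1 x j.2.2)).
  by apply: amp_pair_add; exact: amp_pair_base.
move=> j x; exact: (cder1M (d1 j.1 x j.2.1) (cder1J (d2 j.1 x j.2.2))).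
Qed.

Lemma amp_pair_bounded P : amp_pair P -> forall j, exists K : R, forall x, cabs (P j x) <= K * wt x.
Proof.
move=> + j; elim => [P1 P2 a1 a2|P1 Q1 _ [K HK] _ [L HL]]; last first.
  by exists (K + L) => x; rewrite (le_trans (cabsD _ _))// mulrDl lerD.
have [K K0 HK] := amp_bounded rho_gt0 a_symbol a1; have [L L0 HL] := amp_bounded rho_gt0 a_symbol a2.
exists (K * L) => x; rewrite cabsM cabsJ.
apply: le_trans (ler_pM (cabs_ge0 _) (cabs_ge0 _) (HK _ _ _) (HL _ _ _)) _.
rewrite !expr1 mulrACA ler_wpM2l ?mulr_ge0// ler_piMl ?wt_ge0 ?wt_le1//.
Qed.

Lemma cmeas_amp_pair d (T : measurableType d) (fx : T -> V) (fz : T -> Z * Z) k P : amp_pair P ->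
  measurable_fun setT fx -> measurable_fun setT fz -> cmeas (fun t => P (k, fz t) (fx t)).
Proof.
move=> pP mx mz; elim: pP => [P1 P2 a1 a2|P1 Q1 _ h1 _ h2]; last exact: cmeasD.
have m1 := measurableT_comp measurable_fst mz; have m2 := measurableT_comp measurable_snd mz.
have mk : measurable_fun setT (fun _ : T => k) by exact: measurable_cst.
have H (Q : V -> V -> Z -> C) (g : T -> Z) : amp 1 Q -> measurable_fun setT g -> cmeas (fun t => Q k (fx t) (g t)).
  move=> aQ mg; rewrite (_ : (fun t => _) = fun t => Q k (fx t) ((g t).1, (g t).2)).
    by apply: (measurable_amp a_symbol aQ) => //; [exact: (measurableT_comp measurable_fst mg)|exact: (measurableT_comp measurable_snd mg)].
  by apply/funext => t; case: (g t).
by apply: cmeasM; [exact: H|apply: cmeasJ; exact: H].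
Qed.

Lemma cmeas_amp_pair_x P : amp_pair P -> forall j, cmeas (P j).
Proof.
move=> pP [k z]; apply: (cmeas_amp_pair k pP (fx := fun x : V => x) (fz := fun=> z)) => //.
Qed.

Definition pair_kernel (U : Z -> R) (p : Z * Z) : R :=
  U p.1 * U p.2 * wt ((p.1.1 + p.1.2) - (p.2.1 + p.2.2)).

Lemma measurable_pair_kernel U : measurable_fun setT U -> measurable_fun setT (pair_kernel U).
Proof.
move=> mU; apply: measurable_funM.
  by apply: measurable_funM; [exact: (measurableT_comp mU measurable_fst)|exact: (measurableT_comp mU measurable_snd)].
have mz2 : measurable_fun setT (fun z : Z => z.1 + z.2) by exact: measurable_rv_add.
apply: (measurableT_comp (@measurable_wt R n)); apply: measurable_rv_add.
  exact: (measurableT_comp mz2 measurable_fst).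
by apply: measurable_rv_opp; exact: (measurableT_comp mz2 measurable_snd).
Qed.

(** After Cauchy-Schwarz on slices the factor with [u] and [v] is independent of [x]. The [x]
    integral of the other factor is bounded uniformly in [zeta] by [amp_L2], and integrating the
    first factor in [zeta] restores the squared norm of the tensor product. *)
Lemma amp_convol_bound P : amp 1 P -> exists2 K : R, 0 <= K & forall k (u v : V -> R),
  measurable_fun setT u -> measurable_fun setT v -> (forall x, 0 <= u x) -> (forall x, 0 <= v x) ->
  (\int[mu]_x \int[mu]_zeta (convol (fun z => (cabs (P k x z) * (u z.1 * v z.2))%:E) zeta *
      convol (fun z => (cabs (P k x z) * (u z.1 * v z.2))%:E) zeta) <=
   K%:E * \int[mu2]_z ((u z.1 * v z.2) ^+ 2)%:E)%E.
Proof.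
move=> aP; have [K K0 HK] := amp_L2 rho_gt0 a_symbol a_L2 aP.
exists K => // k u v m_u m_v u0 v0.
pose q (z : Z) := u z.1 * v z.2.
have mq : measurable_fun setT q.
  by apply: measurable_funM; [exact: (measurableT_comp m_u measurable_fst)|exact: (measurableT_comp m_v measurable_snd)].
have q0 z : 0 <= q z by exact: mulr_ge0.
pose b (zeta : V) := convol (fun z => (q z ^+ 2)%:E) zeta.
have mq2 : measurable_fun setT (fun z => (q z ^+ 2)%:E) by apply/measurable_EFinP; exact: measurable_funX.
have q20 z : (0 <= (q z ^+ 2)%:E)%E by rewrite lee_fin sqr_ge0.
have mb : measurable_fun setT b by exact: measurable_convol.
have b0 zeta : (0 <= b zeta)%E by exact: convol_ge0.
pose A x (zeta : V) := convol (fun z => (cabs (P k x z) ^+ 2)%:E) zeta.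
have mPz d (T : measurableType d) (fx fz fe : T -> V) : measurable_fun setT fx ->
    measurable_fun setT fz -> measurable_fun setT fe ->
    measurable_fun setT (fun t => cabs (P k (fx t) (antidiag (fz t) (fe t)))).
  move=> mx mz me; apply: cmeas_cabs; apply: (measurable_amp a_symbol aP) => //.
  by apply: measurable_rv_add => //; exact: measurable_rv_opp.
have mA3 : measurable_fun setT (fun p : (V * V) * V => (cabs (P k p.1.1 (antidiag p.1.2 p.2)) ^+ 2)%:E).
  apply/measurable_EFinP; apply: measurable_funX; apply: mPz => //.
    exact: (measurableT_comp measurable_fst measurable_fst).
  exact: (measurableT_comp measurable_snd measurable_fst).
have A30 (p : (V * V) * V) : (0 <= (cabs (P k p.1.1 (antidiag p.1.2 p.2)) ^+ 2)%:E)%E by rewrite lee_fin sqr_ge0.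
have mA : measurable_fun setT (fun p : V * V => A p.1 p.2) by exact: (measurable_int_section mu mA3 A30).
have A0 x zeta : (0 <= A x zeta)%E by apply: integral_ge0 => eta _; exact: (A30 ((x, zeta), eta)).
have mH3 : measurable_fun setT (fun p : (V * V) * V =>
    (cabs (P k p.1.1 (antidiag p.1.2 p.2)) * q (antidiag p.1.2 p.2))%:E).
  apply/measurable_EFinP; apply: measurable_funM.
    apply: mPz => //; first exact: (measurableT_comp measurable_fst measurable_fst).
    exact: (measurableT_comp measurable_snd measurable_fst).
  apply: (measurableT_comp mq); apply: measurable_antidiag => //.
  exact: (measurableT_comp measurable_snd measurable_fst).
pose H x (zeta : V) := convol (fun z => (cabs (P k x z) * q z)%:E) zeta.
have H30 (p : (V * V) * V) : (0 <= (cabs (P k p.1.1 (antidiag p.1.2 p.2)) * q (antidiag p.1.2 p.2))%:E)%E.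
  by rewrite lee_fin mulr_ge0// cabs_ge0.
have mH : measurable_fun setT (fun p : V * V => H p.1 p.2) by exact: (measurable_int_section mu mH3 H30).
have mAb : measurable_fun setT (fun p : V * V => A p.1 p.2 * b p.2)%E.
  by apply: emeasurable_funM => //; exact: (measurableT_comp mb measurable_snd).
have Ab0 (p : V * V) : (0 <= A p.1 p.2 * b p.2)%E by exact: mule_ge0.
have mHH : measurable_fun setT (fun p : V * V => H p.1 p.2 * H p.1 p.2)%E by exact: emeasurable_funM.
have H0 x zeta : (0 <= H x zeta)%E by apply: integral_ge0 => eta _; exact: (H30 ((x, zeta), eta)).
have HH0 (p : V * V) : (0 <= H p.1 p.2 * H p.1 p.2)%E by exact: mule_ge0.
apply: (@le_trans _ _ (\int[mu]_x \int[mu]_zeta (A x zeta * b zeta))%E).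
  apply: (ge0_le_integral _ measurableT).
  - by move=> x _; apply: integral_ge0 => zeta _; exact: (HH0 (x, zeta)).
  - exact: (measurable_int_section mu mHH HH0).
  - exact: (measurable_int_section mu mAb Ab0).
  move=> x _; apply: (ge0_le_integral _ measurableT).
  - by move=> zeta _; exact: (HH0 (x, zeta)).
  - exact: (measurableT_comp mHH (pair1_measurable x)).
  - exact: (measurableT_comp mAb (pair1_measurable x)).
  move=> zeta _; apply: convol_sqr => //; last by move=> z; exact: cabs_ge0.
  by apply: cmeas_cabs; exact: cmeas_ampz a_symbol _ _ _ _ aP.
rewrite (ge0_fubini mu mu mAb Ab0) /=.
apply: (@le_trans _ _ (\int[mu]_zeta (K%:E * b zeta))%E).
  apply: ge0_le_integral => //.
  - by move=> zeta _; apply: integral_ge0 => x _; exact: (Ab0 (x, zeta)).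
  - exact: (measurable_int_section mu (f := fun p : V * V => A p.2 p.1 * b p.1)%E (measurableT_comp mAb (@measurable_swap _ _ V V)) (fun p => Ab0 (p.2, p.1))).
  - exact: emeasurable_funM.
  move=> zeta _; rewrite ge0_integralZr//.
    by apply: lee_wpmul2r => //; exact: HK.
  exact: (measurableT_comp mA (pair2_measurable zeta)).
by rewrite ge0_integralZl// (integral_antidiag mq2 q20).
Qed.

Lemma measurable_amp_convol P k (q : Z -> R) : amp 1 P -> measurable_fun setT q -> (forall z, 0 <= q z) ->
  measurable_fun setT (fun x => \int[mu]_zeta (convol (fun z => (cabs (P k x z) * q z)%:E) zeta *
      convol (fun z => (cabs (P k x z) * q z)%:E) zeta))%E.
Proof.
move=> aP mq q0.
have mH3 : measurable_fun setT (fun p : (V * V) * V =>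
    (cabs (P k p.1.1 (antidiag p.1.2 p.2)) * q (antidiag p.1.2 p.2))%:E).
  have m12 : measurable_fun setT (fun p : (V * V) * V => p.1.2) by exact: (measurableT_comp measurable_snd measurable_fst).
  apply/measurable_EFinP; apply: measurable_funM.
    apply: cmeas_cabs; apply: (measurable_amp a_symbol aP) => //.
      exact: (measurableT_comp measurable_fst measurable_fst).
    by apply: measurable_rv_add => //; exact: measurable_rv_opp.
  by apply: (measurableT_comp mq); exact: measurable_antidiag.
have H30 (p : (V * V) * V) : (0 <= (cabs (P k p.1.1 (antidiag p.1.2 p.2)) * q (antidiag p.1.2 p.2))%:E)%E.
  by rewrite lee_fin mulr_ge0// cabs_ge0.
have mH := measurable_int_section mu mH3 H30.
have H0 (p : V * V) : (0 <= convol (fun z => (cabs (P k p.1 z) * q z)%:E) p.2)%E.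
  by apply: integral_ge0 => eta _; exact: (H30 (p, eta)).
apply: (measurable_int_section mu (f := fun p : V * V => convol (fun z => (cabs (P k p.1 z) * q z)%:E) p.2 *
      convol (fun z => (cabs (P k p.1 z) * q z)%:E) p.2)%E).
  by apply: emeasurable_funM; exact: mH.
by move=> p; exact: mule_ge0.
Qed.

(** For a product of two amplitudes and fixed [x], the integrand splits into a function of [z], a
    function of [z'] and the kernel, so [schur_antidiag] applies; the result is then integrated in
    [x] by [amp_convol_bound]. Sums are covered by linearity in [Q]. *)
Lemma amp_pair_bound Q : amp_pair Q -> exists2 K : R, 0 <= K & forall k (u v : V -> R),
  measurable_fun setT u -> measurable_fun setT v -> (forall x, 0 <= u x) -> (forall x, 0 <= v x) ->
  (\int[prodm mu2 mu2]_p ((pair_kernel (fun z => u z.1 * v z.2) p)%:E * \int[mu]_x (cabs (Q (k, p) x))%:E) <=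
   K%:E * \int[mu2]_z ((u z.1 * v z.2) ^+ 2)%:E)%E.
Proof.
have mcQ P k : amp_pair P -> measurable_fun setT (fun t : (Z * Z) * V => (cabs (P (k, t.1) t.2))%:E).
  by move=> pP; apply/measurable_EFinP; apply: cmeas_cabs; exact: (cmeas_amp_pair k pP measurable_snd measurable_fst).
have cQ0 (z : C) : (0 <= (cabs z)%:E)%E by rewrite lee_fin cabs_ge0.
elim => {Q} [P1 P2 a1 a2|P Q pP [K K0 HK] pQ [L L0 HL]]; last first.
  exists (K + L); first exact: addr_ge0.
  move=> k u v m_u m_v u0 v0.
  pose q (z : Z) := u z.1 * v z.2.
  have mq : measurable_fun setT q.
    by apply: measurable_funM; [exact: (measurableT_comp m_u measurable_fst)|exact: (measurableT_comp m_v measurable_snd)].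
  have mk : measurable_fun setT (fun p => (pair_kernel q p)%:E) by apply/measurable_EFinP; exact: measurable_pair_kernel.
  have k0 p : (0 <= (pair_kernel q p)%:E)%E by rewrite lee_fin !mulr_ge0 ?wt_ge0.
  have mIP := measurable_int_section mu (mcQ P k pP) (fun t => cQ0 _).
  have mIQ := measurable_int_section mu (mcQ Q k pQ) (fun t => cQ0 _).
  have mIS := measurable_int_section mu (mcQ _ k (amp_pair_add pP pQ)) (fun t => cQ0 _).
  have i0 (P' : V * (Z * Z) -> V -> C) p : (0 <= \int[mu]_x (cabs (P' (k, p) x))%:E)%E by apply: integral_ge0.
  rewrite (EFinD K) ge0_muleDl ?lee_fin//.
  apply: le_trans (leeD (HK k u v m_u m_v u0 v0) (HL k u v m_u m_v u0 v0)).
  pose IP p := (\int[mu]_x (cabs (P (k, p) x))%:E)%E.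
  pose IQ p := (\int[mu]_x (cabs (Q (k, p) x))%:E)%E.
  pose IS p := (\int[mu]_x (cabs (P (k, p) x + Q (k, p) x))%:E)%E.
  have IS_le p : (IS p <= IP p + IQ p)%E.
    have mPp := measurableT_comp (mcQ P k pP) (pair1_measurable p).
    have mQp := measurableT_comp (mcQ Q k pQ) (pair1_measurable p).
    have mSp := measurableT_comp (mcQ _ k (amp_pair_add pP pQ)) (pair1_measurable p).
    rewrite /IP /IQ -(ge0_integralD mu measurableT (fun x _ => cQ0 _) mPp (fun x _ => cQ0 _) mQp).
    apply: (ge0_le_integral _ measurableT) => [x _|//||x _]; [exact: cQ0|exact: emeasurable_funD|].
    by rewrite -EFinD lee_fin cabsD.
  have e0 (f : Z * Z -> \bar R) : (forall p, 0 <= f p)%E -> forall p, setT p -> (0 <= (pair_kernel q p)%:E * f p)%E.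
    by move=> f0 p _; exact: mule_ge0.
  have eM (f : Z * Z -> \bar R) : measurable_fun setT f -> measurable_fun setT (fun p => (pair_kernel q p)%:E * f p)%E.
    by move=> mf; exact: emeasurable_funM mk mf.
  have IP0 p : (0 <= IP p)%E := i0 P p.
  have IQ0 p : (0 <= IQ p)%E := i0 Q p.
  have IS0 p : (0 <= IS p)%E := i0 (fun j x => P j x + Q j x) p.
  have D := ge0_integralD (prodm mu2 mu2) measurableT (e0 IP IP0) (eM IP mIP) (e0 IQ IQ0) (eM IQ mIQ).
  apply: (@le_trans _ _ _ _ _ _ (eqe_le D)).
  have mD : measurable_fun setT (fun p => (pair_kernel q p)%:E * IP p + (pair_kernel q p)%:E * IQ p)%E.
    by exact: emeasurable_funD (eM IP mIP) (eM IQ mIQ).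
  apply: (ge0_le_integral _ measurableT (e0 IS IS0) (eM IS mIS) mD) => p _.
  by rewrite -ge0_muleDr//; apply: lee_wpmul2l.
have [K1 K10 HK1] := amp_convol_bound a1; have [K2 K20 HK2] := amp_convol_bound a2.
have [mw w0 woo] := @gdom_wt R n.
pose W := fine (\int[mu]_x (wt x)%:E)%E.
have WE : (\int[mu]_x (wt x)%:E)%E = W%:E.
  by rewrite fineK// ge0_fin_numE//; apply: integral_ge0 => x _; rewrite lee_fin.
have W0 : 0 <= W by rewrite fine_ge0//; apply: integral_ge0 => x _; rewrite lee_fin.
exists (W * (K1 + K2)); first by rewrite mulr_ge0// addr_ge0.
move=> k u v m_u m_v u0 v0.
pose q (z : Z) := u z.1 * v z.2.
have mq : measurable_fun setT q.
  by apply: measurable_funM; [exact: (measurableT_comp m_u measurable_fst)|exact: (measurableT_comp m_v measurable_snd)].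
have q0 z : 0 <= q z by exact: mulr_ge0.
have mk : measurable_fun setT (fun p => (pair_kernel q p)%:E) by apply/measurable_EFinP; exact: measurable_pair_kernel.
have k0 p : (0 <= (pair_kernel q p)%:E)%E by rewrite lee_fin !mulr_ge0 ?wt_ge0.
have pb := amp_pair_base a1 a2.
pose F (t : (Z * Z) * V) := ((pair_kernel q t.1)%:E *
  (cabs (P1 k t.2 t.1.1 * conjc (P2 k t.2 t.1.2)))%:E)%E.
have mF : measurable_fun setT F.
  by apply: emeasurable_funM; [exact: (measurableT_comp mk measurable_fst)|exact: (mcQ _ k pb)].
have F0 t : (0 <= F t)%E by apply: mule_ge0 => //; rewrite lee_fin cabs_ge0.
pose h1 x (z : Z) := (cabs (P1 k x z) * q z)%:E.
pose h2 x (z : Z) := (cabs (P2 k x z) * q z)%:E.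
pose I1 x := (\int[mu]_zeta (convol (h1 x) zeta * convol (h1 x) zeta))%E.
pose I2 x := (\int[mu]_zeta (convol (h2 x) zeta * convol (h2 x) zeta))%E.
have mI1 : measurable_fun setT I1 by exact: measurable_amp_convol.
have mI2 : measurable_fun setT I2 by exact: measurable_amp_convol.
have h10 x z : (0 <= h1 x z)%E by rewrite lee_fin mulr_ge0// cabs_ge0.
have h20 x z : (0 <= h2 x z)%E by rewrite lee_fin mulr_ge0// cabs_ge0.
have I10 x : (0 <= I1 x)%E by apply: integral_ge0 => z _; rewrite mule_ge0// convol_ge0.
have I20 x : (0 <= I2 x)%E by apply: integral_ge0 => z _; rewrite mule_ge0// convol_ge0.
have -> : (\int[prodm mu2 mu2]_p ((pair_kernel q p)%:E *
    \int[mu]_x (cabs (P1 (k, p).1 x (k, p).2.1 * conjc (P2 (k, p).1 x (k, p).2.2)))%:E) =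
    \int[prodm mu2 mu2]_p \int[mu]_x F (p, x))%E.
  apply: eq_integral => p _; rewrite -ge0_integralZl//; last first.
    exact: (measurableT_comp (mcQ _ k pb) (pair1_measurable p)).
rewrite (ge0_fubini (prodm mu2 mu2) mu mF F0) /=.
have inner x : (\int[prodm mu2 mu2]_p F (p, x) <= W%:E * (I1 x + I2 x))%E.
  have mFx : measurable_fun setT (fun p => F (p, x)) by exact: (measurableT_comp mF (pair2_measurable x)).
  rewrite (@fubini_tonelli1 _ _ _ _ R mu2 mu2 _ mFx (fun p => F0 (p, x))) /fubini_F.
  have mh (P : V -> V -> Z -> C) : amp 1 P -> measurable_fun setT (fun z => (cabs (P k x z) * q z)%:E).
    move=> aP; apply/measurable_EFinP; apply: measurable_funM => //.
    by apply: cmeas_cabs; exact: cmeas_ampz a_symbol _ _ _ _ aP.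
  have := schur_antidiag (mh _ a1) (mh _ a2) (h10 x) (h20 x); rewrite WE => H.
  apply: le_trans H; rewrite le_eqVlt; apply/orP; left; apply/eqP.
  apply: eq_integral => z _; apply: eq_integral => z' _.
  rewrite /F /pair_kernel /= -!EFinM cabsM cabsJ; congr EFin; ring.
have mI12 : measurable_fun setT (fun x => I1 x + I2 x)%E by exact: (emeasurable_funD mI1 mI2).
apply: (@le_trans _ _ (\int[mu]_x (W%:E * (I1 x + I2 x)))%E).
  apply: (ge0_le_integral _ measurableT).
  - by move=> x _; apply: integral_ge0 => p _; exact: (F0 (p, x)).
  - exact: (measurable_int_section (prodm mu2 mu2) (f := fun t : V * (Z * Z) => F (t.2, t.1)) (measurableT_comp mF (@measurable_swap _ _ V (Z * Z)%type)) (fun t => F0 _)).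
  - exact: (emeasurable_funM (measurable_cst W%:E) mI12).
  - by move=> x _; exact: inner.
have WE0 : (0 <= W%:E)%E by rewrite lee_fin.
have I120 x : setT x -> (0 <= I1 x + I2 x)%E by move=> _; exact: (adde_ge0 (I10 x) (I20 x)).
pose B := (\int[mu2]_z (q z ^+ 2)%:E)%E.
have E1 := ge0_integralZl mu measurableT mI12 I120 WE0.
have E2 := ge0_integralD mu measurableT (fun x _ => I10 x) mI1 (fun x _ => I20 x) mI2.
have b1 : (\int[mu]_x I1 x <= K1%:E * B)%E := HK1 k u v m_u m_v u0 v0.
have b2 : (\int[mu]_x I2 x <= K2%:E * B)%E := HK2 k u v m_u m_v u0 v0.
have E3 : ((W * (K1 + K2))%:E * B = W%:E * (K1%:E * B + K2%:E * B))%E.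
  by rewrite EFinM -muleA (EFinD K1) ge0_muleDl ?lee_fin.
apply: (le_trans (eqe_le E1)); apply: le_trans (eqe_le (esym E3)); rewrite E2.
exact: (lee_wpmul2l WE0 (leeD b1 b2)).
Qed.

Lemma integral_tensor_sqr (u v : V -> R) : measurable_fun setT u -> measurable_fun setT v ->
  (\int[mu2]_z ((u z.1 * v z.2) ^+ 2)%:E = (\int[mu]_x (u x ^+ 2)%:E) * (\int[mu]_x (v x ^+ 2)%:E))%E.
Proof.
move=> m_u m_v.
have mq : measurable_fun setT (fun z : Z => ((u z.1 * v z.2) ^+ 2)%:E).
  apply/measurable_EFinP; apply: measurable_funX; apply: measurable_funM.
    exact: (measurableT_comp m_u measurable_fst).
  exact: (measurableT_comp m_v measurable_snd).
have q0 (z : Z) : (0 <= ((u z.1 * v z.2) ^+ 2)%:E)%E by rewrite lee_fin sqr_ge0.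
have mu2E : measurable_fun setT (fun x => (u x ^+ 2)%:E) by apply/measurable_EFinP; exact: measurable_funX.
have mv2E : measurable_fun setT (fun x => (v x ^+ 2)%:E) by apply/measurable_EFinP; exact: measurable_funX.
have v20 : (0 <= \int[mu]_x (v x ^+ 2)%:E)%E by apply: integral_ge0 => x _; rewrite lee_fin sqr_ge0.
rewrite (@fubini_tonelli1 _ _ _ _ R mu mu _ mq q0) /fubini_F -ge0_integralZr//; last first.
  by move=> x _; rewrite lee_fin sqr_ge0.
apply: eq_integral => x _ /=; rewrite -ge0_integralZl//.
- by apply: eq_integral => y _; rewrite exprMn EFinM.
- by move=> y _; rewrite lee_fin sqr_ge0.
- by rewrite lee_fin sqr_ge0.
Qed.

(** Since [wt] is even, this is the convolution of [wt ^+ 2] with the square of [cabs f], evaluated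
    at [k]. *)
Definition local_energy (f : V -> C) (k : V) : \bar R :=
  (\int[mu]_y ((wt y * cabs (f (y + k)%R)) ^+ 2)%:E)%E.

Lemma local_L2 : exists N, exists2 K : R, 0 <= K & forall (f g : V -> C) k, schwartz f -> schwartz g ->
  (\int[mu]_x ((wt x ^+ N * cabs (Tbil a f g (x + k)%R)) ^+ 2)%:E <=
   K%:E * (local_energy f k * local_energy g k))%E.
Proof.
have [P aP [N HP]] := local_representation rho_gt0 a_symbol.
have pP := amp_pair_base aP aP.
have [Q pQ HQ] := oscillatory_decay amp_pair_bounded cmeas_amp_pair_x amp_pair_der amp_pair_sub pP.
have [K K0 HK] := amp_pair_bound pQ.
have [B B0 HB] := @bessel R n.
exists N; exists (K * (B * B)); first by rewrite !mulr_ge0.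
move=> f g k sf sg.
have sP := sfam_window f; have sQ := sfam_window g.
have [Lf Lf0 HLf] := FT_decay sf k sP; have [Lg Lg0 HLg] := FT_decay sg k sQ.
have [Mf HMf] := sfam_bounded sf sP k; have [Mg HMg] := sfam_bounded sg sQ k.
have mf := sfam_meas sf sP k; have mg := sfam_meas sg sQ k.
pose u xi := cabs (FT (window f k) xi); pose v xi := cabs (FT (window g k) xi).
have m_u : measurable_fun setT u by apply: cmeas_cabs; exact: cmeas_FT.
have m_v : measurable_fun setT v by apply: cmeas_cabs; exact: cmeas_FT.
have u0 xi : 0 <= u xi by exact: cabs_ge0.
have v0 xi : 0 <= v xi by exact: cabs_ge0.
(* The window carries [wt ^+ 2]; dividing by the one weight that [bessel] demands leaves exactly the
   integrand of [local_energy]. *)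
have eE (h : V -> C) : (\int[mu]_y ((cabs (window h k y) * (wt y)^-1) ^+ 2)%:E = local_energy h k)%E.
  apply: eq_integral => y _; rewrite /window cabsM cabs_cofR ger0_norm ?exprn_ge0 ?wt_ge0//.
  by congr (_ ^+ 2)%:E; field; rewrite gt_eqF ?wt_gt0.
have bu := HB _ _ _ mf HMf HLf; have bv := HB _ _ _ mg HMg HLg.
rewrite !eE in bu bv.
pose T x := CI mu2 (fun z => P k x z * phase2 x z * FT2 (window f k) (window g k) z).
have TE : (\int[mu]_x ((wt x ^+ N * cabs (Tbil a f g (x + k)%R)) ^+ 2)%:E = \int[mu]_x (cabs (T x) ^+ 2)%:E)%E.
  apply: eq_integral => x _; rewrite /T -(HP f g k x sf sg) cabsM cabs_cofR ger0_norm//.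
  by rewrite exprn_ge0 ?wt_ge0.
have [KP KP0 HKP] := amp_bounded rho_gt0 a_symbol aP.
have mth : measurable_fun setT (fun z : Z => z.1 + z.2) by exact: measurable_rv_add.
have mPz : cmeas (fun p : V * Z => P k p.1 p.2).
  rewrite (_ : (fun p => _) = fun p : V * Z => P k p.1 (p.2.1, p.2.2)); last by apply/funext => -[x [xi eta]].
  apply: (measurable_amp a_symbol aP) => //.
    exact: (measurableT_comp measurable_fst measurable_snd).
  exact: (measurableT_comp measurable_snd measurable_snd).
have bPz x z : cabs (P k x z) <= KP * wt x by have := HKP k x z; rewrite expr1.
have mQz : cmeas (fun p : (Z * Z) * V => Q (k, p.1) p.2).
  exact: (cmeas_amp_pair k pQ measurable_snd measurable_fst).
have iQz p : cintg mu (Q (k, p)).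
  exact: (Dcintg amp_pair_bounded cmeas_amp_pair_x (k, p) pQ).
have hQz p := HQ (k, p) ((p.1.1 + p.1.2) - (p.2.1 + p.2.2)).
have mU : cmeas (FT2 (window f k) (window g k)).
  by apply: cmeasM; [exact: (cmeas_comp (cmeas_FT mf) measurable_fst)|exact: (cmeas_comp (cmeas_FT mg) measurable_snd)].
have gG := gdom_prod (gdomZ Lf0 (gdom_wt n)) (gdomZ Lg0 (gdom_wt n)).
have UG z : cabs (FT2 (window f k) (window g k) z) <= (Lf * wt z.1) * (Lg * wt z.2).
  by rewrite cabsM; apply: ler_pM; rewrite ?cabs_ge0.
(* The Schwartz constants [Lf] and [Lg] enter only through the integrability hypothesis and
   disappear from the bound. *)
have tts := tt_star mth mPz bPz mQz iQz hQz mU gG UG.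
rewrite TE; apply: le_trans tts _.
have := HK k u v m_u m_v u0 v0.
rewrite (integral_tensor_sqr m_u m_v) => H.
apply: (@le_trans _ _ (K%:E * (\int[mu]_x (u x ^+ 2)%:E * \int[mu]_x (v x ^+ 2)%:E))%E).
  apply: le_trans H; apply: eqe_le; apply: eq_integral => p _.
  by rewrite /pair_kernel /FT2 !cabsM.
have K0E : (0 <= K%:E)%E by rewrite lee_fin.
have i0 (h : V -> R) : (0 <= \int[mu]_x (h x ^+ 2)%:E)%E by apply: integral_ge0 => x _; rewrite lee_fin sqr_ge0.
rewrite (EFinM K) (EFinM B) -muleA; apply: (lee_wpmul2l K0E).
rewrite muleACA; exact: (lee_pmul (i0 u) (i0 v) bu bv).
Qed.

End local_estimate.

(** * From local to global bounds *)

Section holder_tools.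
Context {R : realType}.

Lemma poweR_le (x y : \bar R) (s : R) : 0 <= s -> (0 <= x)%E -> (x <= y)%E -> (x `^ s <= y `^ s)%E.
Proof.
move=> s0 x0 xy; apply: gt0_ler_poweR => //; rewrite in_itv/= ?leey ?x0//.
by rewrite andbT (le_trans x0 xy).
Qed.

Lemma poweR_inv (x : \bar R) (s : R) : s != 0 -> (0 <= x)%E -> ((x `^ s) `^ s^-1 = x)%E.
Proof. by move=> s0 x0; rewrite -poweRrM mulfV// poweRe1. Qed.

Lemma poweR_invK (x : \bar R) (s : R) : s != 0 -> (0 <= x)%E -> ((x `^ s^-1) `^ s = x)%E.
Proof. by move=> s0 x0; rewrite -poweRrM mulVf// poweRe1. Qed.

(** Hoelder's inequality for the splitting of [w * h] into [w ^ (1/t)] and [w ^ (1/s) * h], with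
    [1/t + 1/s = 1]. The power of [c] accounts for a weight that is not a probability density. At
    [s = 1] the conjugate exponent is infinite, hence the separate case. *)
Lemma jensen_powR d (T : measurableType d) (m : {measure set T -> \bar R}) (w h : T -> R) (s c : R) :
  1 <= s -> measurable_fun setT w -> measurable_fun setT h ->
  (forall x, 0 <= w x) -> (forall x, 0 <= h x) -> 0 <= c ->
  (\int[m]_x (w x)%:E <= c%:E)%E ->
  ((\int[m]_x (w x * h x)%:E) `^ s <= (c `^ (s - 1))%:E * \int[m]_x (w x * h x `^ s)%:E)%E.
Proof.
move=> s1 mw mh w0 h0 c0 wc.
have I0 : (0 <= \int[m]_x (w x * h x)%:E)%E by apply: integral_ge0 => x _; rewrite lee_fin mulr_ge0.
have := s1; rewrite le_eqVlt => /predU1P[<-|s1'].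
  rewrite subrr powRr0 mul1e poweRe1//; apply: eqe_le; apply: eq_integral => x _.
  by rewrite powRr1.
have s0 : 0 < s by rewrite (lt_trans _ s1').
have sn0 : s != 0 by rewrite gt_eqF.
have s10 : 0 < s - 1 by rewrite subr_gt0.
pose t := s / (s - 1).
have t0 : 0 < t by rewrite divr_gt0.
have ts : t^-1 + s^-1 = 1 by rewrite /t; field; rewrite sn0 gt_eqF.
pose F x := w x `^ t^-1; pose G x := w x `^ s^-1 * h x.
have mF : measurable_fun setT F by exact: (measurableT_comp (measurable_powR _) mw).
have mG : measurable_fun setT G.
  by apply: measurable_funM => //; exact: (measurableT_comp (measurable_powR _) mw).
have G0 x : 0 <= G x by rewrite mulr_ge0// powR_ge0.
have FG x : F x * G x = w x * h x.
  rewrite /F /G mulrA -powRD; last by rewrite ts oner_eq0.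
  by rewrite ts powRr1.
have H := hoelder m mF mG t0 s0 ts.
have N1 : ('N[m]_1[EFin \o (F \* G)%R] = \int[m]_x (w x * h x)%:E)%E.
  rewrite Lnorm1; apply: eq_integral => x _ /=.
  by rewrite FG ger0_norm// mulr_ge0.
rewrite N1 in H.
apply: le_trans (poweR_le (ltW s0) I0 H) _.
rewrite poweRM ?Lnorm_ge0// powR_Lnorm//.
have -> : (\int[m]_x (`|(EFin \o G) x| `^ s) = \int[m]_x (w x * h x `^ s)%:E)%E.
  apply: eq_integral => x _ /=; rewrite ger0_norm// /G powRM ?powR_ge0//.
  by rewrite -powRrM mulVf// powRr1.
have -> : ('N[m]_t%:E[EFin \o F] `^ s = (\int[m]_x (w x)%:E) `^ (s - 1))%E.
  rewrite (_ : s = t * (s - 1)); last by rewrite /t; field; rewrite gt_eqF.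
  rewrite poweRrM powR_Lnorm ?gt_eqF//; congr (_ `^ _)%E.
    apply: eq_integral => x _ /=; rewrite ger0_norm ?powR_ge0// /F -powRrM mulVf ?gt_eqF//.
    by rewrite powRr1.
  by rewrite /t; field; rewrite gt_eqF.
apply: lee_wpmul2r; first by apply: integral_ge0 => x _; rewrite lee_fin mulr_ge0// powR_ge0.
by rewrite -poweR_EFin; apply: poweR_le => //; [exact: ltW|apply: integral_ge0 => x _; rewrite lee_fin].
Qed.

(** With the [k] integral carried out first, translation invariance makes it independent of [x]. *)
Lemma integral_avg n (w : 'rV[R]_n -> R) (F : 'rV[R]_n -> \bar R) :
  measurable_fun setT w -> (forall x, 0 <= w x) -> measurable_fun setT F -> (forall x, 0 <= F x)%E ->
  (\int[rv_measure n]_k \int[rv_measure n]_x ((w x)%:E * F (x + k)%R) =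
   (\int[rv_measure n]_x (w x)%:E) * \int[rv_measure n]_x F x)%E.
Proof.
move=> mw w0 mF F0.
have mwE : measurable_fun setT (EFin \o w) by apply/measurable_EFinP.
have mG : measurable_fun setT (fun p : 'rV[R]_n * 'rV[R]_n => (w p.2)%:E * F (p.2 + p.1)%R)%E.
  apply: emeasurable_funM; first exact: (measurableT_comp mwE measurable_snd).
  by apply: (measurableT_comp mF); exact: measurable_rv_add.
have w0E x : (0 <= (w x)%:E)%E by rewrite lee_fin.
have G0 (p : 'rV[R]_n * 'rV[R]_n) : (0 <= (w p.2)%:E * F (p.2 + p.1)%R)%E by exact: mule_ge0.
have IF0 : (0 <= \int[rv_measure n]_x F x)%E by exact: integral_ge0.
rewrite (ge0_fubini (rv_measure n) (rv_measure n) mG G0) /=.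
rewrite -(ge0_integralZr (rv_measure n) measurableT mwE (fun x _ => w0E x) IF0).
apply: eq_integral => x _.
have mFx : measurable_fun setT (fun k => F (x + k)%R).
  by apply: (measurableT_comp mF); apply: measurable_rv_add => //; exact: measurable_cst.
rewrite (ge0_integralZl (rv_measure n) measurableT mFx (fun k _ => F0 _) (w0E x)); congr (_ * _)%E.
by rewrite -(ge0_integral_rvD x mF F0); apply: eq_integral => k _; rewrite addrC.
Qed.

End holder_tools.

(** * Integrals of powers of the local energies *)

Section energy.
Context {R : realType} (n : nat).
Notation V := 'rV[R]_n.
Notation C := R[i].
Notation mu := (@rv_measure R n).

Definition wt_mass : R := fine (\int[mu]_x (wt x)%:E)%E.

Lemma wt_massE : (\int[mu]_x (wt x)%:E)%E = wt_mass%:E.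
Proof.
have [_ w0 woo] := @gdom_wt R n.
by rewrite fineK// ge0_fin_numE//; apply: integral_ge0 => x _; rewrite lee_fin.
Qed.

Lemma wt_mass_ge0 : 0 <= wt_mass.
Proof. by rewrite fine_ge0//; apply: integral_ge0 => x _; rewrite lee_fin wt_ge0. Qed.

Lemma integral_wtX N : (\int[mu]_x (wt x ^+ N.+1)%:E <= wt_mass%:E)%E.
Proof.
rewrite -wt_massE; apply: (ge0_le_integral _ measurableT).
- by move=> x _; rewrite lee_fin exprn_ge0// wt_ge0.
- by apply/measurable_EFinP; apply: measurable_funX; exact: measurable_wt.
- by apply/measurable_EFinP; exact: measurable_wt.
- move=> x _; rewrite lee_fin exprS ler_piMr ?wt_ge0// exprn_ile1 ?wt_ge0 ?wt_le1//.
Qed.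

Lemma measurable_cabs_schwartz (f : V -> C) : schwartz f -> measurable_fun setT (fun x => cabs (f x)).
Proof.
move=> sf; apply: cmeas_cabs.
by have [cr ci] := smoothC_cont sf.1; split; exact: continuous_measurable_rv.
Qed.

Lemma schwartz_bounded (f : V -> C) : schwartz f -> exists2 M : R, 0 <= M & forall x, cabs (f x) <= M.
Proof.
move=> sf; have [K HK] := sfam_bounded sf (sfam_shift f) 0.
have K0 : 0 <= K by rewrite -(pmulr_lge0 K (wt_gt0 (0 : V))) (le_trans _ (HK 0))// cabs_ge0.
exists K => // x; have := HK x; rewrite addr0 => /le_trans; apply.
by rewrite ler_piMr// wt_le1.
Qed.

Lemma local_energy_ge0 (f : V -> C) k : (0 <= local_energy f k)%E.
Proof. by apply: integral_ge0 => y _; rewrite lee_fin sqr_ge0. Qed.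

Lemma measurable_energy_integrand (f : V -> C) : schwartz f ->
  measurable_fun setT (fun p : V * V => ((wt p.2 * cabs (f (p.2 + p.1)%R)) ^+ 2)%:E).
Proof.
move=> sf; apply/measurable_EFinP; apply: measurable_funX; apply: measurable_funM.
  exact: (measurableT_comp (@measurable_wt R n) measurable_snd).
by apply: (measurableT_comp (measurable_cabs_schwartz sf)); exact: measurable_rv_add.
Qed.

Lemma measurable_local_energy (f : V -> C) : schwartz f -> measurable_fun setT (local_energy f).
Proof.
move=> sf; apply: (measurable_int_section mu (measurable_energy_integrand sf)) => p.
by rewrite lee_fin sqr_ge0.
Qed.

Lemma local_energy_le (f : V -> C) k (M : R) : schwartz f -> 0 <= M ->
  (forall x, cabs (f x) <= M) -> (local_energy f k <= (M ^+ 2 * wt_mass)%:E)%E.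
Proof.
move=> sf M0 HM; rewrite EFinM -wt_massE -ge0_integralZl//; last 3 first.
- by apply/measurable_EFinP; exact: measurable_wt.
- by move=> x _; rewrite lee_fin wt_ge0.
- by rewrite lee_fin sqr_ge0.
apply: (ge0_le_integral _ measurableT).
- by move=> x _; rewrite lee_fin sqr_ge0.
- exact: (measurableT_comp (measurable_energy_integrand sf) (pair1_measurable k)).
- by apply: emeasurable_funM => //; apply/measurable_EFinP; exact: measurable_wt.
move=> x _; rewrite -EFinM lee_fin exprMn mulrC; apply: ler_pM; rewrite ?sqr_ge0//.
  by rewrite ler_sqr ?nnegrE ?cabs_ge0.
by rewrite expr2 ler_piMl ?wt_ge0 ?wt_le1.
Qed.

Lemma local_energy_fin (f : V -> C) k : schwartz f -> local_energy f k \is a fin_num.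
Proof.
move=> sf; have [M M0 HM] := schwartz_bounded sf.
rewrite ge0_fin_numE ?local_energy_ge0//; apply: le_lt_trans (local_energy_le k sf M0 HM) _.
exact: ltry.
Qed.

(** Jensen's inequality with weight [wt ^+ 2] and exponent [p / 2], which is at least one because
    [p >= 2]; averaging over [k] then removes the window. Both steps contribute a power of the mass
    of [wt]. *)
Lemma integral_energy_powR (p : R) : 2 <= p -> exists2 K : R, 0 <= K & forall f : V -> C, schwartz f ->
  (\int[mu]_k (local_energy f k `^ (p / 2)) <= K%:E * \int[mu]_x (cabs (f x) `^ p)%:E)%E.
Proof.
move=> p2; have s1 : 1 <= p / 2 by rewrite ler_pdivlMr// mul1r.
exists (wt_mass `^ (p / 2 - 1) * wt_mass); first by rewrite mulr_ge0 ?powR_ge0 ?wt_mass_ge0.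
move=> f sf; have mf := measurable_cabs_schwartz sf.
have mw2 : measurable_fun setT (fun x : V => wt x ^+ 2) by apply: measurable_funX; exact: measurable_wt.
have w20 (x : V) : 0 <= wt x ^+ 2 by exact: sqr_ge0.
have mfp : measurable_fun setT (fun x => (cabs (f x) `^ p)%:E).
  by apply/measurable_EFinP; exact: (measurableT_comp (measurable_powR p) mf).
have fp0 x : (0 <= (cabs (f x) `^ p)%:E)%E by rewrite lee_fin powR_ge0.
have key k : (local_energy f k `^ (p / 2) <= (wt_mass `^ (p / 2 - 1))%:E *
    \int[mu]_x ((wt x ^+ 2)%:E * (cabs (f (x + k)%R) `^ p)%:E))%E.
  have mfk : measurable_fun setT (fun x : V => cabs (f (x + k)) ^+ 2).
    by apply: measurable_funX; exact: (measurableT_comp mf (measurable_rvD k)).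
  have := jensen_powR s1 mw2 mfk w20 (fun x => sqr_ge0 _) wt_mass_ge0 (integral_wtX 1).
  have -> : (\int[mu]_x (wt x ^+ 2 * cabs (f (x + k)%R) ^+ 2)%:E = local_energy f k)%E.
    by apply: eq_integral => x _; rewrite exprMn.
  have -> : (\int[mu]_x (wt x ^+ 2 * (cabs (f (x + k)%R) ^+ 2) `^ (p / 2))%:E =
      \int[mu]_x ((wt x ^+ 2)%:E * (cabs (f (x + k)%R) `^ p)%:E))%E.
    apply: eq_integral => x _; rewrite -EFinM; congr (_ * _)%:E.
    by rewrite -powR_mulrn ?cabs_ge0// -powRrM; congr (_ `^ _); field.
  by [].
have mE := measurable_local_energy sf.
have m2 : measurable_fun setT (fun q : V * V => (wt q.2 ^+ 2)%:E * (cabs (f (q.2 + q.1)%R) `^ p)%:E)%E.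
  apply: emeasurable_funM.
    by apply/measurable_EFinP; exact: (measurableT_comp mw2 measurable_snd).
  apply/measurable_EFinP; apply: (measurableT_comp (measurable_powR p)); apply: (measurableT_comp mf).
  exact: measurable_rv_add.
have m20 (q : V * V) : (0 <= (wt q.2 ^+ 2)%:E * (cabs (f (q.2 + q.1)%R) `^ p)%:E)%E.
  by apply: mule_ge0 => //; rewrite lee_fin.
have mI := measurable_int_section mu m2 m20.
have I0 k : (0 <= \int[mu]_x ((wt x ^+ 2)%:E * (cabs (f (x + k)%R) `^ p)%:E))%E.
  by apply: integral_ge0 => x _; exact: (m20 (k, x)).
have c0 : (0 <= (wt_mass `^ (p / 2 - 1))%:E)%E by rewrite lee_fin powR_ge0.
apply: (@le_trans _ _ (\int[mu]_k ((wt_mass `^ (p / 2 - 1))%:E *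
    \int[mu]_x ((wt x ^+ 2)%:E * (cabs (f (x + k)%R) `^ p)%:E)))%E).
  apply: (ge0_le_integral _ measurableT) => //.
  - by move=> k _; exact: poweR_ge0.
  - exact: (measurableT_comp (measurable_poweR _) mE).
  - exact: (emeasurable_funM (measurable_cst _) mI).
rewrite (ge0_integralZl mu measurableT mI (fun k _ => I0 k) c0) (integral_avg mw2 w20 mfp fp0).
rewrite EFinM -muleA; apply: lee_wpmul2l => //; apply: lee_wpmul2r; last exact: (integral_wtX 1).
exact: integral_ge0.
Qed.

End energy.

(** * From windows to the whole operator *)

Section reduction.
Context {R : realType} (n : nat).
Notation V := 'rV[R]_n.
Notation C := R[i].
Notation mu := (@rv_measure R n).
Notation mu2 := (prodm (@rv_measure R n) (@rv_measure R n)).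

(** On the unit ball the weight is at least [2^-n], and the ball has positive volume. *)
Lemma integral_wtX_gt0 N : (0 < \int[mu]_x (wt x ^+ N)%:E)%E.
Proof.
have mw : measurable_fun setT (EFin \o (fun x : V => wt x ^+ N)).
  by apply/measurable_EFinP; apply: measurable_funX; exact: measurable_wt.
have w0 (x : V) : setT x -> (0 <= (wt x ^+ N)%:E)%E by rewrite lee_fin exprn_ge0// wt_ge0.
have c0 : (0 <= ((2 ^+ n) ^+ N : R)%:E)%E by rewrite lee_fin !exprn_ge0.
have H : (@ball_vol R n <= ((2 ^+ n) ^+ N)%:E * \int[mu]_x (wt x ^+ N)%:E)%E.
  rewrite -(ge0_integralZl mu measurableT mw w0 c0); apply: (ge0_le_integral _ measurableT).
  - by move=> x _; rewrite lee_fin ballI_ge0.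
  - by apply/measurable_EFinP; exact: measurable_ballI.
  - exact: (emeasurable_funM (measurable_cst _) mw).
  move=> x _; rewrite -EFinM lee_fin -exprMn.
  have b := ballI_le_wt 0 x; rewrite subr0 in b.
  apply: (@le_trans _ _ (ballI 0 x ^+ N)).
    by rewrite ballIE; case: (_ < _); rewrite ?expr1n// exprn_ge0.
  by apply: lerXn2r => //; rewrite nnegrE ?ballI_ge0// mulr_ge0 ?exprn_ge0 ?wt_ge0.
have := lt_le_trans (@ball_vol_gt0 R n) H.
rewrite [X in (0 < X)%E]muleC; set I := integral _ _ _ => H0.
rewrite lt_neqAle (integral_ge0 _ w0) andbT; apply/eqP => I0.
by move: H0; rewrite -/I -I0 mul0e ltxx.
Qed.

Lemma integral_tail_gt0 : (0 < mu setT)%E.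
Proof.
have := @integral_wtX_gt0 0; under eq_integral do rewrite expr0.
by rewrite integral_cst// mul1e.
Qed.

Variables (rho : R) (a : V -> V -> V -> C).
Hypothesis rho_gt0 : 0 < rho.
Hypothesis a_symbol : symbol_class 0 rho 0 a.
Hypothesis a_L2 : forall alpha : 'I_n -> nat, exists K : R, forall x0 zeta : V,
  (poweR
    (Nint (fun x : V =>
       (\1_[set y : V | (enorm (y - x0) < 1)%R] x)%:E *
       Nint (fun eta : V =>
         (cabs (Dmulti (@e_x R n) alpha (uncurry3 a) (x, (zeta - eta)%R, eta)) ^+ 2)%:E)))
    (2^-1) <= K%:E)%E.

Lemma cmeas_Tbil (f g : V -> C) : schwartz f -> schwartz g -> cmeas (Tbil a f g).
Proof.
move=> sf sg.
rewrite (_ : Tbil a f g = fun x => CI mu2 (fun z => da a [::] [::] [::] (x, z.1, z.2) * phase2 x z * FT2 f g z)); last first.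
  by apply/funext => x; exact: (TbilE rho_gt0 a_symbol).
have cf (h : V -> C) : schwartz h -> cmeas (FT h).
  by move=> sh; apply: cmeas_FT; have [cr ci] := smoothC_cont sh.1; split; exact: continuous_measurable_rv.
apply: (cmeas_CI mu2 (h := fun p : V * (V * V) => da a [::] [::] [::] (p.1, p.2.1, p.2.2) * phase2 p.1 p.2 * FT2 f g p.2)).
have m21 : measurable_fun setT (fun p : V * (V * V) => p.2.1) by exact: (measurableT_comp measurable_fst measurable_snd).
have m22 : measurable_fun setT (fun p : V * (V * V) => p.2.2) by exact: (measurableT_comp measurable_snd measurable_snd).
apply: cmeasM; last by apply: cmeasM; [exact: (cmeas_comp (cf f sf) m21)|exact: (cmeas_comp (cf g sg) m22)].
apply: cmeasM.
  apply: (cmeas_comp (cmeas_da a_symbol [::] [::] [::])).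
  by apply: measurable_fun_pair => //; exact: measurable_fun_pair.
by apply: cmeas_expi; apply: measurable_dotv => //; exact: measurable_rv_add.
Qed.

(** On each window the mean square of [Tbil] controls its integral of order [r], by Jensen's
    inequality with exponent [s = 2 / r], which is at least one because [r <= 2]. Integrating in [k]
    recovers the global integral up to the mass of the window. *)
Lemma integral_Tbil_powR (r : R) : 1 <= r -> r <= 2 -> exists2 K : R, 0 <= K &
  forall f g : V -> C, schwartz f -> schwartz g ->
  (\int[mu]_x (cabs (Tbil a f g x) `^ r)%:E <=
   K%:E * \int[mu]_k (local_energy f k `^ (r / 2) * local_energy g k `^ (r / 2)))%E.
Proof.
move=> r1 r2; have r0 : 0 < r by rewrite (lt_le_trans _ r1).
have [N [K K0 HK]] := local_L2 rho_gt0 a_symbol a_L2.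
pose s := 2 / r.
have s1 : 1 <= s by rewrite ler_pdivlMr// mul1r.
have s0 : 0 < s by rewrite (lt_le_trans _ s1).
(* At most [(wt x ^+ N) ^+ 2], as [local_L2] requires; the extra factors make it integrable whatever
   [N] is. *)
pose w (x : V) := wt x ^+ (2 * N).+2.
have mw : measurable_fun setT w by apply: measurable_funX; exact: measurable_wt.
have w0 x : 0 <= w x by rewrite exprn_ge0// wt_ge0.
have wm : (\int[mu]_x (w x)%:E <= (wt_mass n)%:E)%E by exact: integral_wtX.
have wgt : (0 < \int[mu]_x (w x)%:E)%E by exact: integral_wtX_gt0.
pose c := fine (\int[mu]_x (w x)%:E)%E.
have cE : (\int[mu]_x (w x)%:E)%E = c%:E.
  by rewrite fineK// ge0_fin_numE ?(ltW wgt)//; apply: le_lt_trans wm _; exact: ltry.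
have c0 : 0 < c by rewrite -lte_fin -cE.
pose L := (((wt_mass n) `^ (s - 1)) * K) `^ s^-1.
(* [L] is the constant of the estimate on one window. The factor [c^-1] is there because averaging
   over [k] multiplies the global integral by [c]. *)
exists (c^-1 * L); first by rewrite mulr_ge0 ?powR_ge0// invr_ge0 ltW.
move=> f g sf sg.
have mT := cmeas_cabs (cmeas_Tbil sf sg).
have mTr : measurable_fun setT (fun x => (cabs (Tbil a f g x) `^ r)%:E).
  by apply/measurable_EFinP; exact: (measurableT_comp (measurable_powR r) mT).
have Tr0 x : (0 <= (cabs (Tbil a f g x) `^ r)%:E)%E by rewrite lee_fin powR_ge0.
have key k : (\int[mu]_x ((w x)%:E * (cabs (Tbil a f g (x + k)%R) `^ r)%:E) <=
    L%:E * (local_energy f k `^ (r / 2) * local_energy g k `^ (r / 2)))%E.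
  pose h (x : V) := cabs (Tbil a f g (x + k)) `^ r.
  have mTk : measurable_fun setT (fun x : V => cabs (Tbil a f g (x + k))) by exact: (measurableT_comp mT (measurable_rvD k)).
  have mh : measurable_fun setT h by exact: (measurableT_comp (measurable_powR r) mTk).
  have h0 x : 0 <= h x by exact: powR_ge0.
  have I0 : (0 <= \int[mu]_x (w x * h x)%:E)%E by apply: integral_ge0 => x _; rewrite lee_fin mulr_ge0.
  have J := jensen_powR s1 mw mh w0 h0 (wt_mass_ge0 n) wm.
  have Q : (\int[mu]_x (w x * h x `^ s)%:E <= K%:E * (local_energy f k * local_energy g k))%E.
    apply: le_trans (HK f g k sf sg); apply: (ge0_le_integral _ measurableT).
    - by move=> x _; rewrite lee_fin mulr_ge0// powR_ge0.
    - by apply/measurable_EFinP; apply: measurable_funM => //; exact: (measurableT_comp (measurable_powR s) mh).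
    - apply/measurable_EFinP; apply: measurable_funX; apply: measurable_funM => //.
      by apply: measurable_funX; exact: measurable_wt.
    move=> x _; rewrite lee_fin /h -powRrM (_ : r * s = 2); last by rewrite /s; field; rewrite gt_eqF.
    rewrite powR_mulrn ?cabs_ge0// exprMn ler_wpM2r ?sqr_ge0// -exprM.
    by apply: ler_wiXn2l; rewrite ?wt_ge0 ?wt_le1// mulnC; do 2 apply: leqW.
  have EE (e : R) : (e%:E `^ s^-1 = (e `^ s^-1)%:E)%E by exact: poweR_EFin.
  have -> : (\int[mu]_x ((w x)%:E * (cabs (Tbil a f g (x + k)%R) `^ r)%:E) = \int[mu]_x (w x * h x)%:E)%E.
    by apply: eq_integral => x _; rewrite EFinM.
  (* Jensen's inequality bounds the power [s] of the left-hand side, so the left-hand side is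
     rewritten as the root of that power. *)
  rewrite -[leLHS](@poweR_inv _ _ s) ?gt_eqF//.
  have sV0 : 0 <= s^-1 by rewrite invr_ge0 ltW.
  have c1 : (0 <= ((wt_mass n) `^ (s - 1))%:E)%E by rewrite lee_fin powR_ge0.
  have J2 := le_trans J (lee_wpmul2l c1 Q).
  apply: le_trans (poweR_le sV0 (poweR_ge0 _ _) J2) _.
  have Ef := local_energy_ge0 f k; have Eg := local_energy_ge0 g k.
  rewrite muleA -EFinM poweRM ?lee_fin ?mulr_ge0 ?powR_ge0 ?mule_ge0// poweRM// EE.
  by rewrite /L (_ : s^-1 = r / 2)// /s invf_div.
have A := integral_avg mw w0 mTr Tr0.
rewrite cE in A.
have mEr (e : V -> C) : schwartz e -> measurable_fun setT (fun k => local_energy e k `^ (r / 2))%E.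
  by move=> se; exact: (measurableT_comp (measurable_poweR _) (measurable_local_energy se)).
have mEE : measurable_fun setT (fun k => local_energy f k `^ (r / 2) * local_energy g k `^ (r / 2))%E.
  exact: (emeasurable_funM (mEr f sf) (mEr g sg)).
have EE0 k : setT k -> (0 <= local_energy f k `^ (r / 2) * local_energy g k `^ (r / 2))%E.
  by move=> _; apply: mule_ge0; exact: poweR_ge0.
have L0 : (0 <= L%:E)%E by rewrite lee_fin powR_ge0.
rewrite EFinM -muleA lee_pdivlMl// -A -(ge0_integralZl mu measurableT mEE EE0 L0).
have mA : measurable_fun setT (fun q : V * V => (w q.2)%:E * (cabs (Tbil a f g (q.2 + q.1)%R) `^ r)%:E)%E.
  apply: emeasurable_funM; first by apply/measurable_EFinP; exact: (measurableT_comp mw measurable_snd).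
  by apply: (measurableT_comp mTr); exact: measurable_rv_add.
have A0 (q : V * V) : (0 <= (w q.2)%:E * (cabs (Tbil a f g (q.2 + q.1)%R) `^ r)%:E)%E.
  by apply: mule_ge0; rewrite lee_fin ?powR_ge0.
apply: (ge0_le_integral _ measurableT).
- by move=> k _; apply: integral_ge0 => x _; exact: (A0 (k, x)).
- exact: (measurable_int_section mu mA A0).
- exact: (emeasurable_funM (measurable_cst _) mEE).
- by move=> k _; exact: key.
Qed.

End reduction.

(** * Norms of the statement and Hoelder's inequality for the energies *)

Section norms.
Context {R : realType} (n : nat).
Notation V := 'rV[R]_n.
Notation C := R[i].
Notation mu := (@rv_measure R n).

Lemma LpnormE (p : R) (h : V -> C) : measurable_fun setT (fun x => cabs (h x)) ->
  Lpnorm p%:E h = ((\int[mu]_x (cabs (h x) `^ p)%:E) `^ p^-1)%E.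
Proof.
move=> mh; rewrite /Lpnorm NintE//.
  by apply/measurable_EFinP; exact: (measurableT_comp (measurable_powR p) mh).
by move=> x; rewrite lee_fin powR_ge0.
Qed.

Lemma lbnE (A : set V) : measurable A -> lebn A = mu A.
Proof.
move=> mA; rewrite /lebn NintE.
- by rewrite integral_indic// setIT.
- by apply/measurable_EFinP; exact: measurable_indic.
- by move=> x; rewrite lee_fin.
Qed.

Lemma measurable_superlevel (f : V -> C) (M : \bar R) : schwartz f ->
  measurable [set x | (M < (cabs (f x))%:E)%E].
Proof.
move=> sf; have mE : measurable_fun setT (fun x => (cabs (f x))%:E).
  by apply/measurable_EFinP; exact: measurable_cabs_schwartz.
rewrite -[X in measurable X]setTI; exact: (emeasurable_fun_o_infty measurableT mE).
Qed.

(** The infimum ranges over all extended reals. A negative level is not admissible, because its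
    superlevel set is the whole space, which has positive measure. *)
Lemma esssup_ge0 (f : V -> C) : schwartz f -> (0 <= esssup f)%E.
Proof.
move=> sf; apply: le_ereal_inf_tmp => M /= M0; rewrite leNgt; apply/negP => Mlt0.
have := @integral_tail_gt0 R n; rewrite -M0 lbnE; last exact: measurable_superlevel.
rewrite (_ : [set x | _] = setT) ?ltxx//; apply/seteqP; split => // x _ /=.
by apply: lt_le_trans Mlt0 _; rewrite lee_fin cabs_ge0.
Qed.

Lemma local_energy_superlevel (f : V -> C) k (M : R) : schwartz f -> 0 <= M ->
  lebn [set x | (M%:E < (cabs (f x))%:E)%E] = 0%E ->
  (local_energy f k <= (M ^+ 2 * wt_mass n)%:E)%E.
Proof.
move=> sf M0; rewrite lbnE; last exact: measurable_superlevel.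
set A := [set x | _] => mA0.
have mA : measurable A by exact: measurable_superlevel.
have mwk : measurable_fun setT (fun y : V => wt (y - k)).
  by apply: (measurableT_comp (@measurable_wt R n)); exact: (measurable_rvD (- k)).
have mF : measurable_fun setT (fun y : V => ((wt (y - k)%R * cabs (f y)) ^+ 2)%:E).
  apply/measurable_EFinP; apply: measurable_funX; apply: measurable_funM => //.
  exact: measurable_cabs_schwartz.
have F0 (y : V) : (0 <= ((wt (y - k)%R * cabs (f y)) ^+ 2)%:E)%E by rewrite lee_fin sqr_ge0.
(* The translation is moved onto the weight, so that the exceptional null set is [A] for every
   [k]. *)
have -> : local_energy f k = (\int[mu]_y ((wt (y - k)%R * cabs (f y)) ^+ 2)%:E)%E.
  by rewrite -(ge0_integral_rvD k mF F0); apply: eq_integral => y _; rewrite addrK.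
have wE : (M ^+ 2 * wt_mass n)%:E = (\int[mu]_y (M ^+ 2 * wt (y - k)%R)%:E)%E.
  rewrite EFinM -wt_massE -(ge0_integral_rvD (- k) (f := fun y : V => (wt y)%:E)).
  - rewrite -ge0_integralZl//.
    + exact/measurable_EFinP.
    + by move=> y _; rewrite lee_fin wt_ge0.
    + by rewrite lee_fin sqr_ge0.
  - by apply/measurable_EFinP; exact: measurable_wt.
  - by move=> y; rewrite lee_fin wt_ge0.
rewrite wE; apply: ae_ge0_le_integral => //.
- by move=> y _; rewrite lee_fin mulr_ge0 ?sqr_ge0 ?wt_ge0.
- by apply/measurable_EFinP; exact: measurable_funM.
exists A; split => // y /=; apply: contra_notP => /negP; rewrite -leNgt lee_fin => fM _.
rewrite lee_fin exprMn mulrC; apply: ler_pM; rewrite ?sqr_ge0//.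
  by rewrite ler_sqr ?nnegrE ?cabs_ge0.
by rewrite expr2 ler_piMl ?wt_ge0 ?wt_le1.
Qed.

(* [esssup f] is an infimum, so the bound on the energy is first turned into a lower
   bound, [sqrt (energy / mass) <= M], valid for every admissible [M]. *)
Lemma local_energy_esssup (f : V -> C) k : schwartz f ->
  (local_energy f k <= (wt_mass n + 1)%:E * (esssup f * esssup f))%E.
Proof.
(* Adding one to the mass makes the divisor positive without knowing that the mass is. *)
move=> sf; have W0 : 0 < @wt_mass R n + 1 by rewrite ltr_wpDl// wt_mass_ge0.
pose e := fine (local_energy f k).
have eE : local_energy f k = e%:E by rewrite fineK// local_energy_fin.
have e0 : 0 <= e by rewrite fine_ge0// local_energy_ge0.
pose t := Num.sqrt (e / (wt_mass n + 1)).
have t0 : 0 <= t by exact: sqrtr_ge0.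
have et : e = (wt_mass n + 1) * t ^+ 2.
  by rewrite sqr_sqrtr ?divr_ge0// ?(ltW W0)// mulrCA mulfV ?mulr1// gt_eqF.
have tle : (t%:E <= esssup f)%E.
  apply: le_ereal_inf_tmp => M MS.
  have M0 : (0 <= M)%E by apply: le_trans (esssup_ge0 sf) _; exact: ereal_inf_lbound.
  move: M M0 MS => [M| |]// M0 MS; last exact: leey.
  rewrite lee_fin in M0; have := local_energy_superlevel k sf M0 MS.
  rewrite eE !lee_fin et => H.
  rewrite -ler_sqr ?nnegrE//.
  have H2 : (wt_mass n + 1) * t ^+ 2 <= (wt_mass n + 1) * M ^+ 2.
    by apply: le_trans H _; rewrite mulrC ler_wpM2r ?sqr_ge0// lerDl.
  by rewrite ler_pM2l in H2.
rewrite eE et EFinM; apply: lee_wpmul2l; first by rewrite lee_fin ltW.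
by rewrite expr2 EFinM; apply: lee_pmul; rewrite ?lee_fin.
Qed.

Lemma Lpnorm_ge0 (p : \bar R) (f : V -> C) : schwartz f -> (2%:E <= p)%E -> (0 <= Lpnorm p f)%E.
Proof. by case: p => [p| |]// sf _; [exact: poweR_ge0|exact: esssup_ge0]. Qed.

(** The exponents [r / 2] and [p / r] multiply to [p / 2], so the power [p / r] of the norm is the
    integral bounded in [integral_energy_powR]; taking the root back turns the integral of [f] into
    [Lpnorm] to the power [r]. *)
Lemma energy_Lnorm (p r : R) : 2 <= p -> 1 <= r -> exists2 K : R, 0 <= K & forall f : V -> C, schwartz f ->
  ('N[mu]_(p / r)%:E[EFin \o (fun k => (fine (local_energy f k) `^ (r / 2))%R)] <= K%:E * (Lpnorm p%:E f) `^ r)%E.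
Proof.
move=> p2 r1; have p0 : 0 < p by rewrite (lt_le_trans _ p2).
have r0 : 0 < r by rewrite (lt_le_trans _ r1).
have [K K0 HK] := integral_energy_powR n p2.
have pr0 : 0 < p / r by exact: divr_gt0.
exists (K `^ (p / r)^-1); first exact: powR_ge0.
move=> f sf.
have F0 : (0 <= \int[mu]_x (cabs (f x) `^ p)%:E)%E by apply: integral_ge0 => x _; rewrite lee_fin powR_ge0.
rewrite (LpnormE _ (measurable_cabs_schwartz sf)) -poweRrM (_ : p^-1 * r = (p / r)^-1); last by rewrite invf_div mulrC.
rewrite -poweR_EFin -poweRM ?lee_fin//.
rewrite -[leLHS](@poweR_inv _ _ (p / r)) ?gt_eqF ?Lnorm_ge0//.
apply: poweR_le; [by rewrite invr_ge0 ltW|exact: poweR_ge0|].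
apply: le_trans (HK f sf); rewrite powR_Lnorm ?gt_eqF//; apply: eqe_le; apply: eq_integral => k _.
rewrite -[in RHS](fineK (local_energy_fin k sf)) poweR_EFin /= ger0_norm ?powR_ge0//.
by rewrite -powRrM; congr (_ `^ _)%:E; field; rewrite gt_eqF.
Qed.

(* Hoelder with exponents [p / r] and [q / r]; if one of [p], [q] is infinite then the
   other one and [r] are both [2]. *)
Lemma integral_energies (p q : \bar R) (r : R) : (2%:E <= p)%E -> (2%:E <= q)%E -> 1 <= r -> r <= 2 ->
  einv p + einv q = r^-1 -> exists2 K : R, 0 <= K & forall f g : V -> C, schwartz f -> schwartz g ->
  (\int[mu]_k (local_energy f k `^ (r / 2) * local_energy g k `^ (r / 2)) <=
   K%:E * (Lpnorm p f `^ r * Lpnorm q g `^ r))%E.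
Proof.
move=> p2 q2 r1 r2; have r0 : 0 < r by rewrite (lt_le_trans _ r1).
have infinite (s : R) : 2 <= s -> s^-1 = r^-1 -> exists2 K : R, 0 <= K & forall f g : V -> C,
    schwartz f -> schwartz g -> (\int[mu]_k (local_energy f k `^ (r / 2) * local_energy g k `^ (r / 2)) <=
    K%:E * (Lpnorm +oo%E f `^ r * Lpnorm s%:E g `^ r))%E.
  move=> s2 /invr_inj sr; have rE : r = 2 by apply/eqP; rewrite eq_le r2 -sr s2.
  rewrite sr rE.
  have [K K0 HK] := integral_energy_powR n (lexx (2 : R)).
  exists ((@wt_mass R n + 1) * K); first by rewrite mulr_ge0 ?addr_ge0 ?wt_mass_ge0.
  move=> f g sf sg.
  have h22 : 2 / 2 = 1 :> R by rewrite divff.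
  have E1 (e : V -> C) k : (local_energy e k `^ (2 / 2) = local_energy e k)%E.
    by rewrite h22 poweRe1// local_energy_ge0.
  have mg := measurable_local_energy sg; have mf := measurable_local_energy sf.
  have e0 := esssup_ge0 sf.
  have G0 : (0 <= \int[mu]_x (cabs (g x) `^ 2)%:E)%E by apply: integral_ge0 => x _; rewrite lee_fin powR_ge0.
  have W0 : (0 <= (wt_mass n + 1)%:E * (esssup f * esssup f))%E.
    by rewrite !mule_ge0// lee_fin addr_ge0// wt_mass_ge0.
  rewrite (LpnormE _ (measurable_cabs_schwartz sg)) poweR_invK// /Lpnorm poweR2//.
  under eq_integral do rewrite !E1.
  apply: (@le_trans _ _ (\int[mu]_k ((wt_mass n + 1)%:E * (esssup f * esssup f) * local_energy g k))%E).
    apply: (ge0_le_integral _ measurableT).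
    - by move=> k _; apply: mule_ge0; exact: local_energy_ge0.
    - exact: (emeasurable_funM mf mg).
    - exact: (emeasurable_funM (measurable_cst _) mg).
    - by move=> k _; apply: lee_wpmul2r; [exact: local_energy_ge0|exact: local_energy_esssup].
  rewrite (ge0_integralZl mu measurableT mg (fun k _ => local_energy_ge0 g k) W0).
  have HKg : (\int[mu]_k local_energy g k <= K%:E * \int[mu]_x (cabs (g x) `^ 2)%:E)%E.
    by apply: le_trans (HK g sg); apply: eqe_le; apply: eq_integral => k _; rewrite E1.
  apply: le_trans (lee_wpmul2l W0 HKg) _; apply: eqe_le.
  by rewrite EFinM -!muleA; congr (_ * _)%E; rewrite muleCA; congr (_ * _)%E; rewrite muleCA.
case: p p2 => [p| |]// p2; case: q q2 => [q| |]// q2 /=.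
- move=> pq; rewrite !lee_fin in p2 q2.
  have p0 : 0 < p by rewrite (lt_le_trans _ p2).
  have q0 : 0 < q by rewrite (lt_le_trans _ q2).
  have pq1 : (p / r)^-1 + (q / r)^-1 = 1.
    by rewrite !invf_div !(mulrC r) -mulrDl pq mulVf// gt_eqF.
  have [Kp Kp0 HKp] := energy_Lnorm p2 r1; have [Kq Kq0 HKq] := energy_Lnorm q2 r1.
  exists (Kp * Kq); first exact: mulr_ge0.
  move=> f g sf sg.
  have mE (e : V -> C) : schwartz e -> measurable_fun setT (fun k => fine (local_energy e k) `^ (r / 2)).
    move=> se; apply: (measurableT_comp (measurable_powR _)).
    by apply: (measurableT_comp _ (measurable_local_energy se)); exact: fine_measurable.
  have H := hoelder mu (mE f sf) (mE g sg) (divr_gt0 p0 r0) (divr_gt0 q0 r0) pq1.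
  have pE (e : V -> C) k : schwartz e -> (local_energy e k `^ (r / 2) = (fine (local_energy e k) `^ (r / 2))%:E)%E.
    by move=> se; rewrite -[in LHS](fineK (local_energy_fin k se)) poweR_EFin.
  have -> : (\int[mu]_k (local_energy f k `^ (r / 2) * local_energy g k `^ (r / 2)) =
      'N[mu]_1[EFin \o ((fun k => (fine (local_energy f k) `^ (r / 2))%R) \* (fun k => (fine (local_energy g k) `^ (r / 2))%R))%R])%E.
    rewrite Lnorm1; apply: eq_integral => k _ /=; rewrite ger0_norm ?mulr_ge0 ?powR_ge0//.
    by rewrite (pE f k sf) (pE g k sg) -EFinM.
  apply: (le_trans H).
  rewrite (EFinM Kp Kq) muleACA; apply: lee_pmul; [exact: Lnorm_ge0|exact: Lnorm_ge0|exact: HKp|exact: HKq].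
(* The estimate for an infinite first exponent is applied with [f] and [g] exchanged. *)
- rewrite addr0 => pr; have [K K0 HK] := infinite p p2 pr; exists K => // f g sf sg.
  rewrite [X in (_ <= _ * X)%E]muleC; apply: le_trans (HK g f sg sf); apply: eqe_le.
  by apply: eq_integral => k _; rewrite muleC.
- by rewrite add0r => qr; exact: infinite q q2 qr.
(* Two infinite exponents would give [r^-1 = 0]. *)
- by rewrite addr0 => r00; move: r0; rewrite -invr_gt0 -r00 ltxx.
Qed.

End norms.

Theorem theorem6p2 (R : realType) (n : nat) (rho : R)
    (a : 'rV[R]_n -> 'rV[R]_n -> 'rV[R]_n -> R[i]) :
  0 < rho -> rho <= 1 ->
  symbol_class 0 rho 0 a ->
  (forall alpha : 'I_n -> nat, exists K : R, forall x0 zeta : 'rV[R]_n,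
     (poweR
       (Nint (fun x : 'rV[R]_n =>
          (\1_[set y : 'rV[R]_n | enorm (y - x0) < 1] x)%:E *
          Nint (fun eta : 'rV[R]_n =>
            (cabs (Dmulti (@e_x R n) alpha (uncurry3 a) (x, zeta - eta, eta))
               ^+ 2)%:E)))
       (2^-1) <= K%:E)%E) ->
  forall (p q : \bar R) (r : R),
    (2%:E <= p)%E -> (2%:E <= q)%E -> 1 <= r -> r <= 2 ->
    einv p + einv q = r^-1 ->
    exists K : R, forall f g : 'rV[R]_n -> R[i],
      schwartz f -> schwartz g ->
      (Lpnorm r%:E (Tbil a f g) <= K%:E * Lpnorm p f * Lpnorm q g)%E.
Proof.
move=> rho_gt0 _ a_symbol a_L2 p q r p2 q2 r1 r2 pqr.
have r0 : 0 < r by rewrite (lt_le_trans _ r1).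
have [K K0 HK] := integral_Tbil_powR rho_gt0 a_symbol a_L2 r1 r2.
have [L L0 HL] := @integral_energies R n p q r p2 q2 r1 r2 pqr.
(* Both bounds concern powers of order [r]; the constant is the root of their product. *)
exists ((K * L) `^ r^-1) => f g sf sg.
have nf := Lpnorm_ge0 sf p2; have ng := Lpnorm_ge0 sg q2.
rewrite LpnormE; last exact: cmeas_cabs (cmeas_Tbil rho_gt0 a_symbol sf sg).
have K0E : (0 <= K%:E)%E by rewrite lee_fin.
have H := le_trans (HK f g sf sg) (lee_wpmul2l K0E (HL f g sf sg)).
have I0 : (0 <= \int[rv_measure n]_x (cabs (Tbil a f g x) `^ r)%:E)%E.
  by apply: integral_ge0 => x _; rewrite lee_fin powR_ge0.
have rV0 : 0 <= r^-1 by rewrite invr_ge0 ltW.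
apply: le_trans (poweR_le rV0 I0 H) _.
rewrite muleA -EFinM poweRM ?mule_ge0 ?poweR_ge0 ?lee_fin ?mulr_ge0//.
rewrite poweRM ?poweR_ge0// !poweR_inv ?gt_eqF// poweR_EFin muleA.
exact: lexx.
Qed.
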